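(* For $G=C_2$ and for $G=C_3$, there is a one-to-one correspondence between biased permutative $G$-categories and algebras over the operad $\mathcal Q_G$ in $G$-categories.
   Context: **Permutations.** $\Sigma_n$ is the symmetric group on $\{1,\dots,n\}$, with product $\sigma\tau$ meaning ''first $\tau$, then $\sigma$''; $(1\ 2\ 3)$ is the cycle $1\mapsto2\mapsto3\mapsto1$. For $\sigma\in\Sigma_n$ and $k_1,\dots,k_n\ge 0$ with $k=\sum k_i$, split $\{1,\dots,k\}$ into $n$ consecutive (possibly empty) blocks of sizes $k_1,\dots,k_n$; $\sigma\langle k_1,\dots,k_n\rangle\in\Sigma_k$ sends the $i$-th element of the $j$-th block to $i+\sum_{l:\sigma(l)<\sigma(j)}k_l$. For $\tau_j\in\Sigma_{k_j}$, $\tau_1\oplus\dots\oplus\tau_n$ permutes by $\tau_j$ within the $j$-th block, and $\sigma\langle\tau_1,\dots,\tau_n\rangle=\sigma\langle k_1,\dots,k_n\rangle\cdot(\tau_1\oplus\dots\oplus\tau_n)$. **The operad $P_G$.** $P_G$ is the operad in $G$-sets with $P_G(n)$ the set of all functions $f\colon G\to\Sigma_n$, $n\ge0$; $(g\cdot f)(h)=f(hg)$, $(f\cdot\sigma)(h)=f(h)\sigma$, $\gamma(f;f_1,\dots,f_n)(h)=f(h)\langle f_1(h),\dots,f_n(h)\rangle$, and the operadic identity is the unique $\mathbb 1\in P_G(1)$. **$Q_G$ and $\mathcal Q_G$.** Fix a generator $g$ of $G$. $Q_G\subseteq P_G$ is the smallest suboperad (closed under the $G$- and $\Sigma_n$-actions,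 containing $\mathbb 1$, and closed under $\gamma$) containing: the unique $e\in P_G(0)$; $\otimes\in P_G(2)$, constant at $1_{\Sigma_2}$; and $\boxtimes$, where for $G=C_2$, $\boxtimes\in P_{C_2}(2)$ has $\boxtimes(1)=1_{\Sigma_2}$, $\boxtimes(g)=(1\ 2)$, and for $G=C_3$, $\boxtimes\in P_{C_3}(3)$ has $\boxtimes(1)=1_{\Sigma_3}$, $\boxtimes(g)=(1\ 2\ 3)$, $\boxtimes(g^2)=(1\ 3\ 2)$. $\mathcal Q_G=\widetilde{Q_G}$ is the operad in $G$-categories with $\mathcal Q_G(n)$ the category having object set $Q_G(n)$ and exactly one morphism between any two objects, with induced structure. **Algebras.** A $G$-category is a small category with a strict left action of $G$ by functors. An algebra over an operad $\mathcal O$ in $G$-categories is a $G$-category $X$ with $G$-equivariant functors $\mu_n\colon\mathcal O(n)\times X^n\to X$ ($n\ge0$), where $G$ acts diagonally on the source, satisfying (on objects and morphisms) $\mu_n(f\cdot\sigma;x_1,\dots,x_n)=\mu_n(f;x_{\sigma^{-1}(1)},\dots,x_{\sigma^{-1}(n)})$ and the usual strict compatibilities with $\gamma$ and $\mathbb 1$. **Permutative category.** $(\mathcal C,\otimes,e,\beta)$: a category $\mathcal C$, an object $e$, a functor $\otimes\colon\mathcal C\times\mathcal C\to\mathcal C$, strictly associative with $e$ a strict two-sided unit, and a natural isomorphism $\beta_{a,b}\colon a\otimes b\to b\otimes a$ such that $\beta_{a,e}=\mathrm{id}_a$, $\beta_{b,a}\circ\beta_{a,b}=\mathrm{id}$,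 and $\beta_{a\otimes b,c}=(\beta_{a,c}\otimes\mathrm{id}_b)\circ(\mathrm{id}_a\otimes\beta_{b,c})$ for all $a,b,c$. **Biased permutative $C_2$-category.** It consists of: a $C_2$-category $\mathcal C$; a $C_2$-fixed object $e$; a $C_2$-equivariant functor $\otimes\colon\mathcal C\times\mathcal C\to\mathcal C$; a nonequivariant (i.e. not required to be equivariant) functor $\boxtimes\colon\mathcal C\times\mathcal C\to\mathcal C$; a $C_2$-natural isomorphism $\beta$ with components $\beta_{a,b}\colon a\otimes b\to b\otimes a$ (so $g\cdot\beta_{a,b}=\beta_{ga,gb}$); and a nonequivariant natural isomorphism $\upsilon$ with components $\upsilon_{a,b}\colon a\boxtimes b\to a\otimes b$, such that: (i) $(\mathcal C,\otimes,e,\beta)$ is a permutative category; (ii) $e$ is a strict two-sided unit for $\boxtimes$: $e\boxtimes a=a=a\boxtimes e$ and $\upsilon_{e,a}=\mathrm{id}_a=\upsilon_{a,e}$ for all $a$; (iii) $\boxtimes$ is strictly associative, $a\boxtimes(b\boxtimes c)=(a\boxtimes b)\boxtimes c$, and $(\mathrm{id}_a\otimes\upsilon_{b,c})\circ\upsilon_{a,b\boxtimes c}=(\upsilon_{a,b}\otimes\mathrm{id}_c)\circ\upsilon_{a\boxtimes b,c}$ for all $a,b,c$; (iv) $g\cdot(a\boxtimes b)=(g\cdot b)\boxtimes(g\cdot a)$ for all $a,b$, and similarly for morphisms; (v) $g\cdot\upsilon_{a,b}=\beta_{gb,ga}\circ\upsilon_{gb,ga}$ for all $a,b$. **Biased permutative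 $C_3$-category.** It consists of: a $C_3$-category $\mathcal C$; a $C_3$-fixed object $e$; a $C_3$-equivariant functor $\otimes\colon\mathcal C\times\mathcal C\to\mathcal C$; a functor $\boxtimes\colon\mathcal C\times\mathcal C\times\mathcal C\to\mathcal C$ (not required to be equivariant); a $C_3$-natural isomorphism $\beta$ with components $\beta_{a,b}\colon a\otimes b\to b\otimes a$; and a nonequivariant natural isomorphism $\upsilon$ with components $\upsilon_{a,b,c}\colon\boxtimes(a,b,c)\to(a\otimes b)\otimes c$. The *primitive binary operations* $\diamondsuit$ are $\otimes$ and the three functors obtained by inserting $e$ in one position of $\boxtimes$: $\boxtimes(e,a,b)$, $\boxtimes(a,e,b)$, $\boxtimes(a,b,e)$. Each of the latter three has an associated $\upsilon^\diamondsuit_{a,b}\colon a\diamondsuit b\to a\otimes b$, namely $\upsilon_{e,a,b}$, $\upsilon_{a,e,b}$, $\upsilon_{a,b,e}$ respectively; for $\diamondsuit=\otimes$, $\upsilon^\diamondsuit$ is the identity. The axioms are: (i) $(\mathcal C,\otimes,e,\beta)$ is a permutative category; (ii) $e\diamondsuit a=a=a\diamondsuit e$ for all $a$ and all primitive binary operations $\diamondsuit$, and $\upsilon_{e,e,a}=\upsilon_{e,a,e}=\upsilon_{a,e,e}=\mathrm{id}_a$; (iii) for all $a,b,c$ and all primitive binary operations $\diamondsuit$: $a\diamondsuit(b\diamondsuit c)=(a\diamondsuit b)\diamondsuit c$ and $(\mathrm{id}_a\otimes\upsilon^\diamondsuit_{b,c})\circ\upsilon^\diamondsuit_{a,b\diamondsuit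 c}=(\upsilon^\diamondsuit_{a,b}\otimes\mathrm{id}_c)\circ\upsilon^\diamondsuit_{a\diamondsuit b,c}$; (iv) $g\cdot\boxtimes(a,b,c)=\boxtimes(g\cdot c,g\cdot a,g\cdot b)$ for all $a,b,c$, and similarly for morphisms; (v) $g\cdot\upsilon_{a,b,c}=\beta_{gc,\,ga\otimes gb}\circ\upsilon_{gc,ga,gb}$ for all $a,b,c$. *)

(* Defs.v *)
From mathcomp Require Import all_boot all_order all_fingroup.
From mathcomp Require Import boolp.
Set Implicit Arguments. Unset Strict Implicit. Unset Printing Implicit Defensive.

(* A small category has a type of objects and a single type of all morphisms,
   with a composition defined on composable pairs: [compm f g H] is "g, then f".
   Strict equalities between composite functors, on objects and on morphisms,
   are then plain equalities, without transport along equalities of objects. *)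
Record category := Category {
  Ob :> Type;
  Mor : Type;
  src : Mor -> Ob;
  tgt : Mor -> Ob;
  idm : Ob -> Mor;
  compm : forall f g : Mor, src f = tgt g -> Mor;
  src_idm : forall a, src (idm a) = a;
  tgt_idm : forall a, tgt (idm a) = a;
  src_comp : forall f g (H : src f = tgt g), src (compm H) = src g;
  tgt_comp : forall f g (H : src f = tgt g), tgt (compm H) = tgt f;
  comp_idl : forall f (H : src (idm (tgt f)) = tgt f), compm H = f;
  comp_idr : forall f (H : src f = tgt (idm (src f))), compm H = f;
  comp_assoc : forall f g h (H1 : src g = tgt h) (H2 : src f = tgt (compm H1))
      (H3 : src f = tgt g) (H4 : src (compm H3) = tgt h), compm H2 = compm H4
}.
Arguments Mor : clear implicits.
Arguments src {_} _.
Arguments tgt {_} _.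
Arguments idm {_} _.
Arguments compm {_} f g _.

Definition is_comp (C : category) (f g h : Mor C) : Prop :=
  exists H : src f = tgt g, compm f g H = h.

(* Both composites [f o g] and [f' o g'] are defined, and they agree. *)
Definition comm_square (C : category) (f g f' g' : Mor C) : Prop :=
  exists2 h, is_comp f g h & is_comp f' g' h.

Definition is_iso (C : category) (f : Mor C) : Prop :=
  exists g, is_comp f g (idm (tgt f)) /\ is_comp g f (idm (src f)).

Record functor (C D : category) := Functor {
  fob :> C -> D;
  fmor : Mor C -> Mor D;
  src_fmor : forall f, src (fmor f) = fob (src f);
  tgt_fmor : forall f, tgt (fmor f) = fob (tgt f);
  fmor_id : forall a, fmor (idm a) = idm (fob a);
  fmor_comp : forall f g (H : src f = tgt g) (H' : src (fmor f) = tgt (fmor g)),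
      fmor (compm f g H) = compm (fmor f) (fmor g) H'
}.

Record natural_iso (C D : category) (F G : functor C D) (t : C -> Mor D) : Prop := {
  nat_src : forall a, src (t a) = F a;
  nat_tgt : forall a, tgt (t a) = G a;
  nat_square : forall f : Mor C,
      comm_square (fmor G f) (t (src f)) (t (tgt f)) (fmor F f);
  nat_is_iso : forall a, is_iso (t a)
}.

Section Constructions.

Lemma comp_eq (C : category) (f f' g g' : Mor C) (H : src f = tgt g)
    (H' : src f' = tgt g') : f = f' -> g = g' -> compm f g H = compm f' g' H'.
Proof.
move=> ef eg; case: _ / ef in H' *; case: _ / eg in H' *.
by rewrite (Prop_irrelevance H H').
Qed.

Definition id_functor (C : category) : functor C C.
Proof.
refine (@Functor C C (fun a => a) (fun f => f) _ _ _ _) => //.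
by move=> f g H H'; apply: comp_eq.
Defined.

Definition comp_functor (C D E : category) (F : functor D E) (G : functor C D) :
  functor C E.
Proof.
refine (@Functor C E (fun a => F (G a)) (fun f => fmor F (fmor G f)) _ _ _ _).
- by move=> f; rewrite !src_fmor.
- by move=> f; rewrite !tgt_fmor.
- by move=> a; rewrite !fmor_id.
- move=> f g H H'.
  have H1 : src (fmor G f) = tgt (fmor G g) by rewrite src_fmor tgt_fmor H.
  by rewrite (fmor_comp H H1) (fmor_comp H1 H').
Defined.

Definition prod_category (C D : category) : category.
Proof.
refine (@Category (C * D) (Mor C * Mor D)
  (fun f => (src f.1, src f.2)) (fun f => (tgt f.1, tgt f.2))
  (fun a => (idm a.1, idm a.2))
  (fun f g H => (compm f.1 g.1 (congr1 fst H), compm f.2 g.2 (congr1 snd H)))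
  _ _ _ _ _ _ _).
- by case=> a b; rewrite /= !src_idm.
- by case=> a b; rewrite /= !tgt_idm.
- by move=> f g H; rewrite /= !src_comp.
- by move=> f g H; rewrite /= !tgt_comp.
- by case=> f1 f2 H /=; rewrite !comp_idl.
- by case=> f1 f2 H /=; rewrite !comp_idr.
- move=> f g h H1 H2 H3 H4; congr pair; exact: comp_assoc.
Defined.

Definition pi_category (I : Type) (C : I -> category) : category.
Proof.
refine (@Category (forall i, C i) (forall i, Mor (C i))
  (fun f i => src (f i)) (fun f i => tgt (f i)) (fun a i => idm (a i))
  (fun f g H i => compm (f i) (g i) (congr1 (fun u => u i) H))
  _ _ _ _ _ _ _).
- by move=> a; apply: functional_extensionality_dep => i; rewrite src_idm.
- by move=> a; apply: functional_extensionality_dep => i; rewrite tgt_idm.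
- by move=> f g H; apply: functional_extensionality_dep => i; rewrite src_comp.
- by move=> f g H; apply: functional_extensionality_dep => i; rewrite tgt_comp.
- by move=> f H; apply: functional_extensionality_dep => i; rewrite comp_idl.
- by move=> f H; apply: functional_extensionality_dep => i; rewrite comp_idr.
- move=> f g h H1 H2 H3 H4; apply: functional_extensionality_dep => i.
  exact: comp_assoc.
Defined.

Definition prod_functor (C C' D D' : category) (F : functor C D)
    (G : functor C' D') : functor (prod_category C C') (prod_category D D').
Proof.
refine (@Functor (prod_category C C') (prod_category D D')
  (fun a => (F a.1, G a.2)) (fun f => (fmor F f.1, fmor G f.2)) _ _ _ _).
- by move=> f; rewrite /= !src_fmor.
- by move=> f; rewrite /= !tgt_fmor.
- by move=> a; rewrite /= !fmor_id.
- by move=> f g H H'; congr pair; apply: fmor_comp.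
Defined.

Definition swap_functor (C D : category) :
  functor (prod_category C D) (prod_category D C).
Proof.
refine (@Functor (prod_category C D) (prod_category D C)
  (fun a => (a.2, a.1)) (fun f => (f.2, f.1)) _ _ _ _) => //.
by move=> f g H H'; congr pair; apply: comp_eq.
Defined.

(* The category with object type [T] and exactly one morphism, the pair
   [(a, b)], from [a] to [b]. *)
Definition chaotic (T : Type) : category.
Proof.
refine (@Category T (T * T) fst snd (fun a => (a, a))
  (fun f g _ => (g.1, f.2)) _ _ _ _ _ _ _) => //.
- by case=> a b.
- by case=> a b.
Defined.

Definition to_chaotic (C : category) (T : Type) (u : C -> T) :
  functor C (chaotic T).
Proof.
refine (@Functor C (chaotic T) u (fun f => (u (src f), u (tgt f))) _ _ _ _) => //.
- by move=> a; rewrite /= src_idm tgt_idm.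
- by move=> f g H H'; rewrite /= src_comp tgt_comp.
Defined.

End Constructions.

Record gcategory (gT : finGroupType) := GCategory {
  gcat :> category;
  gcat_act : gT -> functor gcat gcat;
  act1_ob : forall a, gcat_act 1%g a = a;
  act1_mor : forall f, fmor (gcat_act 1%g) f = f;
  actM_ob : forall h k a, gcat_act (h * k)%g a = gcat_act h (gcat_act k a);
  actM_mor : forall h k f, fmor (gcat_act (h * k)%g) f = fmor (gcat_act h) (fmor (gcat_act k) f)
}.
Arguments gcat_act {_ _} _.

(* The structure maps of an operad in G-categories.  The notion of an algebra
   refers to these maps only; the operad axioms do not enter its definition. *)
Record operad_data (gT : finGroupType) := OperadData {
  op : nat -> gcategory gT;
  op_perm : forall n, 'S_n -> functor (op n) (op n);
  op_gamma : forall n (k : 'I_n -> nat),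
      functor (prod_category (op n) (pi_category (fun j => gcat (op (k j)))))
              (op (\sum_j k j));
  op_unit : op 1
}.
Arguments op_perm {_} _ {_} _.
Arguments op_gamma {_} _ {_} _.
Arguments op_unit {_} _.

Definition power (C : category) (n : nat) : category :=
  pi_category (fun _ : 'I_n => C).

(* An algebra structure on the G-category X.  The [i]-th element of the [j]-th
   of the consecutive blocks of sizes [k j] is [tagnat.Rank j i]. *)
Record algebra (gT : finGroupType) (O : operad_data gT) (X : gcategory gT) :=
  Algebra {
  mu : forall n, functor (prod_category (op O n) (power X n)) X;
  mu_act_ob : forall n h (f : op O n) (x : power X n),
      gcat_act h (mu n (f, x)) = mu n (gcat_act h f, fun i => gcat_act h (x i));
  mu_act_mor : forall n h (f : Mor (op O n)) (x : Mor (power X n)),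
      fmor (gcat_act h) (fmor (mu n) (f, x)) =
      fmor (mu n) (fmor (gcat_act h) f, fun i => fmor (gcat_act h) (x i));
  mu_perm_ob : forall n (s : 'S_n) (f : op O n) (x : power X n),
      mu n (op_perm O s f, x) = mu n (f, fun i => x ((s^-1)%g i));
  mu_perm_mor : forall n (s : 'S_n) (f : Mor (op O n)) (x : Mor (power X n)),
      fmor (mu n) (fmor (op_perm O s) f, x) =
      fmor (mu n) (f, fun i => x ((s^-1)%g i));
  mu_gamma_ob : forall n (k : 'I_n -> nat) (f : op O n)
      (fs : forall j, op O (k j)) (x : power X (\sum_j k j)),
      mu _ (op_gamma O k (f, fs), x) =
      mu n (f, fun j => mu (k j) (fs j, fun i => x (tagnat.Rank j i)));
  mu_gamma_mor : forall n (k : 'I_n -> nat) (f : Mor (op O n))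
      (fs : forall j, Mor (op O (k j))) (x : Mor (power X (\sum_j k j))),
      fmor (mu _) (fmor (op_gamma O k) (f, fs), x) =
      fmor (mu n) (f, fun j => fmor (mu (k j)) (fs j, fun i => x (tagnat.Rank j i)));
  mu_unit_ob : forall x : power X 1, mu 1 (op_unit O, x) = x ord0;
  mu_unit_mor : forall x : Mor (power X 1),
      fmor (mu 1) (idm (op_unit O), x) = x ord0
}.
Arguments mu {_ _ _} _ _.

Section AlgebraMaps.
Variables (gT : finGroupType) (O : operad_data gT) (X : gcategory gT).
Variables (A : algebra O X) (n : nat).

Definition mu_ob (f : op O n) (x : 'I_n -> X) : X := mu A n (f, x).

Definition mu_mor (f : Mor (op O n)) (x : 'I_n -> Mor X) : Mor X :=
  fmor (mu A n) (f, x).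

End AlgebraMaps.

(* The product "first t, then s"; MathComp's [s * t] means "first s, then t". *)
Definition permc n (s t : 'S_n) : 'S_n := (t * s)%g.

Section Blocks.
Variables (n : nat) (k : 'I_n -> nat).

Definition block_val (s : 'S_n) (x : 'I_(\sum_j k j)) : nat :=
  tagnat.sig2 x + \sum_(l < n | s l < s (tagnat.sig1 x)) k l.

Lemma block_val_lt (s : 'S_n) x : block_val s x < \sum_j k j.
Proof.
rewrite /block_val [ltnRHS](bigID (fun l => s l < s (tagnat.sig1 x))) /=.
rewrite addnC ltn_add2l (bigD1 (tagnat.sig1 x)) ?ltnn //=.
by rewrite ltn_addr.
Qed.

Lemma block_val_mono (s : 'S_n) (x y : 'I_(\sum_j k j)) : s (tagnat.sig1 x) < s (tagnat.sig1 y) ->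
  block_val s x < block_val s y.
Proof.
move=> ltxy; rewrite /block_val.
apply: leq_trans (leq_addl _ _).
rewrite [leqRHS](bigID (fun l => s l < s (tagnat.sig1 x))) /=.
have -> : \sum_(l < n | (s l < s (tagnat.sig1 y)) && (s l < s (tagnat.sig1 x))) k l
        = \sum_(l < n | s l < s (tagnat.sig1 x)) k l.
  by apply: eq_bigl => l; apply: andb_idl => /ltn_trans; apply.
rewrite addnC ltn_add2l (bigD1 (tagnat.sig1 x)) ?ltnn ?ltxy //=.
by rewrite ltn_addr.
Qed.

Definition block_fun s x : 'I_(\sum_j k j) := Ordinal (block_val_lt s x).

Lemma block_fun_inj s : injective (block_fun s).
Proof.
move=> x y /(congr1 val) /= exy.
have [lt1|lt1|eq1] := ltngtP (s (tagnat.sig1 x)) (s (tagnat.sig1 y)).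
- by move: (block_val_mono lt1); rewrite exy ltnn.
- by move: (block_val_mono lt1); rewrite exy ltnn.
have e1 : tagnat.sig1 x = tagnat.sig1 y by apply/(@perm_inj _ s)/val_inj.
have es : \sum_(l < n | s l < s (tagnat.sig1 x)) k l =
          \sum_(l < n | s l < s (tagnat.sig1 y)) k l by rewrite e1.
move: exy; rewrite /block_val es => /addIn e2.
rewrite -(tagnat.sig2K x) -(tagnat.sig2K y); apply/eqP; rewrite -val_eqE /=.
by rewrite tagnat.eq_Rank; apply/andP; split; apply/eqP.
Qed.

(* s<k_1, ..., k_n> *)
Definition block_perm s : 'S_(\sum_j k j) := perm (@block_fun_inj s).

Definition oplus_fun (t : forall j, 'S_(k j)) (x : 'I_(\sum_j k j)) :
    'I_(\sum_j k j) :=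
  tagnat.Rank (tagnat.sig1 x) (t (tagnat.sig1 x) (tagnat.sig2 x)).

Lemma oplus_fun_inj t : injective (oplus_fun t).
Proof.
have fK (u : forall j, 'S_(k j)) x :
    tagnat.sig (oplus_fun u x) =
    Tagged (fun j => 'I_(k j)) (u (tagnat.sig1 x) (tagnat.sig2 x)).
  by rewrite /oplus_fun /tagnat.Rank tagnat.rankK.
apply: (can_inj (g := oplus_fun (fun j => (t j)^-1)%g)) => x.
rewrite {1}/oplus_fun /tagnat.sig1 /tagnat.sig2 fK /= permK.
by rewrite tagnat.sig2K.
Qed.

(* t_1 (+) ... (+) t_n *)
Definition oplus t : 'S_(\sum_j k j) := perm (@oplus_fun_inj t).

(* s<t_1, ..., t_n> *)
Definition block_comp (s : 'S_n) t : 'S_(\sum_j k j) :=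
  permc (block_perm s) (oplus t).

End Blocks.

Section PQ.
Variable gT : finGroupType.

Definition PG (n : nat) := {ffun gT -> 'S_n}.

Definition P_act n (h : gT) (f : PG n) : PG n := [ffun h' => f (h' * h)%g].

Definition P_perm n (s : 'S_n) (f : PG n) : PG n := [ffun h => permc (f h) s].

Definition P_gamma n (k : 'I_n -> nat) (f : PG n) (fs : forall j, PG (k j)) :
  PG (\sum_j k j) := [ffun h => block_comp (f h) (fun j => fs j h)].

(* [P_one 0], [P_one 1] and [P_one 2] are e, the operadic identity and (x). *)
Definition P_one n : PG n := [ffun=> 1%g].

(* The suboperad of P_G generated by e, (x) and [box]. *)
Inductive inQ (m : nat) (box : PG m) : forall n, PG n -> Prop :=
| inQ_e : inQ box (P_one 0)
| inQ_otimes : inQ box (P_one 2)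
| inQ_box : inQ box box
| inQ_unit : inQ box (P_one 1)
| inQ_act n h (f : PG n) : inQ box f -> inQ box (P_act h f)
| inQ_perm n s (f : PG n) : inQ box f -> inQ box (P_perm s f)
| inQ_gamma n (k : 'I_n -> nat) (f : PG n) (fs : forall j, PG (k j)) :
    inQ box f -> (forall j, inQ box (fs j)) -> inQ box (P_gamma f fs).

Section Q.
Variables (m : nat) (box : PG m).

Definition QG (n : nat) : Type := {f : PG n | inQ box f}.

Definition Q_act n h (f : QG n) : QG n := exist _ _ (inQ_act h (proj2_sig f)).

Definition Q_perm n s (f : QG n) : QG n := exist _ _ (inQ_perm s (proj2_sig f)).

Definition Q_gamma n (k : 'I_n -> nat) (f : QG n) (fs : forall j, QG (k j)) :
  QG (\sum_j k j) :=
  exist _ _ (inQ_gamma (proj2_sig f) (fun j => proj2_sig (fs j))).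

Definition Q_e : QG 0 := exist _ _ (inQ_e box).
Definition Q_unit : QG 1 := exist _ _ (inQ_unit box).
Definition Q_otimes : QG 2 := exist _ _ (inQ_otimes box).
Definition Q_box : QG m := exist _ _ (inQ_box box).

Lemma P_gamma_one n (k : 'I_n -> nat) :
  P_gamma (P_one n) (fun j => P_one (k j)) = P_one (\sum_j k j).
Proof.
apply/ffunP => h; rewrite !ffunE /block_comp /permc.
have -> : oplus (fun j => P_one (k j) h) = 1%g.
  apply/permP => x; rewrite permE /oplus_fun ffunE !perm1.
  exact: tagnat.sig2K.
rewrite mul1g; apply/permP => x; rewrite permE perm1; apply: val_inj => /=.
transitivity (nat_of_ord (tagnat.rank (tagnat.sig x))); last by rewrite tagnat.sigK.
rewrite /block_val tagnat.rankEsum addnC.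
by congr addn; apply: eq_bigl => l; rewrite !perm1.
Qed.

Lemma inQ_one3 : inQ box (P_one 3).
Proof.
pose k (j : 'I_2) : nat := if j == ord0 then 2 else 1.
have : inQ box (P_gamma (P_one 2) (fun j => P_one (k j))).
  apply: inQ_gamma (inQ_otimes _) _ => j; rewrite /k.
  by case: (j == ord0); [exact: inQ_otimes | exact: inQ_unit].
rewrite P_gamma_one; suff -> : \sum_j k j = 3 by [].
by rewrite big_ord_recl big_ord1.
Qed.

(* gamma((x); (x), 1), the operation (a (x) b) (x) c. *)
Definition Q_otimes3 : QG 3 := exist _ _ inQ_one3.

Lemma Q_inj n (f f' : QG n) : proj1_sig f = proj1_sig f' -> f = f'.
Proof. by case: f f' => [f Hf] [f' Hf'] /= eff'; apply: eq_exist. Qed.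

Definition tQ (n : nat) : gcategory gT.
Proof.
refine (@GCategory gT (chaotic (QG n))
  (fun h => @to_chaotic (chaotic (QG n)) (QG n) (@Q_act n h)) _ _ _ _).
- by move=> f; apply: Q_inj; apply/ffunP => h; rewrite ffunE mulg1.
- move=> [f f']; congr pair; apply: Q_inj; apply/ffunP => h;
    by rewrite ffunE mulg1.
- by move=> h k f; apply: Q_inj; apply/ffunP => l; rewrite !ffunE mulgA.
- move=> h k [f f']; congr pair; apply: Q_inj; apply/ffunP => l;
    by rewrite !ffunE mulgA.
Defined.

Definition tQ_operad : operad_data gT :=
  @OperadData gT tQ
    (fun n s => @to_chaotic (chaotic (QG n)) (QG n) (Q_perm s))
    (fun n k => @to_chaotic
       (prod_category (chaotic (QG n)) (pi_category (fun j => chaotic (QG (k j)))))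
       (QG (\sum_j k j)) (fun x => Q_gamma x.1 x.2))
    Q_unit.

End Q.

(* Here [g] is a generator of a group of order 2. *)
Definition box2 (g : gT) : PG 2 :=
  [ffun h => if h == g then tperm ord0 ord_max else 1%g].

(* [ordS] is the cyclic successor, so that [cycle3] is the cycle (1 2 3). *)
Definition cycle3 : 'S_3 := perm (@ordS_inj 3).

(* Here [g] is a generator of a group of order 3; the inverse of (1 2 3)
   is (1 3 2). *)
Definition box3 (g : gT) : PG 3 :=
  [ffun h => if h == g then cycle3
             else if h == (g ^+ 2)%g then (cycle3^-1)%g else 1%g].

End PQ.

Definition tQ_C2 (gT : finGroupType) (g : gT) := tQ_operad (box2 g).
Definition tQ_C3 (gT : finGroupType) (g : gT) := tQ_operad (box3 g).

Record permutative (C : category) := Permutative {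
  pe : C;
  pten : functor (prod_category C C) C;
  pbeta : C * C -> Mor C;
  pbeta_iso : natural_iso pten (comp_functor pten (swap_functor C C)) pbeta;
  pten_assoc_ob : forall a b c, pten (a, pten (b, c)) = pten (pten (a, b), c);
  pten_assoc_mor : forall f f' f'',
      fmor pten (f, fmor pten (f', f'')) = fmor pten (fmor pten (f, f'), f'');
  pten_el_ob : forall a, pten (pe, a) = a;
  pten_el_mor : forall f, fmor pten (idm pe, f) = f;
  pten_er_ob : forall a, pten (a, pe) = a;
  pten_er_mor : forall f, fmor pten (f, idm pe) = f;
  pbeta_e : forall a, pbeta (a, pe) = idm a;
  pbeta_sym : forall a b, is_comp (pbeta (b, a)) (pbeta (a, b)) (idm (pten (a, b)));
  pbeta_hex : forall a b c,
      is_comp (fmor pten (pbeta (a, c), idm b)) (fmor pten (idm a, pbeta (b, c)))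
              (pbeta (pten (a, b), c))
}.

(* A permutative structure whose unit, product and symmetry are G-equivariant. *)
Record gpermutative (gT : finGroupType) (X : gcategory gT) := GPermutative {
  gperm :> permutative X;
  pe_act : forall h : gT, gcat_act h (pe gperm) = pe gperm;
  pten_act_ob : forall (h : gT) a b,
      gcat_act h (pten gperm (a, b)) = pten gperm (gcat_act h a, gcat_act h b);
  pten_act_mor : forall (h : gT) f f',
      fmor (gcat_act h) (fmor (pten gperm) (f, f')) =
      fmor (pten gperm) (fmor (gcat_act h) f, fmor (gcat_act h) f');
  pbeta_act : forall (h : gT) a b,
      fmor (gcat_act h) (pbeta gperm (a, b)) = pbeta gperm (gcat_act h a, gcat_act h b)
}.

Record biased_C2 (gT : finGroupType) (g : gT) (X : gcategory gT) := BiasedC2 {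
  b2perm :> gpermutative X;
  b2box : functor (prod_category X X) X;
  b2ups : X * X -> Mor X;
  b2ups_iso : natural_iso b2box (pten b2perm) b2ups;
  b2box_el_ob : forall a, b2box (pe b2perm, a) = a;
  b2box_el_mor : forall f, fmor b2box (idm (pe b2perm), f) = f;
  b2box_er_ob : forall a, b2box (a, pe b2perm) = a;
  b2box_er_mor : forall f, fmor b2box (f, idm (pe b2perm)) = f;
  b2ups_el : forall a, b2ups (pe b2perm, a) = idm a;
  b2ups_er : forall a, b2ups (a, pe b2perm) = idm a;
  b2box_assoc_ob : forall a b c, b2box (a, b2box (b, c)) = b2box (b2box (a, b), c);
  b2box_assoc_mor : forall f f' f'',
      fmor b2box (f, fmor b2box (f', f'')) = fmor b2box (fmor b2box (f, f'), f'');
  b2ups_assoc : forall a b c,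
      comm_square
        (fmor (pten b2perm) (idm a, b2ups (b, c))) (b2ups (a, b2box (b, c)))
        (fmor (pten b2perm) (b2ups (a, b), idm c)) (b2ups (b2box (a, b), c));
  b2box_act_ob : forall a b, gcat_act g (b2box (a, b)) = b2box (gcat_act g b, gcat_act g a);
  b2box_act_mor : forall f f',
      fmor (gcat_act g) (fmor b2box (f, f')) =
      fmor b2box (fmor (gcat_act g) f', fmor (gcat_act g) f);
  b2ups_act : forall a b,
      is_comp (pbeta b2perm (gcat_act g b, gcat_act g a)) (b2ups (gcat_act g b, gcat_act g a))
              (fmor (gcat_act g) (b2ups (a, b)))
}.

(* The primitive binary operations: the tensor product, and the ternary product
   with the unit inserted in its first, second or third position. *)
Inductive prim_op := PTen | PBox1 | PBox2 | PBox3.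

Section Prim.
Variables (C : category) (p : permutative C).
Variable box : functor (prod_category (prod_category C C) C) C.
Variable ups : C * C * C -> Mor C.

Definition prim_ob (d : prim_op) (a b : C) : C :=
  match d with
  | PTen => pten p (a, b)
  | PBox1 => box (pe p, a, b)
  | PBox2 => box (a, pe p, b)
  | PBox3 => box (a, b, pe p)
  end.

Definition prim_mor (d : prim_op) (f f' : Mor C) : Mor C :=
  match d with
  | PTen => fmor (pten p) (f, f')
  | PBox1 => fmor box (idm (pe p), f, f')
  | PBox2 => fmor box (f, idm (pe p), f')
  | PBox3 => fmor box (f, f', idm (pe p))
  end.

Definition prim_ups (d : prim_op) (a b : C) : Mor C :=
  match d with
  | PTen => idm (pten p (a, b))
  | PBox1 => ups (pe p, a, b)
  | PBox2 => ups (a, pe p, b)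
  | PBox3 => ups (a, b, pe p)
  end.

End Prim.

Record biased_C3 (gT : finGroupType) (g : gT) (X : gcategory gT) := BiasedC3 {
  b3perm :> gpermutative X;
  b3box : functor (prod_category (prod_category X X) X) X;
  b3ups : X * X * X -> Mor X;
  b3ups_iso : natural_iso b3box
    (comp_functor (pten b3perm) (prod_functor (pten b3perm) (id_functor X))) b3ups;
  b3prim_el_ob : forall d a, prim_ob b3perm b3box d (pe b3perm) a = a;
  b3prim_el_mor : forall d f, prim_mor b3perm b3box d (idm (pe b3perm)) f = f;
  b3prim_er_ob : forall d a, prim_ob b3perm b3box d a (pe b3perm) = a;
  b3prim_er_mor : forall d f, prim_mor b3perm b3box d f (idm (pe b3perm)) = f;
  b3ups_eea : forall a, b3ups (pe b3perm, pe b3perm, a) = idm a;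
  b3ups_eae : forall a, b3ups (pe b3perm, a, pe b3perm) = idm a;
  b3ups_aee : forall a, b3ups (a, pe b3perm, pe b3perm) = idm a;
  b3prim_assoc_ob : forall d a b c,
      prim_ob b3perm b3box d a (prim_ob b3perm b3box d b c) =
      prim_ob b3perm b3box d (prim_ob b3perm b3box d a b) c;
  b3prim_assoc_mor : forall d f f' f'',
      prim_mor b3perm b3box d f (prim_mor b3perm b3box d f' f'') =
      prim_mor b3perm b3box d (prim_mor b3perm b3box d f f') f'';
  b3ups_assoc : forall d a b c,
      comm_square
        (fmor (pten b3perm) (idm a, prim_ups b3perm b3ups d b c))
        (prim_ups b3perm b3ups d a (prim_ob b3perm b3box d b c))
        (fmor (pten b3perm) (prim_ups b3perm b3ups d a b, idm c))
        (prim_ups b3perm b3ups d (prim_ob b3perm b3box d a b) c);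
  b3box_act_ob : forall a b c,
      gcat_act g (b3box (a, b, c)) = b3box (gcat_act g c, gcat_act g a, gcat_act g b);
  b3box_act_mor : forall f f' f'',
      fmor (gcat_act g) (fmor b3box (f, f', f'')) =
      fmor b3box (fmor (gcat_act g) f'', fmor (gcat_act g) f, fmor (gcat_act g) f');
  b3ups_act : forall a b c,
      is_comp (pbeta b3perm (gcat_act g c, pten b3perm (gcat_act g a, gcat_act g b)))
              (b3ups (gcat_act g c, gcat_act g a, gcat_act g b))
              (fmor (gcat_act g) (b3ups (a, b, c)))
}.

(* Evaluation of an algebra at e, (x), box and at the unique morphisms
   (x) -> (x).(1 2) and box -> (x) (resp. box -> gamma((x); (x), 1)).  A morphism
   of [tQ box n] is a pair (source, target). *)

Record evaluates_perm (gT : finGroupType) (m : nat) (box : PG gT m)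
    (X : gcategory gT) (A : algebra (tQ_operad box) X) (p : permutative X) : Prop := {
  eval_e : forall x : 'I_0 -> X, pe p = mu_ob A (Q_e box) x;
  eval_ten_ob : forall x : 'I_2 -> X,
      pten p (x ord0, x ord_max) = mu_ob A (Q_otimes box) x;
  eval_ten_mor : forall f : 'I_2 -> Mor X,
      fmor (pten p) (f ord0, f ord_max) =
      mu_mor A (Q_otimes box, Q_otimes box) f;
  eval_beta : forall x : 'I_2 -> X,
      pbeta p (x ord0, x ord_max) =
      mu_mor A (Q_otimes box, Q_perm (tperm ord0 ord_max) (Q_otimes box))
             (fun i => idm (x i))
}.

Record evaluates_C2 (gT : finGroupType) (g : gT) (X : gcategory gT)
    (A : algebra (tQ_C2 g) X) (B : biased_C2 g X) : Prop := {
  eval2_perm : evaluates_perm A B;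
  eval2_box_ob : forall x : 'I_2 -> X,
      b2box B (x ord0, x ord_max) = mu_ob A (Q_box (box2 g)) x;
  eval2_box_mor : forall f : 'I_2 -> Mor X,
      fmor (b2box B) (f ord0, f ord_max) =
      mu_mor A (Q_box (box2 g), Q_box (box2 g)) f;
  eval2_ups : forall x : 'I_2 -> X,
      b2ups B (x ord0, x ord_max) =
      mu_mor A (Q_box (box2 g), Q_otimes (box2 g)) (fun i => idm (x i))
}.

Record evaluates_C3 (gT : finGroupType) (g : gT) (X : gcategory gT)
    (A : algebra (tQ_C3 g) X) (B : biased_C3 g X) : Prop := {
  eval3_perm : evaluates_perm A B;
  eval3_box_ob : forall x : 'I_3 -> X,
      b3box B (x ord0, x (inord 1), x ord_max) = mu_ob A (Q_box (box3 g)) x;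
  eval3_box_mor : forall f : 'I_3 -> Mor X,
      fmor (b3box B) (f ord0, f (inord 1), f ord_max) =
      mu_mor A (Q_box (box3 g), Q_box (box3 g)) f;
  eval3_ups : forall x : 'I_3 -> X,
      b3ups B (x ord0, x (inord 1), x ord_max) =
      mu_mor A (Q_box (box3 g), Q_otimes3 (box3 g)) (fun i => idm (x i))
}.

(* Main.v *)
(** An operation of [P_G] is determined by the words, one for each h in G, that
    list its inputs in the order of multiplication.  The operations of [Q_G] are
    those whose words come from terms in the binary operations (the tensor product
    and the operations obtained from the box) and, for C_3, the ternary box.  These
    terms are governed by the associativity and unit laws alone: two linear terms
    with the same words have the same value in every model.  This follows by
    induction from a splitting property: if the words of a term decompose
    along an operation, then the term itself does, up to the laws; otherwise the
    relative positions of two or three letters would conflict.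

    The comparisons upsilon assemble, for each term, into an isomorphism from its
    value to a tensor product.  That it depends only on the words follows
    from the same statement, applied to a model whose elements are morphisms.
    Composing with the canonical permutation isomorphisms of the permutative
    category gives the action of the morphisms of the operad.  Conversely, in an
    algebra a morphism built from values of the operad is determined by its source
    and target words, so that each axiom becomes a comparison of words. *)
Require Import Defs.
From mathcomp Require Import all_boot all_order all_fingroup.
From mathcomp Require Import boolp zify cyclic.
(* Restores [idm], which fingroup shadows. *)
Import Defs.
Set Implicit Arguments. Unset Strict Implicit. Unset Printing Implicit Defensive.

(** The axioms impose associativity on binary operations only, and none on a ternary box whose three
    arguments differ from the unit, so the point to be proved is that no relation is missing. Two
    features make this possible: distinct binary operations are told apart by the elements of G at
    which they reverse their arguments, and the box attains all three rotations, which no binary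
    bracketing allows. They are isolated as fields of [signature], so that C_2, with a second binary
    operation and no ternary one, and C_3 are covered by one argument.

    Words without repetitions matter because letters are then located by relative position;
    symmetric groups act by renaming leaves. Terms are evaluated only in the model of morphisms:
    equality of two comparisons includes equality of their sources, which are the values on objects.
    In one round trip the algebra is recovered because each of its morphisms satisfies the equation
    that characterizes the constructed ones; in the other, the biased structure is recovered because
    evaluation at the generators leaves no freedom. *)

Definition cat3 (L : Type) (r : nat) (a b c : seq L) : seq L :=
  match r with 0 => a ++ b ++ c | 1 => b ++ c ++ a | _ => c ++ a ++ b end.

(* Binary operations [d] and ternary operations [p] on families of words indexed
   by [gT]: at [h], [d] concatenates its arguments in an order given by
   [swap d h], and [p] concatenates them after [turn p h] cyclic rotations.
   [ins1 p], [ins2 p], [ins3 p] are obtained by inserting the unit into [p], and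
   [twist d] describes the translate of [d] by [g]. *)
Record signature (gT : finGroupType) (g : gT) := Signature {
  bop : Type;
  top : Type;
  ten : bop;
  swap : bop -> gT -> bool;
  turn : top -> gT -> nat;
  ins1 : top -> bop;
  ins2 : top -> bop;
  ins3 : top -> bop;
  twist : bop -> bop;
  swap1 : forall d, swap d 1%g = false;
  swap_ten : forall h, swap ten h = false;
  swap_inj : forall d d', (forall h, swap d h = swap d' h) -> d = d';
  turn1 : forall p, turn p 1%g = 0;
  turn_ex1 : forall p, exists h, turn p h = 1;
  turn_ex2 : forall p, exists h, turn p h = 2;
  turn_lt3 : forall p h, turn p h < 3;
  swap_ins1 : forall p h, swap (ins1 p) h = (turn p h == 2);
  swap_ins2 : forall p h, swap (ins2 p) h = (turn p h != 0);
  swap_ins3 : forall p h, swap (ins3 p) h = (turn p h == 1);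
  top_irr : forall p p' : top, p = p';
  swap_twist : forall d h, swap (twist d) h = swap d (h * g)%g (+) swap d g;
  turn_twist : forall p h, turn p (h * g)%g = (turn p h + 2) %% 3
}.

(** * Words and terms *)

Section Words.
Variables (gT : finGroupType) (g : gT) (Sg : signature g).
Variable L : Type.

Definition words := gT -> seq L.

Definition bcat (d : bop Sg) (U V : words) : words :=
  fun h => if swap d h then V h ++ U h else U h ++ V h.

Definition tcat (p : top Sg) (U V Z : words) : words :=
  fun h => cat3 (turn p h) (U h) (V h) (Z h).

Inductive term := Leaf of L | Unt | Bin of bop Sg & term & term
  | Tern of top Sg & term & term & term.

Fixpoint wd (t : term) : words :=
  match t with
  | Leaf i => fun=> [:: i]
  | Unt => fun=> [::]
  | Bin d s t => bcat d (wd s) (wd t)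
  | Tern p s t u => tcat p (wd s) (wd t) (wd u)
  end.

Lemma bcat1 d U V : bcat d U V 1%g = U 1%g ++ V 1%g.
Proof. by rewrite /bcat swap1. Qed.

Lemma tcat1 p U V Z : tcat p U V Z 1%g = U 1%g ++ V 1%g ++ Z 1%g.
Proof. by rewrite /tcat turn1. Qed.

End Words.
Arguments Unt {gT g Sg L}.
Arguments Bin {gT g Sg L} _ _ _.
Arguments Tern {gT g Sg L} _ _ _ _.
Arguments Leaf {gT g Sg L} _.

(** * Rearrangement, cancellation and relative order in families of words *)

Section WordLemmas.
Variables (gT : finGroupType) (g : gT) (Sg : signature g) (L : eqType).
Implicit Types (U V Z A B : words gT L) (d : bop Sg) (p : top Sg).
Implicit Types t s u : term Sg L.

(** What remains of coming from a term for the pieces of a decomposition, which are arbitrary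
    families of words with no term at hand. It allows emptiness, length and membership to be tested
    at 1 alone. *)
Definition stable U := forall h, perm_eq (U h) (U 1%g).

Lemma stable_bcat d U V : stable U -> stable V -> stable (bcat d U V).
Proof.
move=> hU hV h; rewrite bcat1 /bcat; case: ifP => _; last exact: perm_cat.
by rewrite perm_catC; apply: perm_cat.
Qed.

Lemma stable_tcat p U V Z : stable U -> stable V -> stable Z ->
  stable (tcat p U V Z).
Proof.
move=> hU hV hZ h; rewrite tcat1 /tcat.
have H : perm_eq (U h ++ V h ++ Z h) (U 1%g ++ V 1%g ++ Z 1%g).
  by apply: perm_cat => //; apply: perm_cat.
apply: perm_trans H; case: (turn p h) => [|[|r]] //=.
  by rewrite catA perm_catC.
by rewrite perm_catC -catA.
Qed.

Lemma stable_wd t : stable (wd t).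
Proof.
elim: t => [i|//|d s hs t ht|p s hs t ht u hu] //=; first exact: stable_bcat.
exact: stable_tcat.
Qed.

Lemma stable_nil U : stable U -> U 1%g = [::] -> forall h, U h = [::].
Proof. by move=> hU e h; apply: perm_nilP; rewrite -e; apply: hU. Qed.

Lemma stable_size U : stable U -> forall h, size (U h) = size (U 1%g).
Proof. by move=> hU h; apply: perm_size. Qed.

Lemma stable_mem U x h : stable U -> (x \in U h) = (x \in U 1%g).
Proof. by move=> /(_ h) /perm_mem. Qed.

Lemma stable_uniq U h : stable U -> uniq (U h) = uniq (U 1%g).
Proof. by move=> /(_ h) /perm_uniq. Qed.

Lemma bcat_nill d U V h : U h = [::] -> bcat d U V h = V h.
Proof. by rewrite /bcat => ->; rewrite cats0 if_same. Qed.

Lemma bcat_nilr d U V h : V h = [::] -> bcat d U V h = U h.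
Proof. by rewrite /bcat => ->; rewrite cats0 if_same. Qed.

Lemma bcatA d U V Z h : bcat d U (bcat d V Z) h = bcat d (bcat d U V) Z h.
Proof. by rewrite /bcat; case: (swap d h); rewrite catA. Qed.

Lemma tcat_nil1 p U V Z h : U h = [::] -> tcat p U V Z h = bcat (ins1 p) V Z h.
Proof.
rewrite /tcat /bcat swap_ins1 => ->; have := turn_lt3 p h.
by case: (turn p h) => [|[|[]]] //=; rewrite cats0.
Qed.

Lemma tcat_nil2 p U V Z h : V h = [::] -> tcat p U V Z h = bcat (ins2 p) U Z h.
Proof.
rewrite /tcat /bcat swap_ins2 => ->; have := turn_lt3 p h.
by case: (turn p h) => [|[|[]]] //=; rewrite cats0.
Qed.

Lemma tcat_nil3 p U V Z h : Z h = [::] -> tcat p U V Z h = bcat (ins3 p) U V h.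
Proof.
rewrite /tcat /bcat swap_ins3 => ->; have := turn_lt3 p h.
by case: (turn p h) => [|[|[]]] //=; rewrite cats0.
Qed.

Lemma cat_inj_size (A B A' B' : seq L) : A ++ B = A' ++ B' -> size A = size A' ->
  A = A' /\ B = B'.
Proof.
move=> e es; have := congr1 (take (size A)) e; have := congr1 (drop (size A)) e.
by rewrite drop_size_cat // take_size_cat // es drop_size_cat // take_size_cat.
Qed.

(** Levi's lemma for free monoids, applied at every h: the overlap of the two factorizations is cut
    out of A. Stability of the overlap follows by cancelling U from A up to permutation. *)
Lemma bcat_levi d A B U V : stable A -> stable U ->
  size (U 1%g) <= size (A 1%g) -> bcat d A B =1 bcat d U V ->
  exists R, [/\ stable R, A =1 bcat d U R & V =1 bcat d R B].
Proof.
move=> sA sU le e.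
(* Where d reverses its arguments, U is a suffix of A instead of a prefix, so the overlap is the
   initial part of A. *)
pose R : words gT L := fun h => if swap d h then take (size (A h) - size (U h)) (A h)
  else drop (size (U h)) (A h).
have H h : A h = bcat d U R h /\ V h = bcat d R B h.
  have := e h; rewrite /bcat /R; have := stable_size sA h; have := stable_size sU h.
  case: ifP => _ eU eA e'.
    have := @cat_inj_size (B h ++ take (size (A h) - size (U h)) (A h))
       (drop (size (A h) - size (U h)) (A h)) (V h) (U h).
    rewrite -catA cat_take_drop => /(_ e') [].
      by have := congr1 size e'; rewrite !size_cat size_takel ?leq_subr //; lia.
    by move=> <- {2}<-; rewrite cat_take_drop.
  have := @cat_inj_size (take (size (U h)) (A h)) (drop (size (U h)) (A h) ++ B h)
    (U h) (V h).
  rewrite catA cat_take_drop => /(_ e') [].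
    by rewrite size_takel // eA eU.
  by move=> {2}<- <-; rewrite cat_take_drop.
exists R; split=> [h|h|h]; [|by case: (H h)|by case: (H h)].
have [eh _] := H h; have [e1 _] := H 1%g.
have : perm_eq (U h ++ R h) (U 1%g ++ R 1%g).
  rewrite -(bcat1 d) -e1; apply: perm_trans (sA h); rewrite eh /bcat.
  by case: ifP => // _; rewrite perm_catC.
move=> p; rewrite -(perm_cat2l (U 1%g)); apply: perm_trans p.
by rewrite perm_cat2r perm_sym.
Qed.

(** The order of two letters is the invariant that reveals the root of a term: letters from
    different arguments of d recover [swap d h], and pairs from the three arguments of p recover
    [turn p h]. *)
Definition before (w : seq L) x y := index x w < index y w.

Lemma before_catl (a b : seq L) x y : uniq (a ++ b) -> x \in a -> y \in b ->
  before (a ++ b) x y = true.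
Proof.
rewrite cat_uniq => /and3P [_ /hasPn H _] xa yb; rewrite /before !index_cat xa.
rewrite (negbTE (H _ yb)); rewrite -index_mem in xa; exact: ltn_addr.
Qed.

Lemma before_catr (a b : seq L) x y : uniq (a ++ b) -> x \in a -> y \in b ->
  before (a ++ b) y x = false.
Proof. by move=> u xa yb; rewrite /before ltnNge ltnW //; apply: before_catl. Qed.

Lemma bcat_before d U V h x y : uniq (bcat d U V h) -> x \in U h -> y \in V h ->
  before (bcat d U V h) x y = ~~ swap d h.
Proof.
rewrite /bcat; case: ifP => _ u xU yV; first exact: before_catr.
exact: before_catl.
Qed.

Lemma tcat_before12 p U V Z h x y : uniq (tcat p U V Z h) -> x \in U h -> y \in V h ->
  before (tcat p U V Z h) x y = (turn p h != 1).
Proof.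
rewrite /tcat; have := turn_lt3 p h; case: (turn p h) => [|[|[]]] //= _ u xU yV.
- by apply: before_catl; rewrite ?mem_cat ?xU ?yV ?orbT.
- by apply: before_catr; rewrite ?mem_cat ?xU ?yV ?orbT.
- by rewrite catA; apply: before_catl; rewrite -?catA ?mem_cat ?xU ?yV ?orbT.
Qed.

Lemma tcat_before13 p U V Z h x y : uniq (tcat p U V Z h) -> x \in U h -> y \in Z h ->
  before (tcat p U V Z h) x y = (turn p h == 0).
Proof.
rewrite /tcat; have := turn_lt3 p h; case: (turn p h) => [|[|[]]] //= _ u xU yV.
- by apply: before_catl; rewrite ?mem_cat ?xU ?yV ?orbT.
- by rewrite catA; apply: before_catr; rewrite -?catA ?mem_cat ?xU ?yV ?orbT.
- by apply: before_catr; rewrite ?mem_cat ?xU ?yV ?orbT.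
Qed.

Lemma tcat_before23 p U V Z h x y : uniq (tcat p U V Z h) -> x \in V h -> y \in Z h ->
  before (tcat p U V Z h) x y = (turn p h != 2).
Proof.
rewrite /tcat; have := turn_lt3 p h; case: (turn p h) => [|[|[]]] //= _ u xU yV.
- by rewrite catA; apply: before_catl; rewrite -?catA ?mem_cat ?xU ?yV ?orbT.
- by apply: before_catl; rewrite ?mem_cat ?xU ?yV ?orbT.
- by apply: before_catr; rewrite ?mem_cat ?xU ?yV ?orbT.
Qed.

End WordLemmas.

(** * The value of a linear term is determined by its words *)

Section Presentation.
Variables (gT : finGroupType) (g : gT) (Sg : signature g).
Variables (S : Type) (me : S) (mb : bop Sg -> S -> S -> S).
Variable mt : top Sg -> S -> S -> S -> S.
Variables (L : eqType) (x : L -> S).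

Fixpoint ev (t : term Sg L) : S :=
  match t with
  | Leaf i => x i
  | Unt => me
  | Bin d s t => mb d (ev s) (ev t)
  | Tern p s t u => mt p (ev s) (ev t) (ev u)
  end.

Hypothesis mb_el : forall d a, mb d me a = a.
Hypothesis mb_er : forall d a, mb d a me = a.
Hypothesis mb_assoc : forall d a b c, mb d a (mb d b c) = mb d (mb d a b) c.
Hypothesis mt_e1 : forall p a b, mt p me a b = mb (ins1 p) a b.
Hypothesis mt_e2 : forall p a b, mt p a me b = mb (ins2 p) a b.
Hypothesis mt_e3 : forall p a b, mt p a b me = mb (ins3 p) a b.

Implicit Types (t s u : term Sg L) (U V Z W : words gT L) (d : bop Sg) (p : top Sg).

Lemma ev_nil t : wd t 1%g = [::] -> ev t = me.
Proof.
elim: t => [i|//|d s hs t ht|p s hs t ht u hu] //=.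
  rewrite bcat1; case: (wd s 1%g) hs => //= -> // /ht ->; exact: mb_el.
rewrite tcat1; case: (wd s 1%g) hs => //= -> //; case: (wd t 1%g) ht => //= -> // /hu ->.
by rewrite mt_e1 mb_el.
Qed.

Lemma ev_single t i : wd t 1%g = [:: i] -> ev t = x i.
Proof.
elim: t => [j [->]|//|d s hs t ht|p s hs t ht u hu] //=.
  rewrite bcat1; case es: (wd s 1%g) hs => [|j [|//]] /= hs.
    by move/ht => ->; rewrite (ev_nil es) mb_el.
  by case=> eij; rewrite eij in hs *; move/ev_nil => ->; rewrite hs // mb_er.
rewrite tcat1; case es: (wd s 1%g) hs => [|j [|//]] /= hs; last first.
  case et: (wd t 1%g) => [|//] [eij] eu.
  by rewrite hs ?eij // (ev_nil et) (ev_nil eu) mt_e2 mb_er.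
rewrite (ev_nil es) mt_e1.
case et: (wd t 1%g) ht => [|j [|//]] /= ht.
  by move/hu => ->; rewrite (ev_nil et) mb_el.
by case=> eij; rewrite eij in ht *; move/ev_nil => ->; rewrite ht // mb_er.
Qed.

(** Stated for a value and a family of words instead of a term, so that a ternary term with an empty
    argument can be replaced by the binary term that has the same value and words. *)
Definition splits_bin (v : S) W := forall d U V, stable U -> stable V ->
  W =1 bcat d U V -> exists t1 t2,
  [/\ v = mb d (ev t1) (ev t2), wd t1 =1 U & wd t2 =1 V].

Definition splits_tern (v : S) W := forall p U V Z,
  stable U -> stable V -> stable Z ->
  U 1%g <> [::] -> V 1%g <> [::] -> Z 1%g <> [::] ->
  W =1 tcat p U V Z -> exists t1 t2 t3,
  [/\ v = mt p (ev t1) (ev t2) (ev t3), wd t1 =1 U, wd t2 =1 V & wd t3 =1 Z].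

Lemma head_mem (w : seq L) : w <> [::] -> exists i, i \in w.
Proof. by case: w => // i w _; exists i; rewrite mem_head. Qed.

(** The first letter of the common word at 1 lies in both A and U, the last one in both B and V. The
    order of these two letters at h is governed by [swap d h] in one decomposition and by
    [swap d' h] in the other. *)
Lemma bin_inj_op d d' A B U V : stable A -> stable B -> stable U -> stable V ->
  A 1%g <> [::] -> B 1%g <> [::] -> U 1%g <> [::] -> V 1%g <> [::] ->
  uniq (bcat d A B 1%g) -> bcat d A B =1 bcat d' U V -> d = d'.
Proof.
move=> sA sB sU sV nA nB nU nV un e; apply: swap_inj => h.
have [i iA iU] : exists2 i, i \in A 1%g & i \in U 1%g.
  have := e 1%g; rewrite !bcat1; case: (A 1%g) nA => // i a _.
  case: (U 1%g) nU => // j b _ [-> _]; exists j; exact: mem_head.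
have [j jB jV] : exists2 j, j \in B 1%g & j \in V 1%g.
  have := e 1%g; rewrite !bcat1; case/lastP: (B 1%g) nB => // b j _.
  case/lastP: (V 1%g) nV => // b' j' _; rewrite -!rcons_cat => /rcons_inj [_ ->].
  by exists j'; rewrite mem_rcons mem_head.
have unh : uniq (bcat d A B h) by rewrite stable_uniq //; apply: stable_bcat.
have := @bcat_before _ _ _ _ d A B h i j unh.
rewrite !(stable_mem _ _ sA, stable_mem _ _ sB) => /(_ iA jB).
rewrite e bcat_before -?e // ?(stable_mem _ _ sU) ?(stable_mem _ _ sV) //.
by case: (swap d h); case: (swap d' h).
Qed.

(** Apart from empty factors, both decompositions use the same operation. The shorter left factor is
    split off the longer one by the induction hypothesis, and associativity moves the overlap to the
    other side. *)
Lemma split_bin_bin d s1 s2 : uniq (bcat d (wd s1) (wd s2) 1%g) ->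
  splits_bin (ev s1) (wd s1) -> splits_bin (ev s2) (wd s2) ->
  splits_bin (mb d (ev s1) (ev s2)) (bcat d (wd s1) (wd s2)).
Proof.
move=> un IH1 IH2 d' U V sU sV e.
have [s1n|] := eqVneq (wd s1 1%g) [::].
  rewrite (ev_nil s1n) mb_el; apply: IH2 => // h.
  by rewrite -e bcat_nill // (stable_nil _ s1n) //; apply: stable_wd.
have [s2n|/eqP s2n /eqP s1n] := eqVneq (wd s2 1%g) [::].
  move=> _; rewrite (ev_nil s2n) mb_er; apply: IH1 => // h.
  by rewrite -e bcat_nilr // (stable_nil _ s2n) //; apply: stable_wd.
have [Un|/eqP Un] := eqVneq (U 1%g) [::].
  exists Unt, (Bin d s1 s2); rewrite mb_el; split=> // h /=.
    by rewrite (stable_nil sU Un).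
  by rewrite e bcat_nill // (stable_nil sU Un).
have [Vn|/eqP Vn] := eqVneq (V 1%g) [::].
  exists (Bin d s1 s2), Unt; rewrite mb_er; split=> // h /=.
    by rewrite e bcat_nilr // (stable_nil sV Vn).
  by rewrite (stable_nil sV Vn).
have ? : d = d' by apply: (bin_inj_op _ _ _ _ _ _ _ _ un e) => //; apply: stable_wd.
subst d'; have [le|/ltnW le] := leqP (size (U 1%g)) (size (wd s1 1%g)).
  have [R [sR e1 e2]] := bcat_levi (@stable_wd _ _ _ _ s1) sU le e.
  have [t1 [t2 [-> w1 w2]]] := IH1 d U R sU sR e1.
  exists t1, (Bin d t2 s2); rewrite -mb_assoc; split=> //= h.
  by rewrite e2 /bcat w2.
have e' : bcat d U V =1 bcat d (wd s1) (wd s2) by move=> h; rewrite e.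
have [R [sR e1 e2]] := bcat_levi sU (@stable_wd _ _ _ _ s1) le e'.
have [t1 [t2 [-> w1 w2]]] := IH2 d R V sR sV e2.
exists (Bin d s1 t1), t2; rewrite mb_assoc; split=> //= h.
by rewrite e1 /bcat w1.
Qed.

(* Letters of the three arguments of [p] occur in all cyclic orders, but two of them
   lie in the same argument of [d], hence on the same side of the third one. *)
Lemma bin_tern_absurd d p A B U V Z : stable A -> stable B ->
  stable U -> stable V -> stable Z ->
  A 1%g <> [::] -> B 1%g <> [::] ->
  U 1%g <> [::] -> V 1%g <> [::] -> Z 1%g <> [::] ->
  uniq (bcat d A B 1%g) -> bcat d A B =1 tcat p U V Z -> False.
Proof.
move=> sA sB sU sV sZ nA nB nU nV nZ un e.
have [i iA iU] : exists2 i, i \in A 1%g & i \in U 1%g.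
  have := e 1%g; rewrite bcat1 tcat1; case: (A 1%g) nA => // i a _.
  case: (U 1%g) nU => // j b _ [-> _]; exists j; exact: mem_head.
have [k kB kZ] : exists2 k, k \in B 1%g & k \in Z 1%g.
  have := e 1%g; rewrite bcat1 tcat1; case/lastP: (B 1%g) nB => // b j _.
  case/lastP: (Z 1%g) nZ => // b' j' _; rewrite -!rcons_cat => /rcons_inj [_ ->].
  by exists j'; rewrite mem_rcons mem_head.
have [j jV] := head_mem nV.
have unh h : uniq (bcat d A B h) by rewrite stable_uniq //; apply: stable_bcat.
have mA h l : l \in A 1%g -> l \in A h by rewrite (stable_mem _ _ sA).
have mB h l : l \in B 1%g -> l \in B h by rewrite (stable_mem _ _ sB).
have mU h l : l \in U 1%g -> l \in U h by rewrite (stable_mem _ _ sU).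
have mV h l : l \in V 1%g -> l \in V h by rewrite (stable_mem _ _ sV).
have mZ h l : l \in Z 1%g -> l \in Z h by rewrite (stable_mem _ _ sZ).
have : (j \in A 1%g) || (j \in B 1%g).
  by rewrite -mem_cat -(bcat1 d) e tcat1 !mem_cat jV orbT.
case/orP => [jA|jB].
- have [h eh] := turn_ex1 p.
  have := bcat_before (unh h) (mA h _ iA) (mB h _ kB).
  rewrite -(bcat_before (unh h) (mA h _ jA) (mB h _ kB)).
  by rewrite e tcat_before13 ?tcat_before23 -?e ?eh; auto.
- have [h eh] := turn_ex2 p.
  have := bcat_before (unh h) (mA h _ iA) (mB h _ kB).
  rewrite -(bcat_before (unh h) (mA h _ iA) (mB h _ jB)).
  by rewrite e tcat_before13 ?tcat_before12 -?e ?eh; auto.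
Qed.

(** Corresponding arguments share a letter, namely the first letter of the common word at an element
    of G where the box puts that argument in front. A letter lying in arguments that do not
    correspond would have contradictory positions relative to these shared letters. The resulting
    inclusions are equalities of sizes because the total lengths agree. *)
Lemma tcat_inj p A B C U V Z : stable A -> stable B -> stable C ->
  stable U -> stable V -> stable Z ->
  A 1%g <> [::] -> B 1%g <> [::] -> C 1%g <> [::] ->
  U 1%g <> [::] -> V 1%g <> [::] -> Z 1%g <> [::] ->
  uniq (tcat p A B C 1%g) -> tcat p A B C =1 tcat p U V Z ->
  [/\ A =1 U, B =1 V & C =1 Z].
Proof.
move=> sA sB sC sU sV sZ nA nB nC nU nV nZ un e.
have unh h : uniq (tcat p A B C h) by rewrite stable_uniq //; apply: stable_tcat.
have unh' h : uniq (tcat p U V Z h) by rewrite -e.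
have mA h l : l \in A 1%g -> l \in A h by rewrite (stable_mem _ _ sA).
have mB h l : l \in B 1%g -> l \in B h by rewrite (stable_mem _ _ sB).
have mC h l : l \in C 1%g -> l \in C h by rewrite (stable_mem _ _ sC).
have mU h l : l \in U 1%g -> l \in U h by rewrite (stable_mem _ _ sU).
have mV h l : l \in V 1%g -> l \in V h by rewrite (stable_mem _ _ sV).
have mZ h l : l \in Z 1%g -> l \in Z h by rewrite (stable_mem _ _ sZ).
have [h1 eh1] := turn_ex1 p; have [h2 eh2] := turn_ex2 p; have eh0 := turn1 p.
have hd (W W' w w' : seq L) : W <> [::] -> W' <> [::] -> W ++ w = W' ++ w' ->
    exists2 i, i \in W & i \in W'.
  by case: W W' => [//|i W] [//|j W'] _ _ [-> _]; exists j; rewrite mem_head.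
have ne (W : words gT L) h : stable W -> W 1%g <> [::] -> W h <> [::].
  move=> sW nW /(congr1 size) /=; rewrite stable_size //.
  by move/eqP; rewrite size_eq0 => /eqP.
have [a aA aU] : exists2 i, i \in A 1%g & i \in U 1%g.
  by have := e 1%g; rewrite !tcat1; apply: hd.
have [b bB bV] : exists2 i, i \in B 1%g & i \in V 1%g.
  have := e h1; rewrite /tcat eh1 /= => /hd [||i]; [exact: ne|exact: ne|].
  by rewrite (stable_mem _ _ sB) (stable_mem _ _ sV); exists i.
have [c cC cZ] : exists2 i, i \in C 1%g & i \in Z 1%g.
  have := e h2; rewrite /tcat eh2 /= => /hd [||i]; [exact: ne|exact: ne|].
  by rewrite (stable_mem _ _ sC) (stable_mem _ _ sZ); exists i.
have cover y : (y \in A 1%g) || (y \in B 1%g) || (y \in C 1%g) =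
    (y \in U 1%g) || (y \in V 1%g) || (y \in Z 1%g).
  by have := congr1 (fun w => y \in w) (e 1%g); rewrite !tcat1 !mem_cat !orbA.
have AU y : y \in A 1%g -> y \in U 1%g.
  move=> yA; have := cover y; rewrite yA => /esym /orP [/orP [//|yV]|yZ].
    have := tcat_before13 (unh h1) (mA _ _ yA) (mC _ _ cC).
    by rewrite e (tcat_before23 (unh' h1) (mV _ _ yV) (mZ _ _ cZ)) eh1.
  have := tcat_before12 (unh 1%g) yA bB.
  have := tcat_before23 (unh' 1%g) bV yZ; rewrite -e eh0 /before /=; clear; lia.
have BV y : y \in B 1%g -> y \in V 1%g.
  move=> yB; have := cover y; rewrite yB orbT => /esym /orP [/orP [yU|//]|yZ].
    have := tcat_before23 (unh h1) (mB _ _ yB) (mC _ _ cC).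
    by rewrite e (tcat_before13 (unh' h1) (mU _ _ yU) (mZ _ _ cZ)) eh1.
  have := tcat_before12 (unh h2) (mA _ _ aA) (mB _ _ yB).
  by rewrite e (tcat_before13 (unh' h2) (mU _ _ aU) (mZ _ _ yZ)) eh2.
have CZ y : y \in C 1%g -> y \in Z 1%g.
  move=> yC; have := cover y; rewrite yC orbT => /esym /orP [/orP [yU|yV]|//].
    have := tcat_before23 (unh 1%g) bB yC.
    have := tcat_before12 (unh' 1%g) yU bV; rewrite -e eh0 /before /=; clear; lia.
  have := tcat_before13 (unh h2) (mA _ _ aA) (mC _ _ yC).
  by rewrite e (tcat_before12 (unh' h2) (mU _ _ aU) (mV _ _ yV)) eh2.
have [szA szB] : size (A 1%g) = size (U 1%g) /\ size (B 1%g) = size (V 1%g).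
  have := un; rewrite tcat1 !cat_uniq => /and3P [uA _ /and3P [uB _ uC]].
  have := uniq_leq_size uA AU; have := uniq_leq_size uB BV.
  have := uniq_leq_size uC CZ; have := congr1 size (e 1%g).
  rewrite !tcat1 !size_cat; clear; lia.
have H h : [/\ A h = U h, B h = V h & C h = Z h].
  have sz1 : size (A h) = size (U h) by rewrite !stable_size.
  have sz2 : size (B h) = size (V h) by rewrite !stable_size.
  have := congr1 size (e h); rewrite /tcat.
  have := e h; rewrite /tcat; case: (turn p h) => [|[|r]] /=.
  - by move=> /cat_inj_size [] // -> /cat_inj_size [] // -> ->.
  - move=> /cat_inj_size [] // -> e3; rewrite !size_cat => sz.
    by case/cat_inj_size: e3 => [|-> ->]; first lia.
  - rewrite !size_cat => e3 sz.
    by case/cat_inj_size: e3 => [|-> /cat_inj_size [] // -> ->]; first lia.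
by split=> h; case: (H h).
Qed.

(** A ternary root with an empty argument is a binary one in disguise; with three nonempty
    arguments, [bin_tern_absurd] leaves only decompositions with an empty side. *)
Lemma split_bin t : uniq (wd t 1%g) -> splits_bin (ev t) (wd t).
Proof.
(* A leaf or the unit has too short a word for two nonempty sides, so the unit law produces the
   splitting. *)
have trivial_split (v : S) W : (forall d U V, stable U -> stable V ->
    U 1%g <> [::] -> V 1%g <> [::] -> ~ W 1%g = bcat d U V 1%g) ->
    (exists2 t, v = ev t & W =1 wd t) -> splits_bin v W.
  move=> H [{}t -> eW] d U V sU sV e.
  have [Un|/eqP Un] := eqVneq (U 1%g) [::].
    exists Unt, t; rewrite mb_el; split=> // h /=; first by rewrite (stable_nil sU Un).
    by rewrite -eW e bcat_nill // (stable_nil sU Un).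
  have [Vn|/eqP Vn] := eqVneq (V 1%g) [::].
    exists t, Unt; rewrite mb_er; split=> // h /=; last by rewrite (stable_nil sV Vn).
    by rewrite -eW e bcat_nilr // (stable_nil sV Vn).
  by case: (H d U V).
elim: t => [i _||d s IHs t IHt|p s IHs t IHt u IHu] /=.
- apply: trivial_split; last by exists (Leaf i).
  move=> d U V _ _ nU nV /(congr1 size); rewrite bcat1 size_cat.
  by case: (U 1%g) nU => // a U'; case: (V 1%g) nV => //= b V' _ _; lia.
- move=> _; apply: trivial_split; last by exists Unt.
  by move=> d U V _ _ nU nV; rewrite bcat1; case: (U 1%g) nU.
- move=> un; apply: split_bin_bin => //; have := un; rewrite bcat1 cat_uniq.
    by case/and3P => /IHs.
  by case/and3P => _ _ /IHt.
move=> un; have := un; rewrite tcat1 !cat_uniq => /and3P [us _ /and3P [ut _ uu]].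
have ext (v : S) W W' : W =1 W' -> splits_bin v W' -> splits_bin v W.
  by move=> eW H d U V sU sV e; apply: H => // h; rewrite -eW e.
have [sn|] := eqVneq (wd s 1%g) [::].
  have eW : tcat p (wd s) (wd t) (wd u) =1 bcat (ins1 p) (wd t) (wd u).
    by move=> h; apply: tcat_nil1; apply: stable_nil (@stable_wd _ _ _ _ s) sn h.
  rewrite (ev_nil sn) mt_e1; apply: (ext _ _ _ eW).
  apply: split_bin_bin; [by rewrite -eW|exact: IHt|exact: IHu].
have [tn|] := eqVneq (wd t 1%g) [::].
  have eW : tcat p (wd s) (wd t) (wd u) =1 bcat (ins2 p) (wd s) (wd u).
    by move=> h; apply: tcat_nil2; apply: stable_nil (@stable_wd _ _ _ _ t) tn h.
  rewrite (ev_nil tn) mt_e2 => _; apply: (ext _ _ _ eW).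
  apply: split_bin_bin; [by rewrite -eW|exact: IHs|exact: IHu].
have [un0|/eqP nu /eqP nt /eqP ns] := eqVneq (wd u 1%g) [::].
  have eW : tcat p (wd s) (wd t) (wd u) =1 bcat (ins3 p) (wd s) (wd t).
    by move=> h; apply: tcat_nil3; apply: stable_nil (@stable_wd _ _ _ _ u) un0 h.
  rewrite (ev_nil un0) mt_e3 => _ _; apply: (ext _ _ _ eW).
  apply: split_bin_bin; [by rewrite -eW|exact: IHs|exact: IHt].
move=> d U V sU sV e.
have [Un|/eqP Un] := eqVneq (U 1%g) [::].
  exists Unt, (Tern p s t u); rewrite mb_el; split=> // h /=.
    by rewrite (stable_nil sU Un).
  by rewrite e bcat_nill // (stable_nil sU Un).
have [Vn|/eqP Vn] := eqVneq (V 1%g) [::].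
  exists (Tern p s t u), Unt; rewrite mb_er; split=> // h /=.
    by rewrite e bcat_nilr // (stable_nil sV Vn).
  by rewrite (stable_nil sV Vn).
exfalso; apply: (@bin_tern_absurd d p U V (wd s) (wd t) (wd u)) => //;
  by [exact: stable_wd | rewrite -e | move=> h; rewrite e].
Qed.

Lemma split_tern_bin d s1 s2 : uniq (bcat d (wd s1) (wd s2) 1%g) ->
  splits_tern (ev s1) (wd s1) -> splits_tern (ev s2) (wd s2) ->
  splits_tern (mb d (ev s1) (ev s2)) (bcat d (wd s1) (wd s2)).
Proof.
move=> un IH1 IH2 p U V Z sU sV sZ nU nV nZ e.
have [s1n|] := eqVneq (wd s1 1%g) [::].
  rewrite (ev_nil s1n) mb_el; apply: IH2 => // h.
  by rewrite -e bcat_nill // (stable_nil _ s1n) //; apply: stable_wd.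
have [s2n|/eqP s2n /eqP s1n] := eqVneq (wd s2 1%g) [::].
  move=> _; rewrite (ev_nil s2n) mb_er; apply: IH1 => // h.
  by rewrite -e bcat_nilr // (stable_nil _ s2n) //; apply: stable_wd.
exfalso; apply: (@bin_tern_absurd d p (wd s1) (wd s2) U V Z) => //; exact: stable_wd.
Qed.

Lemma split_tern t : uniq (wd t 1%g) -> splits_tern (ev t) (wd t).
Proof.
elim: t => [i||d s IHs t IHt|p s IHs t IHt u IHu] /=.
- move=> _ p U V Z _ _ _ nU nV nZ /(_ 1%g) /(congr1 size) /=.
  rewrite tcat1 !size_cat; case: (U 1%g) nU => // a U'.
  by case: (V 1%g) nV => //= b V' _ _; lia.
- move=> _ p U V Z _ _ _ nU nV nZ /(_ 1%g); rewrite tcat1.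
  by case: (U 1%g) nU.
- move=> un; apply: split_tern_bin => //; have := un; rewrite bcat1 cat_uniq.
    by case/and3P => /IHs.
  by case/and3P => _ _ /IHt.
move=> un; have := un; rewrite tcat1 !cat_uniq => /and3P [us _ /and3P [ut _ uu]].
have ext (v : S) W W' : W =1 W' -> splits_tern v W' -> splits_tern v W.
  by move=> eW H q U V Z sU sV sZ nU nV nZ e; apply: H => // h; rewrite -eW e.
have [sn|] := eqVneq (wd s 1%g) [::].
  have eW : tcat p (wd s) (wd t) (wd u) =1 bcat (ins1 p) (wd t) (wd u).
    by move=> h; apply: tcat_nil1; apply: stable_nil (@stable_wd _ _ _ _ s) sn h.
  rewrite (ev_nil sn) mt_e1; apply: (ext _ _ _ eW).
  apply: split_tern_bin; [by rewrite -eW|exact: IHt|exact: IHu].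
have [tn|] := eqVneq (wd t 1%g) [::].
  have eW : tcat p (wd s) (wd t) (wd u) =1 bcat (ins2 p) (wd s) (wd u).
    by move=> h; apply: tcat_nil2; apply: stable_nil (@stable_wd _ _ _ _ t) tn h.
  rewrite (ev_nil tn) mt_e2 => _; apply: (ext _ _ _ eW).
  apply: split_tern_bin; [by rewrite -eW|exact: IHs|exact: IHu].
have [un0|/eqP nu /eqP nt /eqP ns] := eqVneq (wd u 1%g) [::].
  have eW : tcat p (wd s) (wd t) (wd u) =1 bcat (ins3 p) (wd s) (wd t).
    by move=> h; apply: tcat_nil3; apply: stable_nil (@stable_wd _ _ _ _ u) un0 h.
  rewrite (ev_nil un0) mt_e3 => _ _; apply: (ext _ _ _ eW).
  apply: split_tern_bin; [by rewrite -eW|exact: IHs|exact: IHt].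
(* Only here do two ternary operations meet; [top_irr] identifies them before [tcat_inj] matches the
   arguments. *)
move=> q U V Z sU sV sZ nU nV nZ; rewrite (top_irr q p) => e.
exists s, t, u.
by have [] := tcat_inj (@stable_wd _ _ _ _ s) (@stable_wd _ _ _ _ t)
  (@stable_wd _ _ _ _ u) sU sV sZ ns nt nu nU nV nZ un e.
Qed.

(* The laws of a model are thus a presentation of the operad of families of words
   generated by the operations of the signature. *)
Theorem ev_words t t' : uniq (wd t 1%g) -> wd t =1 wd t' -> ev t = ev t'.
Proof.
elim: t t' => [i||d s IHs t IHt|p s IHs t IHt u IHu] t' /=.
- by move=> _ /(_ 1%g) /esym /ev_single.
- by move=> _ /(_ 1%g) /esym /ev_nil.
- move=> un e; have un' : uniq (wd t' 1%g) by rewrite -e.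
  have e' h : wd t' h = bcat d (wd s) (wd t) h by rewrite e.
  have [t1 [t2 [-> e1 e2]]] := split_bin un' (@stable_wd _ _ _ _ s) (@stable_wd _ _ _ _ t) e'.
  have := un; rewrite bcat1 cat_uniq => /and3P [us _ ut].
  by rewrite (IHs t1) ?(IHt t2).
move=> un e; have := un; rewrite tcat1 !cat_uniq => /and3P [us _ /and3P [ut _ uu]].
have bin_case d (s1 s2 : term Sg L) :
    (forall t', uniq (wd s1 1%g) -> wd s1 =1 wd t' -> ev s1 = ev t') ->
    (forall t', uniq (wd s2 1%g) -> wd s2 =1 wd t' -> ev s2 = ev t') ->
    wd t' =1 bcat d (wd s1) (wd s2) -> mb d (ev s1) (ev s2) = ev t'.
  move=> IH1 IH2 e'; have un' : uniq (wd t' 1%g) by rewrite -e.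
  have [t1 [t2 [-> e1 e2]]] := split_bin un' (@stable_wd _ _ _ _ s1) (@stable_wd _ _ _ _ s2) e'.
  have := un'; rewrite e' bcat1 cat_uniq => /and3P [u1 _ u2].
  by rewrite (IH1 t1) ?(IH2 t2).
have [sn|] := eqVneq (wd s 1%g) [::].
  rewrite (ev_nil sn) mt_e1; apply: bin_case => // h; rewrite -e tcat_nil1 //.
  exact: stable_nil (@stable_wd _ _ _ _ s) sn h.
have [tn|] := eqVneq (wd t 1%g) [::].
  rewrite (ev_nil tn) mt_e2 => _; apply: bin_case => // h; rewrite -e tcat_nil2 //.
  exact: stable_nil (@stable_wd _ _ _ _ t) tn h.
have [un0|/eqP nu /eqP nt /eqP ns] := eqVneq (wd u 1%g) [::].
  rewrite (ev_nil un0) mt_e3 => _ _; apply: bin_case => // h; rewrite -e tcat_nil3 //.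
  exact: stable_nil (@stable_wd _ _ _ _ u) un0 h.
have un' : uniq (wd t' 1%g) by rewrite -e.
have e' h : wd t' h = tcat p (wd s) (wd t) (wd u) h by rewrite e.
have [t1 [t2 [t3 [-> e1 e2 e3]]]] := split_tern un' (@stable_wd _ _ _ _ s)
  (@stable_wd _ _ _ _ t) (@stable_wd _ _ _ _ u) ns nt nu e'.
by rewrite (IHs t1) ?(IHt t2) ?(IHu t3).
Qed.

End Presentation.

(** * Coherence for permutative categories *)

Section Composition.
Variable C : category.
Implicit Types f g h m : Mor C.

(* Composition as a total operation, with junk value [f] on pairs that are not
   composable. *)
Definition cmp f g : Mor C :=
  if pselect (src f = tgt g) is left H then compm f g H else f.

Lemma cmpE f g (H : src f = tgt g) : cmp f g = compm f g H.
Proof. by rewrite /cmp; case: pselect => // H'; apply: comp_eq. Qed.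

Lemma tgt_cmp f g : tgt (cmp f g) = tgt f.
Proof. by rewrite /cmp; case: pselect => // H; rewrite tgt_comp. Qed.

Lemma src_cmp f g : src f = tgt g -> src (cmp f g) = src g.
Proof. by move=> H; rewrite (cmpE H) src_comp. Qed.

Lemma cmpA f g h : src f = tgt g -> src g = tgt h ->
  cmp f (cmp g h) = cmp (cmp f g) h.
Proof.
move=> H1 H2; have H3 : src f = tgt (cmp g h) by rewrite tgt_cmp.
have H4 : src (cmp f g) = tgt h by rewrite src_cmp.
rewrite (cmpE H3) (cmpE H4); have H5 : src f = tgt (compm g h H2) by rewrite tgt_comp.
have H6 : src (compm f g H1) = tgt h by rewrite src_comp.
transitivity (compm f (compm g h H2) H5); first by apply: comp_eq; rewrite ?cmpE.
by rewrite (comp_assoc H5 H6); apply: comp_eq; rewrite ?cmpE.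
Qed.

Lemma cmp1l f a : tgt f = a -> cmp (idm a) f = f.
Proof.
move=> <-; have H : src (idm (tgt f)) = tgt f by rewrite src_idm.
by rewrite (cmpE H) comp_idl.
Qed.

Lemma cmp1r f a : src f = a -> cmp f (idm a) = f.
Proof.
move=> <-; have H : src f = tgt (idm (src f)) by rewrite tgt_idm.
by rewrite (cmpE H) comp_idr.
Qed.

Lemma is_compE f g h : is_comp f g h <-> src f = tgt g /\ cmp f g = h.
Proof.
split=> [[H <-]|[H <-]]; first by rewrite cmpE.
by exists H; rewrite cmpE.
Qed.

Lemma comm_squareE f g f' g' : comm_square f g f' g' <->
  [/\ src f = tgt g, src f' = tgt g' & cmp f g = cmp f' g'].
Proof.
split=> [[h /is_compE [H <-] /is_compE [H' e]]|[H H' e]]; first by split.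
by exists (cmp f g); apply/is_compE.
Qed.

Lemma isoE f : is_iso f <-> exists g, [/\ src g = tgt f, tgt g = src f,
  cmp f g = idm (tgt f) & cmp g f = idm (src f)].
Proof.
split=> [[g [/is_compE [H1 H2] /is_compE [H3 H4]]]|[g [H1 H2 H3 H4]]].
  by exists g; split.
by exists g; split; apply/is_compE.
Qed.

Lemma iso_cancel f m m' : is_iso f -> src f = tgt m -> src f = tgt m' ->
  cmp f m = cmp f m' -> m = m'.
Proof.
move=> /isoE [g [H1 H2 H3 H4]] hm hm' /(congr1 (cmp g)).
by rewrite !cmpA // H4 !cmp1l.
Qed.

Lemma iso_id a : is_iso (idm a : Mor C).
Proof.
apply/isoE; exists (idm a).
by rewrite !src_idm !tgt_idm cmp1l ?tgt_idm.
Qed.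

Lemma iso_cmp f g : src f = tgt g -> is_iso f -> is_iso g -> is_iso (cmp f g).
Proof.
move=> H /isoE [f' [f1 f2 f3 f4]] /isoE [g' [g1 g2 g3 g4]]; apply/isoE.
have H' : src g' = tgt f' by rewrite g1 f2.
exists (cmp g' f'); rewrite !tgt_cmp !src_cmp //; split=> //.
- rewrite -cmpA ?tgt_cmp // 1?[cmp g _]cmpA // ?g2 // g3 cmp1l -?H //.
- rewrite -cmpA ?tgt_cmp // 1?[cmp f' _]cmpA // ?f2 // f4 cmp1l ?H //.
Qed.

End Composition.

Lemma fmor_cmp (C D : category) (F : functor C D) f g : src f = tgt g ->
  fmor F (cmp f g) = cmp (fmor F f) (fmor F g).
Proof.
move=> H; have H' : src (fmor F f) = tgt (fmor F g) by rewrite src_fmor tgt_fmor H.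
by rewrite (cmpE H) (cmpE H') (fmor_comp H H').
Qed.

(** * Calculus in a permutative category with composition as a total operation *)

Section Permutative.
Variables (C : category) (p : permutative C).
Implicit Types (a b c : C) (f g h m : Mor C).

Definition teno a b : C := pten p (a, b).
Definition tenm f g : Mor C := fmor (pten p) (f, g).
Definition beta a b : Mor C := pbeta p (a, b).

Local Notation "f ∘ g" := (cmp f g) (at level 40, left associativity).
Local Notation "a ⊙ b" := (teno a b) (at level 35, right associativity).
Local Notation "f ⊗ g" := (tenm f g) (at level 35, right associativity).
Local Notation e := (pe p).

Lemma src_ten f g : src (f ⊗ g) = src f ⊙ src g.
Proof. exact: src_fmor. Qed.
Lemma tgt_ten f g : tgt (f ⊗ g) = tgt f ⊙ tgt g.
Proof. exact: tgt_fmor. Qed.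
Lemma ten_id a b : idm a ⊗ idm b = idm (a ⊙ b).
Proof. exact: (fmor_id (pten p) (a, b)). Qed.

Lemma cmp_pair (D E : category) (f g : Mor (prod_category D E)) : src f = tgt g ->
  cmp f g = (cmp f.1 g.1, cmp f.2 g.2).
Proof. by move=> H; rewrite (cmpE H) /= (cmpE (congr1 fst H)) (cmpE (congr1 snd H)). Qed.

Lemma tenC f f' g g' : src f = tgt g -> src f' = tgt g' ->
  (f ∘ g) ⊗ (f' ∘ g') = (f ⊗ f') ∘ (g ⊗ g').
Proof.
move=> H H'; have Hp : @src (prod_category C C) (f, f') = @tgt (prod_category C C) (g, g').
  by rewrite /= H H'.
by rewrite /tenm -(fmor_cmp _ Hp) (cmp_pair Hp).
Qed.

Lemma tenoA a b c : a ⊙ (b ⊙ c) = (a ⊙ b) ⊙ c. Proof. exact: pten_assoc_ob. Qed.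
Lemma tenA f g h : f ⊗ (g ⊗ h) = (f ⊗ g) ⊗ h. Proof. exact: pten_assoc_mor. Qed.
Lemma tenoel a : e ⊙ a = a. Proof. exact: pten_el_ob. Qed.
Lemma tenoer a : a ⊙ e = a. Proof. exact: pten_er_ob. Qed.
Lemma tenel f : idm e ⊗ f = f. Proof. exact: pten_el_mor. Qed.
Lemma tener f : f ⊗ idm e = f. Proof. exact: pten_er_mor. Qed.

Lemma src_beta a b : src (beta a b) = a ⊙ b.
Proof. exact: (nat_src (pbeta_iso p)). Qed.
Lemma tgt_beta a b : tgt (beta a b) = b ⊙ a.
Proof. exact: (nat_tgt (pbeta_iso p)). Qed.
Lemma beta_iso a b : is_iso (beta a b).
Proof. exact: (nat_is_iso (pbeta_iso p)). Qed.
Lemma beta_nat f g : (g ⊗ f) ∘ beta (src f) (src g) = beta (tgt f) (tgt g) ∘ (f ⊗ g).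
Proof. by case/comm_squareE: (nat_square (pbeta_iso p) (f, g)). Qed.
Lemma betaK a b : beta b a ∘ beta a b = idm (a ⊙ b).
Proof. by case/is_compE: (pbeta_sym p a b). Qed.
Lemma betae a : beta a e = idm a. Proof. exact: pbeta_e. Qed.

End Permutative.

Section Wob.
Variables (C : category) (p : permutative C).
Local Notation "f ∘ g" := (cmp f g) (at level 40, left associativity).
Local Notation "a ⊙ b" := (teno p a b) (at level 35, right associativity).
Local Notation "f ⊗ g" := (tenm p f g) (at level 35, right associativity).
Local Notation beta := (beta p).
Local Notation e := (pe p).
Variables (L : eqType) (x : L -> C).
Implicit Types (i j : L) (w v r s t q u : seq L).

Fixpoint wob w : C := if w is i :: w' then x i ⊙ wob w' else e.

Lemma wob_cat w v : wob (w ++ v) = wob w ⊙ wob v.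
Proof. by elim: w => [|i w IH] /=; rewrite ?tenoel // IH tenoA. Qed.

Lemma wob_cons i w : wob (i :: w) = x i ⊙ wob w. Proof. by []. Qed.

End Wob.

(* [ty] computes sources and targets, solving recursively the side conditions of
   [src_cmp], and compares them up to strict associativity and units. *)
Ltac rw_ctx := match goal with
  | H : src ?f = _ |- context [src ?f] => rewrite H
  | H : tgt ?f = _ |- context [tgt ?f] => rewrite H
  end.

Ltac ty_step := first
  [ rewrite src_ten | rewrite tgt_ten | rewrite src_idm | rewrite tgt_idm
  | rewrite src_beta | rewrite tgt_beta | rewrite tgt_cmp
  | rewrite tenoel | rewrite tenoer | rw_ctx
  | rewrite wob_cat | rewrite wob_cons ].

Ltac ty := repeat (first [ty_step | rewrite src_cmp; [|solve [ty]]]);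
  rewrite -?tenoA; by [].

Section PermutativeTheory.
Variables (C : category) (p : permutative C).
Implicit Types (a b c : C) (f g h m : Mor C).
Local Notation "f ∘ g" := (cmp f g) (at level 40, left associativity).
Local Notation "a ⊙ b" := (teno p a b) (at level 35, right associativity).
Local Notation "f ⊗ g" := (tenm p f g) (at level 35, right associativity).
Local Notation beta := (beta p).
Local Notation e := (pe p).
Lemma beta_el a : beta e a = idm a.
Proof.
have := betaK p a e; rewrite betae cmp1r ?tenoer //; ty.
Qed.

Lemma beta_hexl a b c : beta (a ⊙ b) c = (beta a c ⊗ idm b) ∘ (idm a ⊗ beta b c).
Proof. by case/is_compE: (pbeta_hex p a b c). Qed.

(** The hexagon for a tensor product in the second variable is the inverse of [beta_hexl]: after
    composing with the isomorphism [beta (b ⊙ c) a], both sides become identities. *)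
Lemma beta_hexr a b c : beta a (b ⊙ c) = (idm b ⊗ beta a c) ∘ (beta a b ⊗ idm c).
Proof.
apply: (@iso_cancel _ (beta (b ⊙ c) a)); [exact: beta_iso|ty|ty|].
rewrite betaK beta_hexl -cmpA; [|ty|ty].
rewrite [(_ ⊗ beta c a) ∘ _]cmpA; [|ty|ty].
rewrite -tenC; [|ty|ty]; rewrite betaK cmp1l; last ty.
rewrite ten_id cmp1l; last ty.
by rewrite -tenC ?betaK ?cmp1l ?ten_id -?tenoA //; ty.
Qed.

Lemma ten_idC f g : (idm (tgt f) ⊗ g) ∘ (f ⊗ idm (src g)) = f ⊗ g.
Proof. by rewrite -tenC ?cmp1l ?cmp1r //; ty. Qed.

Lemma ten_Cid f g : (f ⊗ idm (tgt g)) ∘ (idm (src f) ⊗ g) = f ⊗ g.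
Proof. by rewrite -tenC ?cmp1l ?cmp1r //; ty. Qed.

Lemma cmp_inl a f g : src f = tgt g -> (f ∘ g) ⊗ idm a = (f ⊗ idm a) ∘ (g ⊗ idm a).
Proof. by move=> H; rewrite -tenC ?cmp1l //; ty. Qed.

Lemma cmp_inr a f g : src f = tgt g -> idm a ⊗ (f ∘ g) = (idm a ⊗ f) ∘ (idm a ⊗ g).
Proof. by move=> H; rewrite -tenC ?cmp1l //; ty. Qed.

(** Two ways from i j r s to r j s i, by naturality of [beta i] against the move of j past r; this
    is the configuration in which j ends before i. *)
Lemma beta_move1 i j r s :
  (beta j r ⊗ idm (s ⊙ i)) ∘ ((idm j ⊗ beta i (r ⊙ s)) ∘ (beta i j ⊗ idm (r ⊙ s)))
  = beta i (r ⊙ (j ⊙ s)) ∘ (idm i ⊗ (beta j r ⊗ idm s)).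
Proof.
have := beta_nat p (idm i) (beta j r ⊗ idm s).
rewrite src_ten tgt_ten !src_beta !tgt_beta !src_idm !tgt_idm -!tenoA => <-.
by rewrite -tenA ten_id [beta i (j ⊙ _)]beta_hexr.
Qed.

(** The companion configuration, with j ending after i: both sides lead from i j r s to r i s j. The
    two crossings of i and j cancel by [betaK]. *)
Lemma beta_move2 i j r s :
  beta j (r ⊙ (i ⊙ s)) ∘ ((idm j ⊗ (beta i r ⊗ idm s)) ∘ (beta i j ⊗ idm (r ⊙ s)))
  = (beta i r ⊗ idm (s ⊙ j)) ∘ (idm i ⊗ beta j (r ⊙ s)).
Proof.
have := beta_nat p (idm j) (beta i r ⊗ idm s).
rewrite src_ten tgt_ten !src_beta !tgt_beta !src_idm !tgt_idm -!tenoA => H.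
rewrite cmpA; [|ty|ty]; rewrite -H -tenA ten_id [beta j (i ⊙ _)]beta_hexr -!cmpA; try ty.
by rewrite -cmp_inl ?betaK ?ten_id ?cmp1r //; ty.
Qed.

(** The hypothesis is a square supplied by induction; it is tensored with j, and c is then
    interchanged with the symmetry of i and j, which acts on other factors. *)
Lemma move_step i j v k d (c : Mor C) : src k = tgt d -> src d = i ⊙ v -> src c = v ->
  forall f, src f = i ⊙ tgt c -> k ∘ d = f ∘ (idm i ⊗ c) ->
  (idm j ⊗ k) ∘ ((idm j ⊗ d) ∘ (beta i j ⊗ idm v)) =
  (idm j ⊗ f) ∘ ((beta i j ⊗ idm (tgt c)) ∘ (idm i ⊗ (idm j ⊗ c))).
Proof.
move=> hk hd hc f hf e; rewrite cmpA; [|ty|ty].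
rewrite -cmp_inr // e cmp_inr; [|ty]; rewrite -cmpA; [|ty|ty]; congr (_ ∘ _).
have := ten_idC (beta i j) c; have := ten_Cid (beta i j) c.
rewrite src_beta tgt_beta hc -!ten_id -!tenA => -> ->; ty.
Qed.

(** The inductive step of [can_move] when j lands before i, the target being r j s i t: k, d and c
    stand for the maps of the induction hypothesis. [beta_move2s] serves the target r i s j t. *)
Lemma beta_move1s i j r s t k d (c : Mor C) : src k = tgt d -> tgt k = r ⊙ s ⊙ i ⊙ t ->
  src d = i ⊙ src c -> tgt c = r ⊙ s ⊙ t ->
  k ∘ d = (beta i (r ⊙ s) ⊗ idm t) ∘ (idm i ⊗ c) ->
  (beta j r ⊗ idm (s ⊙ i ⊙ t)) ∘ (idm j ⊗ k) ∘
    ((idm j ⊗ d) ∘ (beta i j ⊗ idm (src c))) =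
  (beta i (r ⊙ j ⊙ s) ⊗ idm t) ∘
    (idm i ⊗ ((beta j r ⊗ idm (s ⊙ t)) ∘ (idm j ⊗ c))).
Proof.
move=> h1 h2 h3 h4 e; rewrite -cmpA; [|ty|ty].
rewrite (move_step _ h1 h3 _ _ e) //; [|ty].
rewrite h4 !cmpA; [|ty|ty|ty|ty]; rewrite cmp_inr; [|ty]; rewrite cmpA; [|ty|ty].
congr (_ ∘ _); have := congr1 (fun f => f ⊗ idm t) (beta_move1 i j r s).
rewrite !cmp_inl; try ty; rewrite -!ten_id -!tenA !ten_id => H.
by rewrite -cmpA ?H //; ty.
Qed.

Lemma beta_move2s i j r s t k d (c : Mor C) : src k = tgt d -> tgt k = r ⊙ i ⊙ s ⊙ t ->
  src d = i ⊙ src c -> tgt c = r ⊙ s ⊙ t ->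
  k ∘ d = (beta i r ⊗ idm (s ⊙ t)) ∘ (idm i ⊗ c) ->
  (beta j (r ⊙ i ⊙ s) ⊗ idm t) ∘ (idm j ⊗ k) ∘
    ((idm j ⊗ d) ∘ (beta i j ⊗ idm (src c))) =
  (beta i r ⊗ idm (s ⊙ j ⊙ t)) ∘
    (idm i ⊗ ((beta j (r ⊙ s) ⊗ idm t) ∘ (idm j ⊗ c))).
Proof.
move=> h1 h2 h3 h4 e; rewrite -cmpA; [|ty|ty].
rewrite (move_step _ h1 h3 _ _ e) //; [|ty].
rewrite h4 !cmpA; [|ty|ty|ty|ty]; rewrite cmp_inr; [|ty]; rewrite cmpA; [|ty|ty].
congr (_ ∘ _); have := congr1 (fun f => f ⊗ idm t) (beta_move2 i j r s).
rewrite !cmp_inl; try ty; rewrite -!ten_id -!tenA !ten_id => H.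
by rewrite -cmpA ?H //; ty.
Qed.

End PermutativeTheory.

(** * Canonical permutation isomorphisms between tensor products of words *)

Section Canonical.
Variables (C : category) (p : permutative C).
Implicit Types (a b c : C) (f g h m : Mor C).
Local Notation "f ∘ g" := (cmp f g) (at level 40, left associativity).
Local Notation "a ⊙ b" := (teno p a b) (at level 35, right associativity).
Local Notation "f ⊗ g" := (tenm p f g) (at level 35, right associativity).
Local Notation beta := (beta p).
Local Notation e := (pe p).
Variables (L : eqType) (x : L -> C).
Implicit Types (i j : L) (w v r s t q u : seq L).
Local Notation wob := (wob p x).

(* The canonical isomorphism [wob w -> wob w'], moving the head of [w] to its place in
   [w'] last; it has junk values unless [w'] is a permutation of [w], and is meant for
   words without repetitions. *)
Fixpoint can w w' : Mor C :=
  if w is i :: w1 then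
    (beta (x i) (wob (take (index i w') w')) ⊗ idm (wob (drop (index i w').+1 w')))
    ∘ (idm (x i) ⊗ can w1 (rem i w'))
  else idm e.

Lemma can_cons i w r s : i \notin r -> can (i :: w) (r ++ i :: s) =
  (beta (x i) (wob r) ⊗ idm (wob s)) ∘ (idm (x i) ⊗ can w (r ++ s)).
Proof.
move=> ir /=; rewrite index_cat (negbTE ir) /= eqxx addn0 take_size_cat //.
rewrite drop_cat ltnNge leqnSn /= subSnn drop1 /= remE index_cat (negbTE ir).
rewrite /= eqxx addn0 take_size_cat //.
by rewrite drop_cat ltnNge leqnSn /= subSnn drop1.
Qed.

Lemma split_mem i w : i \in w -> exists r s, w = r ++ i :: s /\ i \notin r.
Proof.
move=> iw; exists (take (index i w) w), (drop (index i w).+1 w).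
rewrite -{1}(cat_take_drop (index i w) w) (drop_nth i) ?index_mem // nth_index //.
split=> //; rewrite in_take_leq ?ltnn //; exact: index_size.
Qed.

Lemma perm_cons_split i w w' : perm_eq (i :: w) w' -> exists r s,
  [/\ w' = r ++ i :: s, i \notin r & perm_eq w (r ++ s)].
Proof.
move=> pe; have : i \in w' by rewrite -(perm_mem pe) mem_head.
case/split_mem => r [s [ew ir]]; exists r, s; split=> //.
by rewrite -(perm_cons i); apply: perm_trans pe _; rewrite ew -cat1s perm_catCA.
Qed.

Lemma can_ty w w' : perm_eq w w' -> src (can w w') = wob w /\ tgt (can w w') = wob w'.
Proof.
elim: w w' => [|i w IH] w'; first by rewrite perm_sym => /perm_nilP ->; split; ty.
case/perm_cons_split => r [s [-> ir pe]]; rewrite can_cons //.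
have [h1 h2] := IH _ pe; rewrite wob_cat in h2.
rewrite wob_cat /=; split; ty.
Qed.

Lemma src_can w w' : perm_eq w w' -> src (can w w') = wob w.
Proof. by case/can_ty. Qed.

Lemma tgt_can w w' : perm_eq w w' -> tgt (can w w') = wob w'.
Proof. by case/can_ty. Qed.

Lemma perm_insert i u q r s : perm_eq (u ++ q) (r ++ s) ->
  perm_eq (u ++ i :: q) (r ++ i :: s).
Proof.
move=> pe; rewrite -[i :: q]cat1s -[i :: s]cat1s perm_catCA perm_sym perm_catCA.
by rewrite perm_cat2l perm_sym.
Qed.

(** The recursion of [can] treats the head of the source word specially; this makes every letter
    eligible, by bringing it to the front. The induction runs over the letters u that precede i, and
    its two cases are whether the head j of u lands before or after i in the target. *)
Lemma can_move i u q r s : uniq (u ++ i :: q) -> perm_eq (u ++ q) (r ++ s) ->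
  can (u ++ i :: q) (r ++ i :: s) ∘ (beta (x i) (wob u) ⊗ idm (wob q)) =
  (beta (x i) (wob r) ⊗ idm (wob s)) ∘ (idm (x i) ⊗ can (u ++ q) (r ++ s)).
Proof.
elim: u r s => [|j u IH] r s un pe.
  have ir : i \notin r.
    by move: un => /= /andP [iq _]; move: iq; rewrite (perm_mem pe) mem_cat; case/norP.
  have [h1 h2] := can_ty pe.
  rewrite [[::] ++ _]/= can_cons // betae ten_id cmp1r //=; ty.
have ur : uniq (j :: i :: u ++ q).
  by rewrite -(perm_uniq (s1 := (j :: u) ++ i :: q)) // cat_cons perm_cons -cat1s perm_catCA.
have nij : i != j by move: ur => /= /andP []; rewrite inE negb_or eq_sym => /andP [].
have uiq : uniq (u ++ i :: q) by move: un => /= /andP [].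
have ir : i \notin r.
  have : i \notin r ++ s; last by rewrite mem_cat; case/norP.
  by rewrite -(perm_mem pe) inE (negbTE nij); move: ur => /= /and3P [].
have jrs : j \in r ++ s by rewrite -(perm_mem pe) mem_head.
have urs : uniq (r ++ s).
  rewrite -(perm_uniq pe); move: ur => /= /andP [].
  by rewrite inE => /norP [_ ->] /andP [].
have hexj : beta (x i) (wob (j :: u)) ⊗ idm (wob q) =
    (idm (x j) ⊗ (beta (x i) (wob u) ⊗ idm (wob q))) ∘
    (beta (x i) (x j) ⊗ idm (wob (u ++ q))).
  rewrite wob_cons beta_hexr cmp_inl; last by ty.
  by rewrite -!tenA ten_id wob_cat.
move: jrs; rewrite mem_cat => /orP [/split_mem [r1 [r2 [er jr1]]]|/split_mem [s1 [s2 [es js1]]]].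
- subst r; have pe' : perm_eq (u ++ q) ((r1 ++ r2) ++ s).
    by rewrite -(perm_cons j); apply: perm_trans pe _; rewrite -[j :: r2]cat1s -!catA perm_catCA.
  have [h1 h2] := can_ty pe'.
  have pe'' : perm_eq (u ++ i :: q) ((r1 ++ r2) ++ i :: s).
    exact: perm_insert.
  have [h3 h4] := can_ty pe''.
  rewrite -[(r1 ++ j :: r2) ++ i :: s]catA [in can _ _](cat_cons j).
  rewrite cat_cons can_cons // hexj catA.
  have -> : can ((j :: u) ++ q) ((r1 ++ j :: r2) ++ s) =
      (beta (x j) (wob r1) ⊗ idm (wob (r2 ++ s))) ∘
      (idm (x j) ⊗ can (u ++ q) ((r1 ++ r2) ++ s)).
    by rewrite -catA cat_cons can_cons // catA.
  rewrite -h1 !wob_cat !wob_cons; apply: beta_move1s; rewrite ?h1 ?h2 ?h3 ?h4 //;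
    try by ty.
  by rewrite IH // wob_cat.
have jr : j \notin r.
  have := urs; rewrite cat_uniq => /and3P [_ /hasPn /(_ j) H _]; apply: H.
  by rewrite es mem_cat mem_head orbT.
subst s; have pe' : perm_eq (u ++ q) (r ++ (s1 ++ s2)).
  rewrite -(perm_cons j); apply: perm_trans pe _.
  by rewrite -[j :: s2]cat1s catA perm_catCA -?catA.
have [h1 h2] := can_ty pe'; have pe'' := perm_insert i pe'; have [h3 h4] := can_ty pe''.
have jris : j \notin r ++ i :: s1 by rewrite mem_cat inE eq_sym !negb_or jr nij.
rewrite -[i :: s1 ++ j :: s2]/((i :: s1) ++ j :: s2) catA cat_cons can_cons //.
rewrite -catA cat_cons hexj.
have -> : can ((j :: u) ++ q) (r ++ s1 ++ j :: s2) =
    (beta (x j) (wob (r ++ s1)) ⊗ idm (wob s2)) ∘ (idm (x j) ⊗ can (u ++ q) (r ++ s1 ++ s2)).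
  by rewrite catA cat_cons can_cons -?catA // mem_cat negb_or jr.
rewrite -h1 !wob_cat !wob_cons; apply: beta_move2s; rewrite ?h1 ?h2 ?h3 ?h4 //;
  try by ty.
by rewrite IH // wob_cat.
Qed.

(** Symmetric coherence in the form needed here. The head i of w sits in the middle of w', so the
    second factor cannot be unfolded directly; [can_move] unfolds it at that letter. *)
Lemma can_trans w w' w'' : uniq w -> perm_eq w w' -> perm_eq w' w'' ->
  can w' w'' ∘ can w w' = can w w''.
Proof.
elim: w w' w'' => [|i w IH] w' w'' un.
  rewrite perm_sym => /perm_nilP ->; rewrite perm_sym => /perm_nilP -> /=.
  by rewrite cmp1l //; ty.
case/perm_cons_split => u [q [-> iu pe]] pe'.
have : perm_eq (i :: u ++ q) w''.
  by rewrite -cat1s -perm_catCA.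
case/perm_cons_split => r [s [ew ir pe2]]; subst w''.
have [iw uw] := andP un; have uq : uniq (u ++ q) by rewrite -(perm_uniq pe).
have [h1 h2] := can_ty pe; have [h3 h4] := can_ty pe2; have [h5 h6] := can_ty pe'.
rewrite !can_cons // cmpA; [|ty|ty]; rewrite can_move //; last first.
  by rewrite -cat1s uniq_catCA /= -(perm_mem pe) iw.
rewrite -cmpA; [|ty|ty]; rewrite -cmp_inr; [|ty].
by rewrite IH.
Qed.

Lemma can_id w : uniq w -> can w w = idm (wob w).
Proof.
elim: w => [//|i w IH] /andP [iw uw]; rewrite -{2}[i :: w]/([::] ++ i :: w).
rewrite can_cons // betae IH //= !ten_id cmp1r //; ty.
Qed.

Lemma can_cat w w' v v' : uniq (w ++ v) -> perm_eq w w' -> perm_eq v v' ->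
  can w w' ⊗ can v v' = can (w ++ v) (w' ++ v').
Proof.
elim: w w' => [|i w IH] w'; first by move=> _; rewrite perm_sym => /perm_nilP -> _; rewrite tenel.
rewrite cat_cons => /andP [iwv uwv] /perm_cons_split [r [s [-> ir pe]]] pev.
have [h1 h2] := can_ty pe; have [h3 h4] := can_ty pev.
rewrite -catA cat_cons !can_cons // [in RHS]catA -IH //.
have -> : can v v' = idm (wob v') ∘ can v v' by rewrite cmp1l //; ty.
rewrite tenC; [|ty|ty]; rewrite cmp1l; [|ty].
by rewrite -!tenA ten_id wob_cat.
Qed.

Lemma can_beta w v : uniq (w ++ v) -> can (w ++ v) (v ++ w) = beta (wob w) (wob v).
Proof.
elim: w => [|i w IH].
  by move=> uv; rewrite cats0 can_id // beta_el.
rewrite cat_cons => /andP [iwv uwv]; rewrite can_cons ?IH //; first by rewrite beta_hexl.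
by move: iwv; rewrite mem_cat; case/norP.
Qed.

Lemma can_iso w w' : uniq w -> perm_eq w w' -> is_iso (can w w').
Proof.
move=> un pe; apply/isoE; have pe' : perm_eq w' w by rewrite perm_sym.
exists (can w' w); have [-> ->] := can_ty pe; have [-> ->] := can_ty pe'.
by rewrite !can_trans ?can_id -?(perm_uniq pe).
Qed.

End Canonical.

Local Notation "f ∘ g" := (cmp f g) (at level 40, left associativity).

Section CanonicalNatural.
Variables (C : category) (p : permutative C).
Local Notation "a ⊙ b" := (teno p a b) (at level 35, right associativity).
Local Notation "f ⊗ g" := (tenm p f g) (at level 35, right associativity).
Local Notation beta := (beta p).
Local Notation e := (pe p).

Lemma ten_iso f g : is_iso f -> is_iso g -> is_iso (f ⊗ g).
Proof.
move=> /isoE [f' [f1 f2 f3 f4]] /isoE [g' [g1 g2 g3 g4]]; apply/isoE.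
exists (f' ⊗ g'); rewrite -!tenC // f3 f4 g3 g4 !ten_id.
split; ty.
Qed.

Section Labels.
Variable L : eqType.
Implicit Types (i j : L) (w v r s t q u : seq L).

Fixpoint wmor (phi : L -> Mor C) w : Mor C :=
  if w is i :: w' then phi i ⊗ wmor phi w' else idm e.

Lemma wmor_cat phi w v : wmor phi (w ++ v) = wmor phi w ⊗ wmor phi v.
Proof. by elim: w => [|i w IH] /=; rewrite ?tenel // IH tenA. Qed.

Lemma src_wmor phi w : src (wmor phi w) = wob p (src \o phi) w.
Proof. by elim: w => [|i w IH] /=; rewrite ?src_idm // src_ten IH. Qed.

Lemma tgt_wmor phi w : tgt (wmor phi w) = wob p (tgt \o phi) w.
Proof. by elim: w => [|i w IH] /=; rewrite ?tgt_idm // tgt_ten IH. Qed.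

End Labels.
End CanonicalNatural.

Ltac ty_step ::= first
  [ rewrite src_ten | rewrite tgt_ten | rewrite src_idm | rewrite tgt_idm
  | rewrite src_beta | rewrite tgt_beta | rewrite tgt_cmp
  | rewrite tenoel | rewrite tenoer | rw_ctx
  | rewrite src_wmor | rewrite tgt_wmor | rewrite wob_cat | rewrite wob_cons ].

(** * Naturality of the canonical isomorphisms and substitution of words for letters *)

Section CanonicalSubst.
Variables (C : category) (p : permutative C).
Local Notation "a ⊙ b" := (teno p a b) (at level 35, right associativity).
Local Notation "f ⊗ g" := (tenm p f g) (at level 35, right associativity).
Local Notation beta := (beta p).
Local Notation e := (pe p).
Variable L : eqType.
Implicit Types (i j : L) (w v r s t q u : seq L).

Lemma can_nat phi w w' : perm_eq w w' ->
  can p (tgt \o phi) w w' ∘ wmor p phi w = wmor p phi w' ∘ can p (src \o phi) w w'.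
Proof.
elim: w w' => [|i w IH] w'; first by rewrite perm_sym => /perm_nilP ->.
case/perm_cons_split => r [s [-> ir pe]]; rewrite !can_cons // wmor_cat /=.
have [h1 h2] := can_ty p (tgt \o phi) pe; have [h3 h4] := can_ty p (src \o phi) pe.
rewrite -cmpA; [|ty|ty]; rewrite -tenC; [|ty|ty].
rewrite IH // cmp1l //.
rewrite -[X in _ ∘ (X ⊗ _) = _](cmp1r (erefl (src (phi i)))).
rewrite tenC; [|ty|ty]; rewrite !cmpA; [|ty|ty|ty|ty]; congr (_ ∘ _).
rewrite wmor_cat !tenA -!tenC; try ty.
have := beta_nat p (phi i) (wmor p phi r).
by rewrite src_wmor tgt_wmor => ->; rewrite cmp1l ?cmp1r //; ty.
Qed.

Section Subst.
Variables (K : eqType) (y : K -> C) (v : L -> seq K).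
Local Notation fl w := (flatten (map v w)).

Lemma wob_flatten w : wob p (fun i => wob p y (v i)) w = wob p y (fl w).
Proof. by elim: w => [//|i w IH] /=; rewrite IH wob_cat. Qed.

Lemma perm_flatten_map w w' : perm_eq w w' -> perm_eq (fl w) (fl w').
Proof. by move=> pe; apply/perm_flatten/perm_map. Qed.

(** A permutation of letters turns into a permutation of blocks: one block passes the preceding ones
    by [can_beta], [can_cat] adjoins the blocks at rest, and [can_trans] composes the moves. *)
Lemma can_flatten w w' : uniq (fl w) -> perm_eq w w' ->
  can p (fun i => wob p y (v i)) w w' = can p y (fl w) (fl w').
Proof.
elim: w w' => [|i w IH] w' un; first by rewrite perm_sym => /perm_nilP ->.
case/perm_cons_split => r [s [-> ir pe]]; rewrite can_cons //.
have := perm_flatten_map pe; rewrite !map_cat !flatten_cat /= => pef.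
move: un => /= un; have unw : uniq (fl w) by move: un; rewrite cat_uniq => /and3P [].
have un' : uniq (v i ++ fl r ++ fl s).
  by rewrite -(perm_uniq (s1 := v i ++ fl w)) // perm_cat2l.
rewrite IH // !wob_flatten map_cat flatten_cat.
rewrite -(can_id p y (w := v i)) ?(can_cat _ _ _ _ pef) //; last first.
  by move: un; rewrite cat_uniq => /and3P [].
rewrite -(can_id p y (w := fl s)); last by move: un'; rewrite !cat_uniq => /and5P [].
rewrite -can_beta; last by move: un'; rewrite catA cat_uniq => /and3P [].
rewrite can_cat //; [|by rewrite -catA|by rewrite perm_catC].
by rewrite -!catA can_trans // ?perm_cat2l // perm_catCA.
Qed.

Lemma wmor_can (v' : L -> seq K) w : uniq (fl w) ->
  (forall i, perm_eq (v i) (v' i)) ->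
  wmor p (fun i => can p y (v i) (v' i)) w = can p y (fl w) (flatten (map v' w)).
Proof.
move=> un pe; elim: w un => [//|i w IH] /= un; rewrite IH ?can_cat //.
  elim: w {IH un} => [//|j w IH] /=; exact: perm_cat.
by move: un; rewrite cat_uniq => /and3P [].
Qed.

End Subst.

End CanonicalSubst.

(** * Coherence for terms *)

(* The part of a biased permutative structure that it adds to the permutative one:
   the comparison isomorphisms of the binary operations [d] and of the ternary
   operations [p]; these operations are recovered on objects as the sources. *)
Record comparisons (gT : finGroupType) (g : gT) (Sg : signature g)
    (X : gcategory gT) (P : gpermutative X) := Comparisons {
  ups : bop Sg -> X -> X -> Mor X;
  upst : top Sg -> X -> X -> X -> Mor X;
  tgt_ups : forall d a b, tgt (ups d a b) = teno P a b;
  ups_iso : forall d a b, is_iso (ups d a b);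
  ups_el : forall d a, ups d (pe P) a = idm a;
  ups_er : forall d a, ups d a (pe P) = idm a;
  ups_assoc : forall d a b c,
    tenm P (idm a) (ups d b c) ∘ ups d a (src (ups d b c)) =
    tenm P (ups d a b) (idm c) ∘ ups d (src (ups d a b)) c;
  ups_act : forall d a b, fmor (gcat_act g) (ups d a b) =
    if swap d g
    then beta P (gcat_act g b) (gcat_act g a) ∘
         ups (twist d) (gcat_act g b) (gcat_act g a)
    else ups (twist d) (gcat_act g a) (gcat_act g b);
  tgt_upst : forall p a b c, tgt (upst p a b c) = teno P a (teno P b c);
  upst_iso : forall p a b c, is_iso (upst p a b c);
  upst_e1 : forall p a b, upst p (pe P) a b = ups (ins1 p) a b;
  upst_e2 : forall p a b, upst p a (pe P) b = ups (ins2 p) a b;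
  upst_e3 : forall p a b, upst p a b (pe P) = ups (ins3 p) a b;
  upst_act : forall p a b c, fmor (gcat_act g) (upst p a b c) =
    beta P (gcat_act g c) (teno P (gcat_act g a) (gcat_act g b)) ∘
    upst p (gcat_act g c) (gcat_act g a) (gcat_act g b)
}.

Section TermGeneral.
Variables (gT : finGroupType) (g : gT) (Sg : signature g).

Fixpoint subst (L K : Type) (s : L -> term Sg K) (t : term Sg L) : term Sg K :=
  match t with
  | Leaf i => s i
  | Unt => Unt
  | Bin d t u => Bin d (subst s t) (subst s u)
  | Tern p t u v => Tern p (subst s t) (subst s u) (subst s v)
  end.

Lemma wd_subst (L K : Type) (s : L -> term Sg K) t h :
  wd (subst s t) h = flatten [seq wd (s i) h | i <- wd t h].
Proof.
elim: t => [i||d t IHt u IHu|p t IHt u IHu v IHv] //=; first by rewrite cats0.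
  by rewrite /bcat IHt IHu; case: ifP; rewrite map_cat flatten_cat.
rewrite /tcat IHt IHu IHv; case: (turn p h) => [|[|r]] /=;
  by rewrite !map_cat !flatten_cat.
Qed.

(** Since no operation of the signature reverses its arguments at 1, the arguments are exchanged by
    hand when d reverses them at g. For the box, [turn_twist] at 1 gives two rotations at g, which
    puts the last argument first. *)
Fixpoint translate (L : Type) (t : term Sg L) : term Sg L :=
  match t with
  | Leaf i => Leaf i
  | Unt => Unt
  | Bin d t u => if swap d g then Bin (twist d) (translate u) (translate t)
                 else Bin (twist d) (translate t) (translate u)
  | Tern p t u v => Tern p (translate v) (translate t) (translate u)
  end.

Lemma wd_translate (L : Type) (t : term Sg L) h : wd (translate t) h = wd t (h * g)%g.
Proof.
elim: t => [i||d t IHt u IHu|p t IHt u IHu v IHv] //=.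
  have := swap_twist d h; rewrite /bcat; case: (swap d g); rewrite /= /bcat IHt IHu => ->;
  by case: (swap d (h * g)%g).
rewrite /tcat IHt IHu IHv turn_twist; have := turn_lt3 p h.
by case: (turn p h) => [|[|[|]]].
Qed.

End TermGeneral.

(** * Comparison isomorphisms and coherent morphisms between terms *)

Section Comparison.
Variables (gT : finGroupType) (g : gT) (Sg : signature g).
Variables (X : gcategory gT) (P : gpermutative X) (Q : comparisons Sg P).
Local Notation "a ⊙ b" := (teno P a b) (at level 35, right associativity).
Local Notation "f ⊗ g" := (tenm P f g) (at level 35, right associativity).
Local Notation beta := (beta P).
Local Notation e := (pe P).
Local Notation ga := (gcat_act g).
Local Notation gm := (fmor (gcat_act g)).

(** By naturality of the comparison, this is the operation d on the two morphisms followed by the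
    comparison at their targets. The chosen form uses the tensor product as the only operation on
    morphisms. *)
Definition cbin d (m m' : Mor X) : Mor X := (m ⊗ m') ∘ ups Q d (src m) (src m').

Definition ctern p (m m' m'' : Mor X) : Mor X :=
  (m ⊗ m' ⊗ m'') ∘ upst Q p (src m) (src m') (src m'').

Lemma src_cbin d m m' : src (cbin d m m') = src (ups Q d (src m) (src m')).
Proof. by rewrite /cbin src_cmp // tgt_ups src_ten. Qed.

Lemma tgt_cbin d m m' : tgt (cbin d m m') = tgt m ⊙ tgt m'.
Proof. by rewrite tgt_cmp tgt_ten. Qed.

Lemma src_ctern p m m' m'' :
  src (ctern p m m' m'') = src (upst Q p (src m) (src m') (src m'')).
Proof. by rewrite /ctern src_cmp // tgt_upst !src_ten. Qed.

Lemma tgt_ctern p m m' m'' : tgt (ctern p m m' m'') = tgt m ⊙ tgt m' ⊙ tgt m''.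
Proof. by rewrite tgt_cmp !tgt_ten. Qed.

Lemma cbin_el d m : cbin d (idm e) m = m.
Proof. by rewrite /cbin src_idm ups_el tenel cmp1r. Qed.

Lemma cbin_er d m : cbin d m (idm e) = m.
Proof. by rewrite /cbin src_idm ups_er tener cmp1r. Qed.

Lemma cbin_assoc d m1 m2 m3 : cbin d m1 (cbin d m2 m3) = cbin d (cbin d m1 m2) m3.
Proof.
have t a b := tgt_ups Q d a b.
rewrite {1}/cbin [RHS]/cbin !src_cbin /cbin.
have -> : m1 ⊗ (m2 ⊗ m3 ∘ ups Q d (src m2) (src m3)) =
    (m1 ⊗ m2 ⊗ m3) ∘ (idm (src m1) ⊗ ups Q d (src m2) (src m3)).
  by rewrite -tenC ?cmp1r // ?tgt_idm // t src_ten.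
have -> : (m1 ⊗ m2 ∘ ups Q d (src m1) (src m2)) ⊗ m3 =
    (m1 ⊗ m2 ⊗ m3) ∘ (ups Q d (src m1) (src m2) ⊗ idm (src m3)).
  by rewrite tenA -tenC ?cmp1r // ?tgt_idm // t src_ten.
rewrite -!cmpA ?ups_assoc // ?src_ten ?tgt_ten ?src_idm ?tgt_idm ?t ?src_ten //.
by rewrite tenoA.
Qed.

Lemma ctern_e1 p m m' : ctern p (idm e) m m' = cbin (ins1 p) m m'.
Proof. by rewrite /ctern /cbin src_idm upst_e1 tenel. Qed.

Lemma ctern_e2 p m m' : ctern p m (idm e) m' = cbin (ins2 p) m m'.
Proof. by rewrite /ctern /cbin src_idm upst_e2 tenel. Qed.

Lemma ctern_e3 p m m' : ctern p m m' (idm e) = cbin (ins3 p) m m'.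
Proof. by rewrite /ctern /cbin src_idm upst_e3 tener. Qed.

Section Labels.
Variable L : eqType.
Implicit Types (t u v : term Sg L) (phi psi : L -> Mor X).

(* For identities [phi i] of objects, [cmpr phi t] is the comparison of the value
   of [t] with the tensor product of its leaves, in the order of [wd t 1]. *)
Definition cmpr phi t : Mor X := ev (idm e) cbin ctern phi t.

Lemma cmpr_words phi t t' : uniq (wd t 1%g) -> wd t =1 wd t' ->
  cmpr phi t = cmpr phi t'.
Proof.
apply: ev_words.
- exact: cbin_el. - exact: cbin_er. - exact: cbin_assoc.
- exact: ctern_e1. - exact: ctern_e2. - exact: ctern_e3.
Qed.

Lemma tgt_cmpr phi t : tgt (cmpr phi t) = wob P (tgt \o phi) (wd t 1%g).
Proof.
elim: t => [i||d t IHt u IHu|p t IHt u IHu v IHv] /=; rewrite ?tenoer ?tgt_idm //.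
  by rewrite bcat1 tgt_cbin IHt IHu wob_cat.
by rewrite tcat1 tgt_ctern IHt IHu IHv !wob_cat.
Qed.

Lemma src_cmpr phi psi t : src \o phi =1 src \o psi ->
  src (cmpr phi t) = src (cmpr psi t).
Proof.
move=> H; elim: t => [i||d t IHt u IHu|p t IHt u IHu v IHv] //=; first exact: H.
  by rewrite !src_cbin IHt IHu.
by rewrite !src_ctern IHt IHu IHv.
Qed.

Lemma cmpr_iso phi t : (forall i, is_iso (phi i)) -> is_iso (cmpr phi t).
Proof.
move=> H; elim: t => [i||d t IHt u IHu|p t IHt u IHu v IHv] //=.
- exact: iso_id.
- apply: iso_cmp; [by rewrite tgt_ups src_ten|exact: ten_iso|exact: ups_iso].
- apply: iso_cmp; [by rewrite tgt_upst !src_ten| |exact: upst_iso].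
  by do 2! [apply: ten_iso => //].
Qed.

(** The comparisons inside [cbin] and [ctern] sit at the sources, which composition with phi leaves
    unchanged, so phi slides out to the left as a tensor product by interchange. *)
Lemma cmpr_cmp phi psi t : (forall i, src (phi i) = tgt (psi i)) ->
  cmpr (fun i => phi i ∘ psi i) t = wmor P phi (wd t 1%g) ∘ cmpr psi t.
Proof.
move=> H; have Hs s : src (wmor P phi (wd s 1%g)) = tgt (cmpr psi s).
  by rewrite src_wmor tgt_cmpr; congr (wob _ _ _); apply/funext.
have Hr s : src (cmpr (fun i => phi i ∘ psi i) s) = src (cmpr psi s).
  by apply: src_cmpr => i /=; rewrite src_cmp.
elim: t => [i||d t IHt u IHu|p t IHt u IHu v IHv].
- by rewrite /= tener.
- by rewrite /= cmp1l ?tgt_idm.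
- rewrite /= /cbin bcat1 wmor_cat -!/(cmpr _ _) !Hr IHt IHu tenC // -cmpA //.
    by rewrite src_ten tgt_ten !Hs.
  by rewrite tgt_ups src_ten.
- rewrite /= /ctern tcat1 !wmor_cat -!/(cmpr _ _) !Hr IHt IHu IHv !tenC //.
    rewrite -cmpA //; first by rewrite !src_ten !tgt_ten !Hs.
    by rewrite tgt_upst !src_ten.
  by rewrite src_ten tgt_ten !Hs.
Qed.

End Labels.

Lemma cmpr_subst (L K : eqType) (phi : K -> Mor X) (s : L -> term Sg K) t :
  cmpr phi (subst s t) = cmpr (fun i => cmpr phi (s i)) t.
Proof.
elim: t => [i||d t IHt u IHu|p t IHt u IHu v IHv] //=.
  by rewrite /cmpr /= -!/(cmpr _ _) IHt IHu.
by rewrite /cmpr /= -!/(cmpr _ _) IHt IHu IHv.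
Qed.

Section Coherent.
Variable L : eqType.
Implicit Types (t u v : term Sg L) (phi psi : L -> Mor X).

(* [m] is the composite of the operation [t] on the morphisms [phi] with the
   canonical isomorphism from [t] to [t'] at their targets. *)
Definition coherent phi t t' m :=
  let y i := idm (tgt (phi i)) in
  [/\ src m = src (cmpr phi t), tgt m = src (cmpr y t') &
   cmpr y t' ∘ m = can P (tgt \o phi) (wd t 1%g) (wd t' 1%g) ∘ cmpr phi t].

Lemma tgt_cmpr_id (x : L -> X) t :
  tgt (cmpr (fun i => idm (x i)) t) = wob P x (wd t 1%g).
Proof. by rewrite tgt_cmpr; congr (wob _ _ _); apply/funext => i; rewrite /= tgt_idm. Qed.

Lemma cmpr_id_iso (x : L -> X) t : is_iso (cmpr (fun i => idm (x i)) t).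
Proof. by apply: cmpr_iso => i; apply: iso_id. Qed.

Lemma coherent_uniq phi t t' m m' : coherent phi t t' m -> coherent phi t t' m' ->
  m = m'.
Proof.
move=> [h1 h2 h3] [h1' h2' h3']; apply: (iso_cancel (cmpr_id_iso (tgt \o phi) t')) => //.
by rewrite /= h3.
Qed.

Lemma coherent_ex phi t t' : perm_eq (wd t 1%g) (wd t' 1%g) ->
  exists m, coherent phi t t' m.
Proof.
move=> pe; pose y i := idm (tgt (phi i)).
have [k [k1 k2 k3 k4]] := (iffLR (isoE _)) (cmpr_id_iso (tgt \o phi) t').
have [h1 h2] := can_ty P (tgt \o phi) pe; rewrite tgt_cmpr_id in k1 k3.
have e1 : src (can P (tgt \o phi) (wd t 1%g) (wd t' 1%g)) = tgt (cmpr phi t).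
  by rewrite h1 tgt_cmpr.
exists (k ∘ (can P (tgt \o phi) (wd t 1%g) (wd t' 1%g) ∘ cmpr phi t)); split.
- by rewrite !src_cmp // tgt_cmp k1 h2.
- by rewrite tgt_cmp k2.
- by rewrite cmpA ?k3 ?cmp1l ?tgt_cmp ?k1 ?h2.
Qed.

(** The only place where [ev_words], through [cmpr_words], enters the notion of coherence: the terms
    may be replaced by any others with the same words. *)
Lemma coherent_words phi t t' u u' m : uniq (wd t 1%g) -> uniq (wd t' 1%g) ->
  wd t =1 wd u -> wd t' =1 wd u' -> coherent phi t t' m -> coherent phi u u' m.
Proof.
move=> ut ut' e1 e2; rewrite /coherent.
by rewrite (cmpr_words _ ut e1) (cmpr_words _ ut' e2) !e1 !e2.
Qed.

Lemma coherent_id (x : L -> X) t : uniq (wd t 1%g) ->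
  coherent (fun i => idm (x i)) t t (idm (src (cmpr (fun i => idm (x i)) t))).
Proof.
move=> un; have e : (fun i => idm (tgt (idm (x i)))) = (fun i => idm (x i)).
  by apply/funext => i; rewrite tgt_idm.
split; rewrite ?e ?src_idm ?tgt_idm // can_id // cmp1r // cmp1l //.
by rewrite tgt_cmpr.
Qed.

(** The morphisms phi slide past the comparison of the middle term by [cmpr_cmp] and past the
    permutation by [can_nat]; the two permutations, now adjacent, compose by [can_trans]. *)
Lemma coherent_cmp phi psi t t' t'' m m' : uniq (wd t 1%g) ->
  perm_eq (wd t 1%g) (wd t' 1%g) -> perm_eq (wd t' 1%g) (wd t'' 1%g) ->
  (forall i, src (phi i) = tgt (psi i)) ->
  coherent phi t' t'' m' -> coherent psi t t' m ->
  coherent (fun i => phi i ∘ psi i) t t'' (m' ∘ m).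
Proof.
move=> un pe pe' H [h1 h2 h3] [k1 k2 k3].
have e : tgt \o (fun i => phi i ∘ psi i) = tgt \o phi.
  by apply/funext => i; rewrite /= tgt_cmp.
have e' : (fun i => idm (tgt (phi i ∘ psi i))) = (fun i => idm (tgt (phi i))).
  by apply/funext => i; rewrite /= tgt_cmp.
have e'' : src \o phi = tgt \o psi by apply/funext.
have mm : src m' = tgt m.
  by rewrite h1 k2; apply: src_cmpr => i /=; rewrite src_idm H.
have [c1 c2] := can_ty P (tgt \o psi) pe.
have [c3 c4] := can_ty P (tgt \o phi) pe'.
have [c5 c6] := can_ty P (tgt \o phi) pe.
split; rewrite ?e ?e' ?tgt_cmp // ?src_cmp //.
  by rewrite k1; apply: src_cmpr => i /=; rewrite src_cmp.
have q1 : src (cmpr phi t') = tgt m.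
  by rewrite k2; apply: src_cmpr => i /=; rewrite src_idm H.
rewrite cmpA // h3 -cmpA //; last by rewrite c3 tgt_cmpr.
have -> : cmpr phi t' = wmor P phi (wd t' 1%g) ∘ cmpr (fun i => idm (tgt (psi i))) t'.
  rewrite -cmpr_cmp; last by move=> i; rewrite tgt_idm.
  by congr (cmpr _ t'); apply/funext => i; rewrite cmp1r.
rewrite -[in X in _ ∘ X]cmpA //; last by rewrite src_wmor tgt_cmpr_id e''.
rewrite k3 [in X in _ ∘ X]cmpA; [|by rewrite src_wmor c2 e''|by rewrite c1 tgt_cmpr].
rewrite -e'' -can_nat // -cmpA ?src_wmor ?tgt_wmor ?tgt_cmpr ?c5 ?e'' //.
rewrite -cmpr_cmp // cmpA //; [|by rewrite c3 c6|].
  by rewrite can_trans.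
by rewrite c5 tgt_cmpr e.
Qed.

End Coherent.

(** Corresponds to operadic composition. [can_nat] exchanges the outer permutation with the inner
    target comparisons f; the inner coherence equations then produce inner permutations. [wmor_can]
    and [can_flatten] turn inner and outer permutations into permutations of the flattened words,
    where [can_trans] composes them. *)
Lemma coherent_subst (L K : eqType) (phi : K -> Mor X) (psi : L -> Mor X)
    (t t' : term Sg L) (s s' : L -> term Sg K) m :
  uniq (wd (subst s t) 1%g) -> perm_eq (wd t 1%g) (wd t' 1%g) ->
  (forall i, perm_eq (wd (s i) 1%g) (wd (s' i) 1%g)) ->
  (forall i, coherent phi (s i) (s' i) (psi i)) ->
  coherent psi t t' m -> coherent phi (subst s t) (subst s' t') m.
Proof.
rewrite wd_subst => un pe pes H [h1 h2 h3].
pose y k := idm (tgt (phi k)); pose z i := idm (tgt (psi i)).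
pose f i := cmpr y (s' i); pose w := wd t 1%g; pose w' := wd t' 1%g.
have hf i : src (f i) = tgt (psi i) by case: (H i).
have tf i : tgt (f i) = wob P (tgt \o phi) (wd (s' i) 1%g).
  by rewrite /f tgt_cmpr; congr (wob _ _ _); apply/funext => k; rewrite /= tgt_idm.
have et : cmpr f t' = wmor P f w' ∘ cmpr z t'.
  rewrite -cmpr_cmp; last by move=> i; rewrite tgt_idm.
  by congr (cmpr _ t'); apply/funext => i; rewrite cmp1r.
have hz : tgt \o psi = src \o f by apply/funext => i /=.
have [c1 c2] := can_ty P (src \o f) pe; have [c3 c4] := can_ty P (tgt \o f) pe.
rewrite /coherent !cmpr_subst -!/(f _) -/(y) -/f; split.
- rewrite h1; apply: src_cmpr => i /=; by case: (H i).
- by rewrite h2; apply: src_cmpr => i /=; rewrite src_idm hf.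
rewrite et -cmpA; [|by rewrite src_wmor tgt_cmpr_id -hz|by rewrite h2].
rewrite h3 hz cmpA; [|by rewrite src_wmor c2|by rewrite c1 tgt_cmpr hz].
rewrite -can_nat // -cmpA; [|by rewrite c3 tgt_wmor|by rewrite src_wmor tgt_cmpr hz].
rewrite -cmpr_cmp //.
have -> : (fun i => f i ∘ psi i) =
    fun i => can P (tgt \o phi) (wd (s i) 1%g) (wd (s' i) 1%g) ∘ cmpr phi (s i).
  by apply/funext => i; case: (H i).
have tc i : src (can P (tgt \o phi) (wd (s i) 1%g) (wd (s' i) 1%g)) = tgt (cmpr phi (s i)).
  by rewrite src_can // tgt_cmpr.
rewrite cmpr_cmp // wmor_can // !wd_subst.
have -> : tgt \o f = fun i => wob P (tgt \o phi) (wd (s' i) 1%g) by apply/funext.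
have pes1 : perm_eq (flatten [seq wd (s i) 1%g | i <- w]) (flatten [seq wd (s' i) 1%g | i <- w]).
  by elim: {un h3 et c1 c2 c3 c4 pe} w => //= i w0 IH; apply: perm_cat.
have pes2 := perm_flatten_map (fun i => wd (s' i) 1%g) pe.
rewrite can_flatten //; last by rewrite -(perm_uniq pes1).
rewrite cmpA ?can_trans //; first by rewrite src_can ?tgt_can.
rewrite src_can // tgt_cmpr -wob_flatten; congr (wob _ _ _); apply/funext => i /=.
by rewrite tgt_cmpr.
Qed.

(** * Compatibility of comparisons and coherent morphisms with the group action *)

Section Action.
Variable L : eqType.
Implicit Types (t u v : term Sg L) (phi psi : L -> Mor X) (w : seq L).

Lemma gact_teno a b : ga (a ⊙ b) = ga a ⊙ ga b.
Proof. exact: pten_act_ob. Qed.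

Lemma gact_tenm f f' : gm (f ⊗ f') = gm f ⊗ gm f'.
Proof. exact: pten_act_mor. Qed.

Lemma gact_wob (x : L -> X) w : ga (wob P x w) = wob P (ga \o x) w.
Proof. by elim: w => [|i w IH] /=; [exact: pe_act|rewrite gact_teno IH]. Qed.

Lemma gact_can (x : L -> X) w w' : perm_eq w w' ->
  gm (can P x w w') = can P (ga \o x) w w'.
Proof.
elim: w w' => [|i w IH] w'.
  by rewrite perm_sym => /perm_nilP -> /=; rewrite fmor_id pe_act.
case/perm_cons_split => r [s [-> ir pe]]; rewrite !can_cons //.
have [h1 h2] := can_ty P x pe.
rewrite fmor_cmp; last by ty.
rewrite !gact_tenm IH // !fmor_id gact_wob /=.
by rewrite [gm (beta _ _)](pbeta_act P) gact_wob.
Qed.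

(** The translated term has at 1 the word that t has at g, so the two comparisons end in differently
    ordered tensor products. The symmetries produced by [ups_act] and [upst_act] accumulate to
    exactly the canonical isomorphism that corrects this. *)
Lemma gact_cmpr phi t : uniq (wd t 1%g) -> gm (cmpr phi t) =
  can P (tgt \o (gm \o phi)) (wd (translate t) 1%g) (wd t 1%g) ∘ cmpr (gm \o phi) (translate t).
Proof.
pose x := tgt \o (gm \o phi).
have pg u : perm_eq (wd (translate u) 1%g) (wd u 1%g).
  by rewrite wd_translate mul1g; apply: stable_wd.
have tg u : tgt (cmpr (gm \o phi) (translate u)) = wob P x (wd (translate u) 1%g).
  by rewrite tgt_cmpr.
have sg u : src (can P x (wd (translate u) 1%g) (wd u 1%g)) = tgt (cmpr (gm \o phi) (translate u)).
  by rewrite src_can ?tgt_cmpr.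
have ssg u : gm (cmpr phi u) = can P x (wd (translate u) 1%g) (wd u 1%g) ∘
    cmpr (gm \o phi) (translate u) ->
    ga (src (cmpr phi u)) = src (cmpr (gm \o phi) (translate u)).
  by move=> /(congr1 src); rewrite src_fmor src_cmp.
have ttg u : ga (tgt (cmpr phi u)) = wob P x (wd u 1%g).
  by rewrite tgt_cmpr gact_wob; congr (wob _ _ _); apply/funext => i; rewrite /x /= tgt_fmor.
elim: t => [i _|_|d t IHt u IHu|p t IHt u IHu v IHv].
- by rewrite can_id //= tenoer cmp1l.
- by rewrite /= cmp1l ?tgt_idm // fmor_id pe_act.
- rewrite [wd (Bin d t u) _]/= bcat1 => un.
  have := un; rewrite cat_uniq => /and3P [/IHt {}IHt _ /IHu {}IHu].
  rewrite [cmpr phi _]/= /cbin -!/(cmpr _ _) fmor_cmp; last by rewrite src_ten tgt_ups.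
  rewrite gact_tenm ups_act !ssg //.
  have unc : uniq (wd u 1%g ++ wd t 1%g) by rewrite uniq_catC.
  have ung : uniq (wd (translate u) 1%g ++ wd (translate t) 1%g).
    by rewrite (perm_uniq (perm_cat (pg u) (pg t))).
  have ung' : uniq (wd (translate t) 1%g ++ wd (translate u) 1%g) by rewrite uniq_catC.
  rewrite [translate (Bin _ _ _)]/=; case: ifP => _;
    rewrite [wd (Bin _ _ _) _]/= bcat1 [cmpr (gm \o phi) _]/=
    /cbin -!/(cmpr _ _); last first.
    rewrite IHt IHu tenC // can_cat // -cmpA ?src_ten ?tgt_ups //.
    by rewrite src_can ?perm_cat // tgt_ten !tg wob_cat.
  rewrite cmpA; [| |by rewrite src_beta tgt_ups]; last first.
    by rewrite src_ten tgt_beta !src_fmor !ssg.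
  have := beta_nat P (gm (cmpr phi u)) (gm (cmpr phi t)).
  rewrite !src_fmor !tgt_fmor !ttg !ssg // => ->.
  rewrite IHt IHu tenC // can_cat // -can_beta // cmpA; last first.
  - by rewrite src_can ?perm_cat // tgt_ten !tg wob_cat.
  - by rewrite src_can ?tgt_can //; [exact: perm_cat|rewrite perm_catC].
  rewrite can_trans //; [|exact: perm_cat|by rewrite perm_catC].
  rewrite -cmpA // ?src_ten ?tgt_ups // src_can; last first.
    by apply: perm_trans (perm_cat (pg u) (pg t)) _; rewrite perm_catC.
  by rewrite tgt_ten !tg wob_cat.
rewrite [wd (Tern p t u v) _]/= tcat1 => un.
have := un; rewrite !cat_uniq => /and3P [/IHt {}IHt _ /and3P [/IHu {}IHu _ /IHv {}IHv]].
rewrite [cmpr phi _]/= /ctern -!/(cmpr _ _) fmor_cmp; last by rewrite !src_ten tgt_upst.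
rewrite !gact_tenm upst_act !ssg //.
have unc : uniq (wd v 1%g ++ wd t 1%g ++ wd u 1%g) by rewrite uniq_catC -catA.
have pgu := perm_cat (pg v) (perm_cat (pg t) (pg u)).
have ung : uniq (wd (translate v) 1%g ++ wd (translate t) 1%g ++ wd (translate u) 1%g).
  by rewrite (perm_uniq pgu).
have unc' : uniq (wd (translate t) 1%g ++ wd (translate u) 1%g).
  by move: ung; rewrite cat_uniq => /and3P [].
rewrite [translate (Tern _ _ _ _)]/= [wd (Tern _ _ _ _) _]/= tcat1.
rewrite [cmpr (gm \o phi) _]/= /ctern -!/(cmpr _ _).
rewrite cmpA; [| |by rewrite src_beta tgt_upst]; last first.
  by rewrite !src_ten tgt_beta !src_fmor !ssg // tenoA.
have := beta_nat P (gm (cmpr phi v)) (gm (cmpr phi t) ⊗ gm (cmpr phi u)).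
rewrite src_ten tgt_ten !src_fmor !tgt_fmor !ttg !ssg // -tenA => ->.
rewrite IHt IHu IHv !tenC //; last first.
  by rewrite src_ten tgt_ten !sg.
rewrite (can_cat _ _ unc') // can_cat // ?perm_cat // -wob_cat -can_beta //.
rewrite cmpA; last first.
- by rewrite src_can // !tgt_ten !tg !wob_cat.
- by rewrite src_can ?tgt_can // perm_catC.
rewrite -catA can_trans //; last by rewrite perm_catC -catA.
rewrite -cmpA // ?src_ten ?tgt_upst ?src_ten // src_can; last first.
  by apply: perm_trans pgu _; rewrite perm_catC -catA.
by rewrite !tgt_ten !tg !wob_cat.
Qed.

(** The corrections of [gact_cmpr] at source and target are absorbed by [can_trans], after composing
    the desired equation with the invertible correction of the target. *)
Lemma coherent_act phi t t' m : uniq (wd t 1%g) -> perm_eq (wd t 1%g) (wd t' 1%g) ->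
  coherent phi t t' m -> coherent (gm \o phi) (translate t) (translate t') (gm m).
Proof.
move=> un pe [h1 h2 h3]; have un' : uniq (wd t' 1%g) by rewrite -(perm_uniq pe).
have pg u : perm_eq (wd (translate u) 1%g) (wd u 1%g).
  by rewrite wd_translate mul1g; apply: stable_wd.
have sg psi u : uniq (wd u 1%g) -> ga (src (cmpr psi u)) = src (cmpr (gm \o psi) (translate u)).
  by move=> uu; rewrite -src_fmor gact_cmpr // src_cmp // src_can // tgt_cmpr.
pose y i := idm (tgt (phi i)).
have ey : gm \o y = fun i => idm (tgt (gm (phi i))).
  by apply/funext => i; rewrite /= fmor_id tgt_fmor.
have ey' : tgt \o (gm \o y) = tgt \o (gm \o phi).
  by apply/funext => i; rewrite /= !tgt_fmor tgt_idm.
have ey'' : ga \o (tgt \o phi) = tgt \o (gm \o phi).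
  by apply/funext => i; rewrite /= !tgt_fmor.
have pge : perm_eq (wd (translate t) 1%g) (wd t' 1%g) := perm_trans (pg t) pe.
have pge' : perm_eq (wd (translate t) 1%g) (wd (translate t') 1%g).
  by apply: perm_trans pge _; rewrite perm_sym.
have ung : uniq (wd (translate t) 1%g) by rewrite (perm_uniq (pg t)).
have ung' : uniq (wd (translate t') 1%g) by rewrite (perm_uniq (pg t')).
have H1 : src (gm m) = src (cmpr (gm \o phi) (translate t)) by rewrite src_fmor h1 sg.
have H2 : tgt (gm m) = src (cmpr (gm \o y) (translate t')) by rewrite tgt_fmor h2 sg.
rewrite /coherent -ey; split=> //.
have e1 : tgt (cmpr (gm \o y) (translate t')) =
  src (can P (tgt \o (gm \o phi)) (wd (translate t') 1%g) (wd t' 1%g)).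
  by rewrite src_can // tgt_cmpr ey'.
apply: (iso_cancel (can_iso P (tgt \o (gm \o phi)) ung' (pg t'))).
- by rewrite tgt_cmp e1.
- by rewrite tgt_cmp src_can // tgt_can.
rewrite !cmpA ?can_trans //; last first.
- by rewrite src_can // tgt_cmpr.
- by rewrite src_can // tgt_can.
rewrite -ey' -gact_cmpr // -fmor_cmp // h3 fmor_cmp; last by rewrite src_can ?tgt_cmpr.
rewrite gact_can // ey'' ey' gact_cmpr // cmpA ?can_trans //.
- by rewrite src_can // tgt_can.
- by rewrite src_can // tgt_cmpr.
Qed.

End Action.

End Comparison.

(** * The words of the operations of [Q_G] *)

Section PermWords.
Variable n : nat.
Implicit Types s t : 'S_n.

(* The inputs of the operation [s], in the order in which [s] multiplies them. *)
Definition word s : seq 'I_n := [seq (s^-1)%g i | i <- enum 'I_n].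

Lemma word_uniq s : uniq (word s).
Proof. by rewrite map_inj_uniq ?enum_uniq //; apply: perm_inj. Qed.

Lemma mem_word s i : i \in word s.
Proof. by apply/mapP; exists (s i); rewrite ?mem_enum ?permK. Qed.

Lemma size_word s : size (word s) = n.
Proof. by rewrite size_map size_enum_ord. Qed.

Lemma word_inj : injective word.
Proof.
move=> s t /eq_in_map e; apply: invg_inj; apply/permP => i.
by apply: e; rewrite mem_enum.
Qed.

Lemma perm_word s t : perm_eq (word s) (word t).
Proof. by apply: uniq_perm; rewrite ?word_uniq // => i; rewrite !mem_word. Qed.

Lemma word1 : word 1 = enum 'I_n.
Proof. by rewrite /word invg1 -[RHS]map_id; apply: eq_map => i; rewrite perm1. Qed.

Lemma word_permc s t : word (permc s t) = map (t^-1)%g (word s).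
Proof.
rewrite /word /permc invMg -[RHS]map_comp; apply: eq_map => i /=.
by rewrite permM.
Qed.

Lemma word_pairwise s : pairwise (fun i j => s i < s j) (word s).
Proof.
rewrite pairwise_map.
apply: (@sub_in_pairwise _ predT (relpre val ltn)); rewrite ?all_predT //.
  by move=> i j _ _ /=; rewrite !permKV.
rewrite -pairwise_map val_enum_ord -sorted_pairwise ?iota_ltn_sorted //.
exact: ltn_trans.
Qed.

(** A list sorted for a transitive irreflexive relation is determined by its elements. This
    identifies the word of a permutation from its values, without computing the inverse. *)
Lemma word_unique s (w : seq 'I_n) : (forall i, i \in w) ->
  pairwise (fun i j => s i < s j) w -> w = word s.
Proof.
have tr : transitive (fun i j => s i < s j) by move=> j i k; apply: ltn_trans.
move=> mw pw; apply: (irr_sorted_eq tr).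
- by move=> i; rewrite ltnn.
- by rewrite sorted_pairwise.
- by rewrite sorted_pairwise // word_pairwise.
- by move=> i; rewrite mw mem_word.
Qed.

End PermWords.

(** The concatenation lists the inputs by increasing value of [block_comp s t]: across blocks by
    [block_val_mono], inside a block because all values carry the same offset. Then [word_unique]
    applies. *)
Lemma word_block n (k : 'I_n -> nat) (s : 'S_n) (t : forall j, 'S_(k j)) :
  word (block_comp s t) =
  flatten [seq map (@tagnat.Rank n k j) (word (t j)) | j <- word s].
Proof.
have vo j (i : 'I_(k j)) : oplus t (tagnat.Rank j i) = tagnat.Rank j (t j i).
  have fK : tagnat.sig (tagnat.Rank j i) = Tagged (fun j => 'I_(k j)) i.
    exact: tagnat.rankK.
  by rewrite permE /oplus_fun /tagnat.sig1 /tagnat.sig2 fK.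
have vb j (i : 'I_(k j)) : block_val s (tagnat.Rank j i) =
    i + \sum_(l < n | s l < s j) k l.
  by rewrite /block_val tagnat.Rank2K /= tagnat.Rank1K.
have bE j (i : 'I_(k j)) : val (block_comp s t (tagnat.Rank j i)) =
    t j i + \sum_(l < n | s l < s j) k l.
  by rewrite /block_comp /permc permM vo permE /= vb.
symmetry; apply: word_unique => [x|].
  apply/flattenP; exists (map (@tagnat.Rank n k (tagnat.sig1 x)) (word (t (tagnat.sig1 x)))).
    by apply/mapP; exists (tagnat.sig1 x); rewrite ?mem_word.
  by apply/mapP; exists (tagnat.sig2 x); rewrite ?mem_word ?tagnat.sig2K.
elim: (word s) (word_pairwise s) => [//|j w IH] /=; rewrite pairwise_cat.
case/andP => /allP jw /IH ->; rewrite andbT; apply/andP; split.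
  apply/allrelP => x y /mapP [i _ ->] /flattenP [u /mapP [j' j'w ->] /mapP [i' _ ->]].
  have lt : block_val s (tagnat.Rank j (t j i)) < block_val s (tagnat.Rank j' (t j' i')).
    by apply: block_val_mono; rewrite !tagnat.Rank1K; apply: jw.
  by move: lt; rewrite !vb -!bE.
rewrite pairwise_map.
apply: (@sub_in_pairwise _ predT (fun i i' => t j i < t j i')); rewrite ?all_predT //.
  by move=> i i' _ _ /=; rewrite !bE ltn_add2r.
exact: word_pairwise.
Qed.

(** * Every operation of Q_G has the words of a term *)

Section QTerms.
Variables (gT : finGroupType) (g : gT) (g_gen : <[g]>%g = [set: gT]).
Variable Sg : signature g.

Definition represents n (t : term Sg 'I_n) (f : PG gT n) :=
  forall h, wd t h = word (f h).

(** [translate] realizes the action of g alone; as g generates the group, iterating it reaches every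
    element. *)
Lemma represents_act n (f : PG gT n) h : (exists t, represents t f) ->
  exists t, represents t (P_act h f).
Proof.
have /cycleP [k ->] : h \in <[g]>%g by rewrite g_gen inE.
elim: k f => [|k IH] f [t tf].
  by exists t => h'; rewrite ffunE expg0 mulg1.
have [t' tf'] : exists t, represents t (P_act g f).
  by exists (translate t) => h'; rewrite wd_translate tf ffunE.
have [|t'' tf''] := IH (P_act g f); first by exists t'.
by exists t'' => h'; rewrite tf'' !ffunE expgSr mulgA.
Qed.

Lemma inQ_represents m (box : PG gT m) : (exists t, represents t box) ->
  forall n (f : PG gT n), inQ box f -> exists t, represents t f.
Proof.
move=> Hbox n f; elim=> {n f} //.
- by exists Unt => h; rewrite ffunE word1 /= enum_ord0.
- exists (Bin (ten Sg) (Leaf ord0) (Leaf ord_max)) => h.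
  rewrite ffunE word1 /= /bcat swap_ten !enum_ordSl enum_ord0 /=.
  by congr [:: _; _]; apply: val_inj.
- exists (Leaf ord0) => h; by rewrite ffunE word1 enum_ordSl enum_ord0.
- by move=> n h f _; apply: represents_act.
- move=> n s f _ [t tf]; exists (subst (fun i => Leaf ((s^-1)%g i)) t) => h.
  rewrite wd_subst tf ffunE word_permc.
  by elim: (word (f h)) => //= i w ->.
- move=> n k f fs _ [t tf] _ H.
  pose ts j := projT1 (cid (H j)); have tfs j : represents (ts j) (fs j) := projT2 (cid (H j)).
  exists (subst (fun j => subst (fun i => Leaf (tagnat.Rank j i)) (ts j)) t) => h.
  rewrite wd_subst tf ffunE word_block; congr flatten; apply: eq_map => j.
  rewrite wd_subst tfs; by elim: (word (fs j h)) => //= i w ->.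
Qed.

End QTerms.

(** * From biased structures to algebras *)

Section Realization.
Variables (gT : finGroupType) (g : gT) (g_gen : <[g]>%g = [set: gT]).
Variables (Sg : signature g) (m : nat) (box : PG gT m).
Hypothesis box_term : exists t : term Sg 'I_m, represents t box.
Variables (X : gcategory gT) (P : gpermutative X) (Q : comparisons Sg P).

(** Membership in Q_G is an inductive proposition, so a term is chosen instead of computed from it;
    [realize_uniq] makes the choice immaterial. *)
Definition term_of n (f : QG box n) : term Sg 'I_n :=
  projT1 (cid (inQ_represents g_gen box_term (proj2_sig f))).

Lemma term_ofP n (f : QG box n) : represents (term_of f) (proj1_sig f).
Proof. exact: projT2 (cid (inQ_represents g_gen box_term (proj2_sig f))). Qed.

Lemma represents_uniq n (t : term Sg 'I_n) f : represents t f -> uniq (wd t 1%g).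
Proof. by move=> ->; apply: word_uniq. Qed.

Lemma represents_perm n (t t' : term Sg 'I_n) f f' :
  represents t f -> represents t' f' -> perm_eq (wd t 1%g) (wd t' 1%g).
Proof. by move=> -> ->; apply: perm_word. Qed.

Lemma realize_ex n (f f' : QG box n) (phi : 'I_n -> Mor X) :
  exists k, coherent Q phi (term_of f) (term_of f') k.
Proof. by apply: coherent_ex; apply: represents_perm; apply: term_ofP. Qed.

Definition realize n (f f' : QG box n) (phi : 'I_n -> Mor X) : Mor X :=
  projT1 (cid (realize_ex f f' phi)).

Lemma realizeP n (f f' : QG box n) phi :
  coherent Q phi (term_of f) (term_of f') (realize f f' phi).
Proof. exact: projT2 (cid (realize_ex f f' phi)). Qed.

(** The device behind all laws of the realized algebra: any terms with the right words may stand in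
    for the chosen ones, so each law amounts to exhibiting terms adapted to it and a coherent
    morphism between them. *)
Lemma realize_uniq n (f f' : QG box n) phi t t' k : represents t (proj1_sig f) ->
  represents t' (proj1_sig f') -> coherent Q phi t t' k -> k = realize f f' phi.
Proof.
move=> tf tf' H; apply: coherent_uniq (realizeP f f' phi).
apply: coherent_words H.
- exact: represents_uniq tf.
- exact: represents_uniq tf'.
- by move=> h; rewrite tf term_ofP.
- by move=> h; rewrite tf' term_ofP.
Qed.

Definition realize_ob n (f : QG box n) (x : 'I_n -> X) : X :=
  src (cmpr Q (fun i => idm (x i)) (term_of f)).

Lemma src_realize n (f f' : QG box n) phi :
  src (realize f f' phi) = realize_ob f (src \o phi).
Proof.
have [-> _ _] := realizeP f f' phi.
by apply: src_cmpr => i; rewrite /= src_idm.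
Qed.

Lemma tgt_realize n (f f' : QG box n) phi :
  tgt (realize f f' phi) = realize_ob f' (tgt \o phi).
Proof. by have [_ -> _] := realizeP f f' phi. Qed.

Lemma realize_id n (f : QG box n) (x : 'I_n -> X) :
  realize f f (fun i => idm (x i)) = idm (realize_ob f x).
Proof.
apply/esym/(realize_uniq (term_ofP f) (term_ofP f))/coherent_id.
exact: represents_uniq (term_ofP f).
Qed.

Lemma realize_cmp n (f f' f'' : QG box n) phi psi :
  (forall i, src (phi i) = tgt (psi i)) ->
  realize f f'' (fun i => phi i ∘ psi i) = realize f' f'' phi ∘ realize f f' psi.
Proof.
move=> H; apply/esym/(realize_uniq (term_ofP f) (term_ofP f'')).
apply: coherent_cmp H (realizeP _ _ _) (realizeP _ _ _);
  by [exact: represents_uniq (term_ofP f)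
     | apply: represents_perm; apply: term_ofP].
Qed.

Definition realize_functor n :
  functor (prod_category (tQ box n) (power X n)) X.
Proof.
refine (@Functor (prod_category (tQ box n) (power X n)) X
  (fun fx => realize_ob fx.1 fx.2) (fun F => realize F.1.1 F.1.2 F.2) _ _ _ _).
- by move=> F; apply: src_realize.
- by move=> F; apply: tgt_realize.
- by move=> [f x]; apply: realize_id.
- move=> [[f1 f2] phi] [[k1 k2] psi] H H'.
  case: (H) => /= e1 e2; have e i : src (phi i) = tgt (psi i) := congr1 (fun u => u i) e2.
  rewrite -cmpE; transitivity (realize k1 f2 (fun i => phi i ∘ psi i)).
    by congr (realize _ _ _); apply/funext => i; rewrite /= -cmpE.
  by rewrite e1; apply: realize_cmp.
Defined.

Lemma Q_act1 n (f : QG box n) : Q_act 1%g f = f.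
Proof. exact: (@act1_ob _ (tQ box n) f). Qed.

Lemma Q_actM n h k (f : QG box n) : Q_act (h * k)%g f = Q_act h (Q_act k f).
Proof. exact: (@actM_ob _ (tQ box n) h k f). Qed.

Lemma realize_act n h (f f' : QG box n) (phi : 'I_n -> Mor X) :
  fmor (gcat_act h) (realize f f' phi) =
  realize (Q_act h f) (Q_act h f') (fun i => fmor (gcat_act h) (phi i)).
Proof.
have /cycleP [k ->] : h \in <[g]>%g by rewrite g_gen inE.
elim: k => [|k IH].
  rewrite expg0 act1_mor !Q_act1; congr realize; apply/funext => i.
  by rewrite act1_mor.
have act_term (f0 : QG box n) :
    represents (translate (term_of f0)) (proj1_sig (Q_act g f0)).
  by move=> h'; rewrite wd_translate term_ofP /= ffunE.
rewrite expgS actM_mor IH !Q_actM; apply: (realize_uniq (act_term _) (act_term _)).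
have -> : (fun i => fmor (gcat_act (g * g ^+ k)%g) (phi i)) =
    fmor (gcat_act g) \o (fun i => fmor (gcat_act (g ^+ k)%g) (phi i)).
  by apply/funext => i; rewrite /= actM_mor.
apply: coherent_act (realizeP _ _ _); first exact: represents_uniq (term_ofP _).
exact: represents_perm (term_ofP _) (term_ofP _).
Qed.

Lemma coherent_leaf (L : eqType) (phi : L -> Mor X) i :
  coherent Q phi (Leaf i) (Leaf i) (phi i).
Proof. by split; rewrite ?can_id //= ?src_idm // !cmp1l ?tenoer. Qed.

Lemma coherent_rename (L K : eqType) (phi : K -> Mor X) (v : L -> K) t t' k :
  uniq (wd (subst (fun i => Leaf (v i)) t) 1%g) ->
  perm_eq (wd t 1%g) (wd t' 1%g) -> coherent Q (phi \o v) t t' k ->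
  coherent Q phi (subst (fun i => Leaf (v i)) t) (subst (fun i => Leaf (v i)) t') k.
Proof.
move=> un pe; apply: coherent_subst => // i; exact: coherent_leaf.
Qed.

Lemma wd_rename (L K : Type) (v : L -> K) (t : term Sg L) h :
  wd (subst (fun i => Leaf (v i)) t) h = map v (wd t h).
Proof. by rewrite wd_subst; elim: (wd t h) => //= i w ->. Qed.

Lemma realize_perm n (s : 'S_n) (f f' : QG box n) (phi : 'I_n -> Mor X) :
  realize (Q_perm s f) (Q_perm s f') phi =
  realize f f' (fun i => phi ((s^-1)%g i)).
Proof.
have tP (f0 : QG box n) : represents (subst (fun i => Leaf ((s^-1)%g i)) (term_of f0))
    (proj1_sig (Q_perm s f0)).
  by move=> h; rewrite wd_rename term_ofP /= ffunE word_permc.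
apply/esym/(realize_uniq (tP f) (tP f')); apply: coherent_rename.
- exact: represents_uniq (tP f).
- exact: represents_perm (term_ofP _) (term_ofP _).
- exact: realizeP.
Qed.

Lemma realize_gamma n (k : 'I_n -> nat) (f f' : QG box n)
    (fs fs' : forall j, QG box (k j)) (phi : 'I_(\sum_j k j) -> Mor X) :
  realize (Q_gamma f fs) (Q_gamma f' fs') phi =
  realize f f' (fun j => realize (fs j) (fs' j) (fun i => phi (tagnat.Rank j i))).
Proof.
pose ts (fs0 : forall j, QG box (k j)) j :=
  subst (fun i => Leaf (tagnat.Rank j i)) (term_of (fs0 j)).
have tsP fs0 j h : wd (ts fs0 j) h =
    map (tagnat.Rank j) (word (proj1_sig (fs0 j) h)).
  by rewrite wd_rename term_ofP.
have tP f0 fs0 : represents (subst (ts fs0) (term_of f0)) (proj1_sig (Q_gamma f0 fs0)).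
  move=> h; rewrite wd_subst term_ofP /= ffunE word_block; congr flatten.
  exact: eq_map.
have uq fs0 j : uniq (wd (ts fs0 j) 1%g).
  rewrite tsP map_inj_uniq ?word_uniq // => i i' /(congr1 val) /eqP.
  by rewrite /= tagnat.eq_Rank eqxx => /eqP /val_inj.
apply/esym/(realize_uniq (tP f fs) (tP f' fs')); apply: coherent_subst (realizeP _ _ _).
- exact: represents_uniq (tP f fs).
- exact: represents_perm (term_ofP _) (term_ofP _).
- by move=> j; rewrite !tsP perm_map // perm_word.
move=> j; apply: coherent_rename (realizeP _ _ _) => //; first exact: uq.
exact: represents_perm (term_ofP _) (term_ofP _).
Qed.

Lemma realize_unit (phi : 'I_1 -> Mor X) :
  realize (Q_unit box) (Q_unit box) phi = phi ord0.
Proof.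
have tP : represents (Leaf ord0 : term Sg _) (proj1_sig (Q_unit box)).
  by move=> h; rewrite [sval _]/(P_one gT 1) ffunE word1 enum_ordSl enum_ord0.
exact/esym/(realize_uniq tP tP)/coherent_leaf.
Qed.

(** Reduces each law on objects to the law on morphisms, read off at identities. *)
Lemma realize_ob_src n (f : QG box n) x :
  realize_ob f x = src (realize f f (fun i => idm (x i))).
Proof. by rewrite realize_id src_idm. Qed.

Definition realization : algebra (tQ_operad box) X.
Proof.
refine (@Algebra gT (tQ_operad box) X realize_functor _ _ _ _ _ _ _ _).
- move=> n h f x /=; rewrite !realize_ob_src -src_fmor realize_act.
  by congr (src (realize _ _ _)); apply/funext => i; rewrite fmor_id.
- by move=> n h [f f'] x; apply: realize_act.
- by move=> n s f x /=; rewrite !realize_ob_src realize_perm.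
- by move=> n s [f f'] x; apply: realize_perm.
- move=> n k f fs x /=; rewrite !realize_ob_src realize_gamma.
  by congr (src (realize _ _ _)); apply/funext => j; rewrite realize_id.
- by move=> n k [f f'] fs x /=; rewrite realize_gamma.
- by move=> x /=; rewrite realize_ob_src realize_unit src_idm.
- by move=> x; apply: realize_unit.
Defined.

End Realization.

(** * From algebras to biased structures *)

Section AlgebraWords.
Variables (gT : finGroupType) (m : nat) (box : PG gT m) (X : gcategory gT).
Variable A : algebra (tQ_operad box) X.
Local Notation Q n := (QG box n).

Lemma src_mu n (f f' : Q n) (phi : 'I_n -> Mor X) :
  src (mu_mor A (f, f') phi) = mu_ob A f (src \o phi).
Proof. exact: src_fmor. Qed.

Lemma tgt_mu n (f f' : Q n) (phi : 'I_n -> Mor X) :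
  tgt (mu_mor A (f, f') phi) = mu_ob A f' (tgt \o phi).
Proof. exact: tgt_fmor. Qed.

Lemma mu_id n (f : Q n) (x : 'I_n -> X) :
  mu_mor A (f, f) (fun i => idm (x i)) = idm (mu_ob A f x).
Proof. exact: (fmor_id (mu A n) (f, x)). Qed.

Lemma mu_cmp n (f f' f'' : Q n) (phi psi : 'I_n -> Mor X) :
  (forall i, src (phi i) = tgt (psi i)) ->
  mu_mor A (f, f'') (fun i => phi i ∘ psi i) =
  mu_mor A (f', f'') phi ∘ mu_mor A (f, f') psi.
Proof.
move=> H; have Hs : @src (power X n) phi = @tgt (power X n) psi by apply/funext.
pose D := prod_category (tQ box n) (power X n).
have H2 : @src D (f', f'', phi) = @tgt D (f, f', psi) by congr pair.
rewrite /mu_mor -(fmor_cmp _ H2) (cmpE H2); congr fmor; congr pair.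
by apply/funext => i /=; rewrite -cmpE.
Qed.

Variable L : eqType.
Implicit Types (phi psi : L -> Mor X) (W : words gT L).

(* [k] is the value of a morphism of the operad at the morphisms [phi], the
   source and target operations being given by the words [W] and [W']. *)
Definition evaluated phi W W' (k : Mor X) := exists n (l : 'I_n -> L) (f f' : Q n),
  [/\ forall h, W h = map l (word (sval f h)), forall h, W' h = map l (word (sval f' h))
    & k = mu_mor A (f, f') (phi \o l)].

Lemma uniq_map_word n (s : 'S_n) (l : 'I_n -> L) : uniq (map l (word s)) -> injective l.
Proof.
move=> un; apply/injectiveP; rewrite /injectiveb /dinjectiveb -(word1 n).
by rewrite (perm_uniq (perm_map l (perm_word 1 s))).
Qed.

Lemma Q_word_inj n (l : 'I_n -> L) (f f' : Q n) : injective l ->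
  (forall h, map l (word (sval f h)) = map l (word (sval f' h))) -> f = f'.
Proof.
move=> il e; apply: Q_inj; apply/ffunP => h; apply: word_inj.
by apply: (inj_map il); apply: e.
Qed.

Lemma map_word_eq n (s s' : 'S_n) (l l' : 'I_n -> L) :
  map l (word s) = map l' (word s') -> forall i, l ((s^-1)%g i) = l' ((s'^-1)%g i).
Proof.
rewrite /word -[LHS]map_comp -[RHS]map_comp => /eq_in_map e i.
by apply: e; rewrite mem_enum.
Qed.

(** An operation known through labelled words is known only up to renumbering its inputs. Here the
    numbering is adjusted to a prescribed target operation, equivariance of the algebra absorbing
    the renumbering; this makes two evaluated morphisms comparable or composable. *)
Lemma evaluated_rebase phi W W' k n (l : 'I_n -> L) (f' : Q n) :
  uniq (W' 1%g) -> (forall h, W' h = map l (word (sval f' h))) ->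
  evaluated phi W W' k ->
  exists2 f : Q n, forall h, W h = map l (word (sval f h)) &
                   k = mu_mor A (f, f') (phi \o l).
Proof.
move=> un e [n1 [l1 [f1 [f1' [e1 e1' ->]]]]].
have en : n1 = n.
  by rewrite -(size_word (sval f1' 1%g)) -(size_map l1) -e1' e size_map size_word.
subst n1; have il : injective l by apply: (@uniq_map_word _ (sval f' 1%g)); rewrite -e.
(* With MathComp's order of composition: the position of an input in the word of f' at 1, followed
   by the input of f1' at that position, which bears the same label. *)
pose s := (sval f' 1 * (sval f1' 1)^-1)%g.
have ls i : l i = l1 (s i).
  have := map_word_eq (etrans (esym (e 1%g)) (e1' 1%g)) (sval f' 1%g i).
  by rewrite permK permM.
have lsV i : l ((s^-1)%g i) = l1 i by rewrite ls permKV.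
have es (f0 : Q n) h : map l (word (sval (Q_perm s f0) h)) = map l1 (word (sval f0 h)).
  by rewrite /= ffunE word_permc -map_comp; apply: eq_map => i /=.
exists (Q_perm s f1) => [h|]; first by rewrite es.
have -> : f' = Q_perm s f1' by apply: (Q_word_inj il) => h; rewrite es -e -e1'.
have := mu_perm_mor A s ((f1, f1') : Mor (tQ box n)) (phi \o l); rewrite /mu_mor /= => ->.
by congr fmor; congr pair; apply/funext => i /=; rewrite lsV.
Qed.

Lemma evaluated_perm phi W W' k : evaluated phi W W' k -> perm_eq (W 1%g) (W' 1%g).
Proof. by case=> n [l [f [f' [-> -> _]]]]; rewrite perm_map // perm_word. Qed.

(** After renumbering, both morphisms have the same target operation. The injective labelling makes
    the words determine the source operations too, and the operad has one morphism between any two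
    operations. *)
Lemma evaluated_uniq phi W W' k k' : uniq (W 1%g) ->
  evaluated phi W W' k -> evaluated phi W W' k' -> k = k'.
Proof.
move=> un E; have un' : uniq (W' 1%g) by rewrite -(perm_uniq (evaluated_perm E)).
move: (E) => [n [l [f [f' [e e' ->]]]]] /(evaluated_rebase un' e') [f1 e1 ->].
have il : injective l by apply: (@uniq_map_word _ (sval f 1%g)); rewrite -e.
by rewrite (Q_word_inj il (fun h => etrans (esym (e h)) (e1 h))).
Qed.

Lemma evaluated_leaf phi i : evaluated phi (fun=> [:: i]) (fun=> [:: i]) (phi i).
Proof.
exists 1, (fun=> i), (Q_unit box), (Q_unit box).
have e h : [:: i] = map (fun=> i) (word (sval (Q_unit box) h)).
  by rewrite [sval _]/(P_one gT 1) ffunE word1 enum_ordSl enum_ord0.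
by split=> //; exact: (esym (mu_unit_mor A (fun=> phi i))).
Qed.

(** Compatibility of the algebra with gamma: the labellings of the inner operations are glued along
    the consecutive blocks of inputs. *)
Lemma evaluated_op phi n (f f' : Q n) (W W' : 'I_n -> words gT L) (k : 'I_n -> Mor X) :
  (forall j, evaluated phi (W j) (W' j) (k j)) ->
  evaluated phi (fun h => flatten [seq W j h | j <- word (sval f h)])
    (fun h => flatten [seq W' j h | j <- word (sval f' h)]) (mu_mor A (f, f') k).
Proof.
move=> H.
have /choice [r Hr] j : exists r : {n : nat & (('I_n -> L) * Q n * Q n)%type},
    [/\ forall h, W j h = map (tagged r).1.1 (word (sval (tagged r).1.2 h)),
        forall h, W' j h = map (tagged r).1.1 (word (sval (tagged r).2 h))
      & k j = mu_mor A ((tagged r).1.2, (tagged r).2) (phi \o (tagged r).1.1)].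
  by have [n' [l [u [u' E]]]] := H j; exists (existT _ n' (l, u, u')).
pose n_ j := tag (r j); pose l_ j : 'I_(n_ j) -> L := (tagged (r j)).1.1.
pose f_ j : Q (n_ j) := (tagged (r j)).1.2; pose f'_ j : Q (n_ j) := (tagged (r j)).2.
have {}Hr j : [/\ forall h, W j h = map (l_ j) (word (sval (f_ j) h)),
    forall h, W' j h = map (l_ j) (word (sval (f'_ j) h))
  & k j = mu_mor A (f_ j, f'_ j) (phi \o l_ j)] := Hr j.
clearbody n_ l_ f_ f'_.
pose l (x : 'I_(\sum_j n_ j)) := l_ (tagnat.sig1 x) (tagnat.sig2 x).
have lR j i : l (tagnat.Rank j i) = l_ j i.
  have fK : tagnat.sig (tagnat.Rank j i) = Tagged (fun j => 'I_(n_ j)) i.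
    exact: tagnat.rankK.
  by rewrite /l /tagnat.sig1 /tagnat.sig2 fK.
have lw (f0 : Q n) (fs : forall j, Q (n_ j)) (W0 : 'I_n -> words gT L) h :
    (forall j, W0 j h = map (l_ j) (word (sval (fs j) h))) ->
    flatten [seq W0 j h | j <- word (sval f0 h)] = map l (word (sval (Q_gamma f0 fs) h)).
  move=> e; rewrite /= ffunE word_block map_flatten; congr flatten.
  rewrite -[RHS]map_comp; apply: eq_map => j /=; rewrite e -[RHS]map_comp.
  by apply: eq_map => i /=; rewrite lR.
exists _, l, (Q_gamma f f_), (Q_gamma f' f'_); split=> [h|h|].
- by apply: lw => j; case: (Hr j).
- by apply: lw => j; case: (Hr j).
have := mu_gamma_mor A ((f, f') : Mor (tQ box n))
  (fun j => (f_ j, f'_ j) : Mor (tQ box (n_ j))) (phi \o l).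
rewrite /mu_mor /= => ->; congr fmor; congr pair; apply/funext => j.
have [_ _ ->] := Hr j; congr fmor; congr pair; apply/funext => i /=.
by rewrite lR.
Qed.

Lemma evaluated_act h phi W W' k : evaluated phi W W' k ->
  evaluated (fmor (gcat_act h) \o phi) (fun x => W (x * h)%g) (fun x => W' (x * h)%g)
    (fmor (gcat_act h) k).
Proof.
move=> [n [l [f [f' [e e' ->]]]]]; exists n, l, (Q_act h f), (Q_act h f').
split=> [x|x|]; [by rewrite e /= ffunE|by rewrite e' /= ffunE|].
exact: (mu_act_mor A h ((f, f') : Mor (tQ box n))).
Qed.

Lemma evaluated_cmp phi psi W W' W'' k k' : uniq (W' 1%g) ->
  (forall i, src (phi i) = tgt (psi i)) ->
  evaluated phi W' W'' k' -> evaluated psi W W' k ->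
  evaluated (fun i => phi i ∘ psi i) W W'' (k' ∘ k).
Proof.
move=> un H [n [l [f' [f'' [e' e'' ->]]]]] /(evaluated_rebase un e') [f e ->].
exists n, l, f, f''; split=> //; rewrite -mu_cmp // => i; exact: H.
Qed.

Lemma evaluated_src phi W W' k : evaluated phi W W' k ->
  evaluated (fun i => idm (src (phi i))) W W (idm (src k)).
Proof.
move=> [n [l [f [f' [e e' ->]]]]]; exists n, l, f, f; split=> //.
by rewrite src_mu -mu_id.
Qed.

Lemma evaluated_tgt phi W W' k : evaluated phi W W' k ->
  evaluated (fun i => idm (tgt (phi i))) W' W' (idm (tgt k)).
Proof.
move=> [n [l [f [f' [e e' ->]]]]]; exists n, l, f', f'; split=> //.
by rewrite tgt_mu -mu_id.
Qed.

Lemma evaluated_cmp_id (x : L -> X) W W' W'' k k' : uniq (W' 1%g) ->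
  evaluated (fun i => idm (x i)) W' W'' k' -> evaluated (fun i => idm (x i)) W W' k ->
  evaluated (fun i => idm (x i)) W W'' (k' ∘ k).
Proof.
move=> un E' E; have := evaluated_cmp un _ E' E.
have -> : (fun i => idm (x i) ∘ idm (x i)) = fun i => idm (x i).
  by apply/funext => i; rewrite cmp1l ?tgt_idm.
by apply=> i; rewrite src_idm tgt_idm.
Qed.

End AlgebraWords.

Lemma idm_inj (C : category) : injective (@idm C).
Proof. by move=> a b /(congr1 src); rewrite !src_idm. Qed.

Definition wcat (gT : finGroupType) (L : Type) (U V : words gT L) : words gT L :=
  fun h => U h ++ V h.

(** Expresses in words that the permutative structure and the comparisons are values of operations
    of the algebra. It is all that the uniqueness argument uses about a biased structure, which
    makes that argument common to both groups. *)
Record generated_by (gT : finGroupType) (g : gT) (Sg : signature g) (m : nat)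
    (box : PG gT m) (X : gcategory gT) (A : algebra (tQ_operad box) X)
    (P : gpermutative X) (Q : comparisons Sg P) : Prop := {
  gen_unit : forall (L : eqType) (phi : L -> Mor X),
    evaluated A phi (fun=> [::]) (fun=> [::]) (idm (pe P));
  gen_ten : forall (L : eqType) (phi : L -> Mor X) U U' V V' k k',
    evaluated A phi U U' k -> evaluated A phi V V' k' ->
    evaluated A phi (wcat U V) (wcat U' V') (tenm P k k');
  gen_beta : forall (L : eqType) (x : L -> X) U V a b,
    evaluated A (fun i => idm (x i)) U U (idm a) ->
    evaluated A (fun i => idm (x i)) V V (idm b) ->
    evaluated A (fun i => idm (x i)) (wcat U V) (wcat V U) (beta P a b);
  gen_bin : forall (L : eqType) (phi : L -> Mor X) d U U' V V' k k',
    evaluated A phi U U' k -> evaluated A phi V V' k' ->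
    evaluated A phi (bcat d U V) (wcat U' V') (cbin Q d k k');
  gen_tern : forall (L : eqType) (phi : L -> Mor X) p U U' V V' Z Z' k k' k'',
    evaluated A phi U U' k -> evaluated A phi V V' k' -> evaluated A phi Z Z' k'' ->
    evaluated A phi (tcat p U V Z) (wcat U' (wcat V' Z')) (ctern Q p k k' k'')
}.

(** * An algebra is recovered from the structure it generates *)

Section Uniqueness.
Variables (gT : finGroupType) (g : gT) (g_gen : <[g]>%g = [set: gT]).
Variables (Sg : signature g) (m : nat) (box : PG gT m).
Hypothesis box_term : exists t : term Sg 'I_m, represents t box.
Variables (X : gcategory gT) (A : algebra (tQ_operad box) X).
Variables (P : gpermutative X) (Q : comparisons Sg P).
Hypothesis gen : generated_by A Q.

Section Labels.
Variable L : eqType.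

Lemma evaluated_wob (x : L -> X) w :
  evaluated A (fun i => idm (x i)) (fun=> w) (fun=> w) (idm (wob P x w)).
Proof.
elim: w => [|i w IH]; first exact: (gen_unit gen).
by rewrite wob_cons -ten_id; exact: (gen_ten gen (evaluated_leaf A (fun i => idm (x i)) i) IH).
Qed.

Lemma evaluated_can (x : L -> X) w w' : uniq w -> perm_eq w w' ->
  evaluated A (fun i => idm (x i)) (fun=> w) (fun=> w') (can P x w w').
Proof.
elim: w w' => [|i w IH] w'.
  by move=> _; rewrite perm_sym => /perm_nilP ->; exact: (gen_unit gen).
move=> /andP [iw uw] /perm_cons_split [r [s [-> ir pe]]]; rewrite can_cons //.
have un : uniq (i :: (r ++ s)) by rewrite /= -(perm_mem pe) -(perm_uniq pe) iw.
apply: (evaluated_cmp_id (W' := fun=> i :: (r ++ s))) un _ _; last first.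
  exact: (gen_ten gen (evaluated_leaf A (fun i => idm (x i)) i) (IH _ uw pe)).
have := gen_ten gen (gen_beta gen (evaluated_leaf A (fun i => idm (x i)) i) (evaluated_wob x r))
  (evaluated_wob x s).
have -> : wcat (wcat (fun=> r) (fun=> [:: i])) (fun=> s) = fun _ : gT => r ++ i :: s.
  by apply/funext => h; rewrite /wcat -catA.
by [].
Qed.

Lemma evaluated_cmpr (phi : L -> Mor X) (t : term Sg L) :
  evaluated A phi (wd t) (fun=> wd t 1%g) (cmpr Q phi t).
Proof.
elim: t => [i||d s IHs t IHt|p s IHs t IHt u IHu].
- exact: evaluated_leaf.
- exact: (gen_unit gen).
- rewrite [wd (Bin _ _ _) 1%g]/= bcat1; exact: (gen_bin gen d IHs IHt).
- rewrite [wd (Tern _ _ _ _) 1%g]/= tcat1; exact: (gen_tern gen p IHs IHt IHu).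
Qed.

End Labels.

(** Both sides of the coherence equation are evaluated morphisms from the words of t to the constant
    family at the word of t' at 1, hence equal by [evaluated_uniq]. The equations for source and
    target follow in the same way from identities. *)
Lemma evaluated_coherent n (f f' : QG box n) (t t' : term Sg 'I_n) phi :
  represents t (sval f) -> represents t' (sval f') ->
  coherent Q phi t t' (mu_mor A (f, f') phi).
Proof.
move=> tf tf'; set k := mu_mor _ _ _.
have ek : evaluated A phi (wd t) (wd t') k.
  by exists n, id, f, f'; split=> // h; rewrite map_id; [exact: tf|exact: tf'].
have un : uniq (wd t 1%g) by rewrite tf word_uniq.
have un' : uniq (wd t' 1%g) by rewrite tf' word_uniq.
have pe : perm_eq (wd t 1%g) (wd t' 1%g) by rewrite tf tf' perm_word.
have e1 : src k = src (cmpr Q phi t).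
  apply: idm_inj; apply: (evaluated_uniq un (evaluated_src ek)).
  exact: evaluated_src (evaluated_cmpr phi t).
pose y i := idm (tgt (phi i)).
have e2 : tgt k = src (cmpr Q y t').
  apply: idm_inj; apply: (evaluated_uniq un' (evaluated_tgt ek)).
  have := evaluated_src (evaluated_cmpr y t').
  by have -> : (fun i => idm (src (y i))) = y by apply/funext => i; rewrite src_idm.
split=> //; have ey : (fun i => y i ∘ phi i) = phi.
  by apply/funext => i; rewrite cmp1l.
have sy i : src (y i) = tgt (phi i) by rewrite src_idm.
have E1 := evaluated_cmp un' sy (evaluated_cmpr y t') ek.
have E2 := evaluated_cmp (W' := fun=> wd t 1%g) un sy
  (evaluated_can (fun i => tgt (phi i)) un pe) (evaluated_cmpr phi t).
by rewrite ey in E1 E2; apply: evaluated_uniq un E1 E2.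
Qed.

Lemma functor_ext (C D : category) (F G : functor C D) :
  (forall f, fmor F f = fmor G f) -> F = G.
Proof.
move=> e; have eo a : F a = G a.
  by rewrite -[LHS]src_idm -fmor_id e fmor_id src_idm.
case: F G e eo => [F1 F2 a b c d] [G1 G2 a' b' c' d'] /= /funext eF /funext eG.
by subst; congr Functor; apply: Prop_irrelevance.
Qed.

Lemma algebra_ext (B : algebra (tQ_operad box) X) :
  (forall n, mu A n = mu B n) -> A = B.
Proof.
clear gen; case: A => [M a b c d e f h i]; case: B => [M' a' b' c' d' e' f' h' i'] /= eM.
have {}eM : M = M' by apply: functional_extensionality_dep.
by subst; congr Algebra; apply: Prop_irrelevance.
Qed.

Lemma realization_unique : A = realization g_gen box_term Q.
Proof.
apply: algebra_ext => n; apply: functor_ext => -[[f f'] phi].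
have tf := term_ofP g_gen box_term f; have tf' := term_ofP g_gen box_term f'.
exact: realize_uniq tf tf' (evaluated_coherent phi tf tf').
Qed.

End Uniqueness.

Definition none (T : Type) (i : 'I_0) : T.
Proof. by case: i. Defined.

Definition two (T : Type) (a b : T) (i : 'I_2) : T := if val i == 0 then a else b.

Definition three (T : Type) (a b c : T) (i : 'I_3) : T :=
  if val i == 0 then a else if val i == 1 then b else c.

Lemma two_eta (T : Type) (x : 'I_2 -> T) : two (x ord0) (x ord_max) = x.
Proof. by apply/funext => -[[|[|//]] p]; congr x; apply: val_inj. Qed.

Lemma three_eta (T : Type) (x : 'I_3 -> T) :
  three (x ord0) (x (inord 1)) (x ord_max) = x.
Proof.
apply/funext => -[[|[|[|//]]] p]; congr x; apply: val_inj => //=.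
by rewrite inordK.
Qed.

Lemma comp_two (T T' : Type) (f : T -> T') a b :
  (fun i => f (two a b i)) = two (f a) (f b).
Proof. by apply/funext => -[[|[|//]] p]. Qed.

Lemma comp_three (T T' : Type) (f : T -> T') a b c :
  (fun i => f (three a b c i)) = three (f a) (f b) (f c).
Proof. by apply/funext => -[[|[|[|//]]] p]. Qed.

Lemma enum2 : enum 'I_2 = [:: ord0; ord_max].
Proof.
by rewrite !enum_ordSl enum_ord0 /=; congr [:: _; _]; apply: val_inj.
Qed.

Lemma enum3 : enum 'I_3 = [:: ord0; inord 1; ord_max].
Proof.
rewrite !enum_ordSl enum_ord0 /=; congr [:: _; _; _]; apply: val_inj => //=.
by rewrite inordK.
Qed.

Lemma word_tperm2 : word (tperm ord0 ord_max : 'S_2) = [:: ord_max; ord0].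
Proof. by rewrite /word tpermV enum2 /= tpermL tpermR. Qed.

Section FromAlgebra.
Variables (gT : finGroupType) (m : nat) (box : PG gT m) (X : gcategory gT).
Variable A : algebra (tQ_operad box) X.
Local Notation Q n := (QG box n).

Definition mu_functor2 (f : Q 2) : functor (prod_category X X) X.
Proof.
refine (@Functor (prod_category X X) X (fun a => mu_ob A f (two a.1 a.2))
  (fun k => mu_mor A (f, f) (two k.1 k.2)) _ _ _ _).
- by move=> k; rewrite src_mu; congr mu_ob; apply: comp_two.
- by move=> k; rewrite tgt_mu; congr mu_ob; apply: comp_two.
- by move=> a; rewrite -mu_id comp_two.
- move=> k k' H H'; rewrite -[RHS]cmpE -mu_cmp.
    congr mu_mor; apply/funext => -[[|[|//]] p]; by rewrite /two /= -cmpE.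
  by case: H => e1 e2 [[|[|//]] p].
Defined.

Definition mu_functor3 (f : Q 3) : functor (prod_category (prod_category X X) X) X.
Proof.
refine (@Functor (prod_category (prod_category X X) X) X
  (fun a => mu_ob A f (three a.1.1 a.1.2 a.2))
  (fun k => mu_mor A (f, f) (three k.1.1 k.1.2 k.2)) _ _ _ _).
- by move=> k; rewrite src_mu; congr mu_ob; apply: comp_three.
- by move=> k; rewrite tgt_mu; congr mu_ob; apply: comp_three.
- by move=> a; rewrite -mu_id comp_three.
- move=> k k' H H'; rewrite -[RHS]cmpE -mu_cmp.
    congr mu_mor; apply/funext => -[[|[|[|//]]] p]; by rewrite /three /= -cmpE.
  by case: H => e1 e2 e3 [[|[|[|//]]] p].
Defined.

Lemma mu_iso n (f f' : Q n) (x : 'I_n -> X) :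
  is_iso (mu_mor A (f, f') (fun i => idm (x i))).
Proof.
have e (h : 'I_n -> X) : src \o (fun i => idm (h i)) = h by apply/funext => i; rewrite /= src_idm.
have e' (h : 'I_n -> X) : tgt \o (fun i => idm (h i)) = h by apply/funext => i; rewrite /= tgt_idm.
have ee : (fun i => idm (x i) ∘ idm (x i)) = fun i => idm (x i).
  by apply/funext => i; rewrite cmp1l ?tgt_idm.
apply/isoE; exists (mu_mor A (f', f) (fun i => idm (x i))).
rewrite !src_mu !tgt_mu e e'; split=> //.
- by rewrite -mu_cmp ?ee ?mu_id // => i; rewrite src_idm tgt_idm.
- by rewrite -mu_cmp ?ee ?mu_id // => i; rewrite src_idm tgt_idm.
Qed.

Lemma mu_natural n (f f' : Q n) (phi : 'I_n -> Mor X) :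
  mu_mor A (f', f') phi ∘ mu_mor A (f, f') (fun i => idm (src (phi i))) =
  mu_mor A (f, f') (fun i => idm (tgt (phi i))) ∘ mu_mor A (f, f) phi.
Proof.
rewrite -mu_cmp; last by move=> i; rewrite tgt_idm.
rewrite -mu_cmp; last by move=> i; rewrite src_idm.
by congr mu_mor; apply/funext => i; rewrite cmp1l ?cmp1r.
Qed.

Definition mu_e : X := mu_ob A (Q_e box) (@none X).
Definition mu_ten := mu_functor2 (Q_otimes box).
Definition Q_swap : Q 2 := Q_perm (tperm ord0 ord_max) (Q_otimes box).
Definition mu_beta (a : X * X) : Mor X :=
  mu_mor A (Q_otimes box, Q_swap) (fun i => idm (two a.1 a.2 i)).

Lemma word_otimes h : word (sval (Q_otimes box) h) = [:: ord0; ord_max].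
Proof. by rewrite /= ffunE word1 enum2. Qed.

Lemma word_swap h : word (sval Q_swap h) = [:: ord_max; ord0].
Proof. by rewrite /= ffunE word_permc ffunE word1 enum2 /= tpermV tpermL tpermR. Qed.

Section Rules.
Variable L : eqType.
Implicit Types (phi : L -> Mor X).

Lemma evaluated2 phi (f f' : Q 2) U U' V V' W W' k k' :
  (forall h, W h = flatten [seq two U V j h | j <- word (sval f h)]) ->
  (forall h, W' h = flatten [seq two U' V' j h | j <- word (sval f' h)]) ->
  evaluated A phi U U' k -> evaluated A phi V V' k' ->
  evaluated A phi W W' (mu_mor A (f, f') (two k k')).
Proof.
move=> /funext -> /funext -> E E'; apply: evaluated_op => -[[|[|//]] p] //.
Qed.

Lemma evaluated3 phi (f f' : Q 3) U U' V V' Z Z' W W' k k' k'' :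
  (forall h, W h = flatten [seq three U V Z j h | j <- word (sval f h)]) ->
  (forall h, W' h = flatten [seq three U' V' Z' j h | j <- word (sval f' h)]) ->
  evaluated A phi U U' k -> evaluated A phi V V' k' -> evaluated A phi Z Z' k'' ->
  evaluated A phi W W' (mu_mor A (f, f') (three k k' k'')).
Proof.
move=> /funext -> /funext -> E E' E''; apply: evaluated_op => -[[|[|[|//]]] p] //.
Qed.

Lemma evaluated_e phi : evaluated A phi (fun=> [::]) (fun=> [::]) (idm mu_e).
Proof.
have l : 'I_0 -> L by case.
exists 0, l, (Q_e box), (Q_e box).
have e h : [::] = map l (word (sval (Q_e box) h)).
  by rewrite (size0nil (size_word _)).
split=> //; rewrite -mu_id; congr mu_mor; apply/funext => -[i p]; by [].
Qed.

Lemma evaluated_ten phi U U' V V' k k' :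
  evaluated A phi U U' k -> evaluated A phi V V' k' ->
  evaluated A phi (wcat U V) (wcat U' V') (fmor mu_ten (k, k')).
Proof.
by apply: evaluated2 => h; rewrite word_otimes /= cats0.
Qed.

Lemma evaluated_beta (x : L -> X) U V a b :
  evaluated A (fun i => idm (x i)) U U (idm a) ->
  evaluated A (fun i => idm (x i)) V V (idm b) ->
  evaluated A (fun i => idm (x i)) (wcat U V) (wcat V U) (mu_beta (a, b)).
Proof.
rewrite /mu_beta (comp_two (fun a => idm a)).
by apply: evaluated2 => h; rewrite ?word_otimes ?word_swap /= cats0.
Qed.

End Rules.
End FromAlgebra.

(** * The equivariant permutative structure read off from an algebra *)

Section PermutativeOfAlgebra.
Variables (gT : finGroupType) (m : nat) (box : PG gT m) (X : gcategory gT).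
Variable A : algebra (tQ_operad box) X.
Local Notation "a ⊙ b" := (mu_ten A (a, b)) (at level 35, right associativity).
Local Notation "f ⊗ g" := (fmor (mu_ten A) (f, g)) (at level 35, right associativity).
Local Notation e := (mu_e A).
Local Notation beta a b := (mu_beta A (a, b)).
Local Notation leaf phi i := (evaluated_leaf A phi i).
Local Notation ev_uniq phi w w' := (@evaluated_uniq _ _ _ _ A _ phi (fun=> w) (fun=> w') _ _ isT).
Local Notation env s := (fun i => idm (nth e s i)).

Lemma mu_ten_id a b : idm a ⊗ idm b = idm (a ⊙ b).
Proof. exact: (fmor_id (mu_ten A) (a, b)). Qed.

Lemma src_mu_ten f f' : src (f ⊗ f') = src f ⊙ src f'.
Proof. exact: (src_fmor (mu_ten A) (f, f')). Qed.

Lemma tgt_mu_ten f f' : tgt (f ⊗ f') = tgt f ⊙ tgt f'.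
Proof. exact: (tgt_fmor (mu_ten A) (f, f')). Qed.

(** The pattern for all axioms read off from an algebra: the variables are labelled by natural
    numbers, both sides are exhibited as evaluated morphisms, and only their words are compared. For
    constant words, absence of repetitions holds by computation. *)
Lemma mu_ten_assoc f f' f'' : f ⊗ (f' ⊗ f'') = (f ⊗ f') ⊗ f''.
Proof.
pose phi := nth f [:: f; f'; f'']; apply: (ev_uniq phi [:: 0; 1; 2] [:: 0; 1; 2]).
- exact: (evaluated_ten (leaf phi 0) (evaluated_ten (leaf phi 1) (leaf phi 2))).
- exact: (evaluated_ten (evaluated_ten (leaf phi 0) (leaf phi 1)) (leaf phi 2)).
Qed.

Lemma mu_ten_el f : idm e ⊗ f = f.
Proof.
pose phi (i : nat) := f; apply: (ev_uniq phi [:: 0] [:: 0]).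
- exact: (evaluated_ten (evaluated_e A phi) (leaf phi 0)).
- exact: (leaf phi 0).
Qed.

Lemma mu_ten_er f : f ⊗ idm e = f.
Proof.
pose phi (i : nat) := f; apply: (ev_uniq phi [:: 0] [:: 0]).
- exact: (evaluated_ten (leaf phi 0) (evaluated_e A phi)).
- exact: (leaf phi 0).
Qed.

Lemma mu_ten_assoc_ob a b c : a ⊙ (b ⊙ c) = (a ⊙ b) ⊙ c.
Proof. by apply: idm_inj; rewrite -!mu_ten_id mu_ten_assoc. Qed.

Lemma mu_ten_el_ob a : e ⊙ a = a.
Proof. by apply: idm_inj; rewrite -!mu_ten_id mu_ten_el. Qed.

Lemma mu_ten_er_ob a : a ⊙ e = a.
Proof. by apply: idm_inj; rewrite -!mu_ten_id mu_ten_er. Qed.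

Lemma src_mu_beta a b : src (beta a b) = a ⊙ b.
Proof. by rewrite src_mu; congr mu_ob; apply/funext => i; rewrite /= src_idm. Qed.

Lemma two_swap (T : Type) (a b : T) :
  (fun i => two a b (((tperm ord0 ord_max : 'S_2)^-1)%g i)) = two b a.
Proof.
apply/funext => i; have [->|->] : i = ord0 \/ i = ord_max.
- by case: i => [[|[|//]] p]; [left|right]; apply: val_inj.
- by rewrite tpermV tpermL.
- by rewrite tpermV tpermR.
Qed.

(** Equivariance under the transposition identifies the target operation of [mu_beta] with the
    reversed tensor product. *)
Lemma mu_swap_mor f f' :
  mu_mor A (Q_swap box, Q_swap box) (two f f') = f' ⊗ f.
Proof.
have := mu_perm_mor A (tperm ord0 ord_max)
  ((Q_otimes box, Q_otimes box) : Mor (tQ box 2)) (two f f').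
by rewrite two_swap.
Qed.

Lemma tgt_mu_beta a b : tgt (beta a b) = b ⊙ a.
Proof.
apply: idm_inj; rewrite tgt_mu -mu_id -mu_ten_id -mu_swap_mor; congr mu_mor.
by rewrite -(comp_two (fun a => idm a)); apply/funext => i; rewrite /= tgt_idm.
Qed.

Lemma mu_beta_natural :
  natural_iso (mu_ten A) (comp_functor (mu_ten A) (swap_functor X X)) (mu_beta A).
Proof.
split=> [[a b]|[a b]|[f f']|[a b]].
- exact: src_mu_beta.
- exact: tgt_mu_beta.
- apply/comm_squareE; split.
  + by rewrite tgt_mu_beta (src_mu_ten f' f).
  + by rewrite src_mu_beta tgt_mu_ten.
  + rewrite -[fmor (comp_functor _ _) _]mu_swap_mor.
    have := mu_natural A (Q_otimes box) (Q_swap box) (two f f').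
    have e1 : (fun i => idm (src (two f f' i))) = fun i => idm (two (src f) (src f') i).
      by apply/funext => -[[|[|//]] p].
    have e2 : (fun i => idm (tgt (two f f' i))) = fun i => idm (two (tgt f) (tgt f') i).
      by apply/funext => -[[|[|//]] p].
    by rewrite e1 e2.
- exact: mu_iso.
Qed.

Lemma mu_beta_e a : beta a e = idm a.
Proof.
pose x := [:: a]; apply: (ev_uniq (env x) [:: 0] [:: 0]); last exact: (leaf (env x) 0).
exact: (evaluated_beta (leaf (env x) 0) (evaluated_e A (env x))).
Qed.

Lemma mu_beta_sym a b : is_comp (beta b a) (beta a b) (idm (a ⊙ b)).
Proof.
apply/is_compE; split; first by rewrite src_mu_beta tgt_mu_beta.
pose x := [:: a; b]; apply: (ev_uniq (env x) [:: 0; 1] [:: 0; 1]).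
  apply: (evaluated_cmp_id (W' := fun=> [:: 1; 0])) => //.
  - exact: (evaluated_beta (leaf (env x) 1) (leaf (env x) 0)).
  - exact: (evaluated_beta (leaf (env x) 0) (leaf (env x) 1)).
rewrite -mu_ten_id; exact: (evaluated_ten (leaf (env x) 0) (leaf (env x) 1)).
Qed.

Lemma mu_beta_hex a b c :
  is_comp (beta a c ⊗ idm b) (idm a ⊗ beta b c) (beta (a ⊙ b) c).
Proof.
apply/is_compE; split.
  by rewrite src_mu_ten tgt_mu_ten src_idm tgt_idm src_mu_beta tgt_mu_beta mu_ten_assoc_ob.
pose x := [:: a; b; c]; apply: (ev_uniq (env x) [:: 0; 1; 2] [:: 2; 0; 1]).
  apply: (evaluated_cmp_id (W' := fun=> [:: 0; 2; 1])) => //.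
  - exact: (evaluated_ten (evaluated_beta (leaf (env x) 0) (leaf (env x) 2)) (leaf (env x) 1)).
  - exact: (evaluated_ten (leaf (env x) 0) (evaluated_beta (leaf (env x) 1) (leaf (env x) 2))).
have := evaluated_ten (leaf (env x) 0) (leaf (env x) 1); rewrite mu_ten_id => H.
exact: (evaluated_beta H (leaf (env x) 2)).
Qed.

Definition mu_permutative : permutative X :=
  @Permutative X e (mu_ten A) (mu_beta A) mu_beta_natural mu_ten_assoc_ob mu_ten_assoc
    mu_ten_el_ob mu_ten_el mu_ten_er_ob mu_ten_er mu_beta_e mu_beta_sym mu_beta_hex.

Lemma mu_e_act (h : gT) : gcat_act h e = e.
Proof.
apply: idm_inj; rewrite -fmor_id; pose phi (i : nat) := idm e.
apply: (ev_uniq (fmor (gcat_act h) \o phi) [::] [::]); last exact: evaluated_e.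
exact: (evaluated_act h (evaluated_e A phi)).
Qed.

Lemma mu_ten_act (h : gT) f f' : fmor (gcat_act h) (f ⊗ f') =
  fmor (gcat_act h) f ⊗ fmor (gcat_act h) f'.
Proof.
pose phi := nth f [:: f; f'].
apply: (ev_uniq (fmor (gcat_act h) \o phi) [:: 0; 1] [:: 0; 1]).
- exact: (evaluated_act h (evaluated_ten (leaf phi 0) (leaf phi 1))).
- exact: (evaluated_ten (leaf (fmor (gcat_act h) \o phi) 0) (leaf (fmor (gcat_act h) \o phi) 1)).
Qed.

Lemma mu_ten_act_ob (h : gT) a b : gcat_act h (a ⊙ b) = gcat_act h a ⊙ gcat_act h b.
Proof. by apply: idm_inj; rewrite -[LHS]fmor_id -!mu_ten_id mu_ten_act !fmor_id. Qed.

Lemma evaluated_act_id (h : gT) (L : eqType) (x : L -> X) W W' k :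
  evaluated A (fun i => idm (x i)) W W' k ->
  evaluated A (fun i => idm (gcat_act h (x i))) (fun l => W (l * h)%g)
    (fun l => W' (l * h)%g) (fmor (gcat_act h) k).
Proof.
move=> /(evaluated_act h); congr evaluated.
by apply/funext => i; rewrite /= fmor_id.
Qed.

Lemma mu_beta_act (h : gT) a b : fmor (gcat_act h) (beta a b) =
  beta (gcat_act h a) (gcat_act h b).
Proof.
pose x := nth e [:: a; b]; pose y i := idm (gcat_act h (x i)); pose z i := idm (x i).
apply: (ev_uniq y [:: 0; 1] [:: 1; 0]).
- exact: (evaluated_act_id h (evaluated_beta (leaf z 0) (leaf z 1))).
- exact: (evaluated_beta (leaf y 0) (leaf y 1)).
Qed.

Definition mu_gpermutative : gpermutative X :=
  @GPermutative gT X mu_permutative mu_e_act mu_ten_act_ob mu_ten_act mu_beta_act.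

Lemma evaluates_mu_permutative : evaluates_perm A mu_gpermutative.
Proof.
split=> [x|x|f|x] /=.
- by rewrite /mu_e; congr mu_ob; apply/funext; case.
- by rewrite two_eta.
- by rewrite two_eta.
- by rewrite /mu_beta /= two_eta.
Qed.

End PermutativeOfAlgebra.

Lemma permutative_ext (C : category) (p p' : permutative C) : pe p = pe p' ->
  pten p = pten p' -> pbeta p = pbeta p' -> p = p'.
Proof.
case: p => [e t b h1 h2 h3 h4 h5 h6 h7 h8 h9 h10].
case: p' => [e' t' b' k1 k2 k3 k4 k5 k6 k7 k8 k9 k10] /= ee et eb.
by subst; congr Permutative; apply: Prop_irrelevance.
Qed.

Lemma gpermutative_ext (gT : finGroupType) (X : gcategory gT)
  (p p' : gpermutative X) : gperm p = gperm p' -> p = p'.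
Proof.
case: p => [p h1 h2 h3 h4]; case: p' => [p' k1 k2 k3 k4] /= e.
by subst; congr GPermutative; apply: Prop_irrelevance.
Qed.

Lemma evaluates_perm_uniq (gT : finGroupType) (m : nat) (box : PG gT m)
    (X : gcategory gT) (A : algebra (tQ_operad box) X) (p p' : permutative X) :
  evaluates_perm A p -> evaluates_perm A p' -> p = p'.
Proof.
move=> [e1 e2 e3 e4] [k1 k2 k3 k4]; apply: permutative_ext.
- by rewrite (e1 (@none X)) (k1 (@none X)).
- by apply: functor_ext => -[f f']; rewrite (e3 (two f f')) (k3 (two f f')).
- by apply/funext => -[a b]; rewrite (e4 (two a b)) (k4 (two a b)).
Qed.

(** * The values of a realized algebra at the generating operations *)

Section RealizationValues.
Variables (gT : finGroupType) (g : gT) (g_gen : <[g]>%g = [set: gT]).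
Variables (Sg : signature g) (m : nat) (box : PG gT m).
Hypothesis box_term : exists t : term Sg 'I_m, represents t box.
Variables (X : gcategory gT) (P : gpermutative X) (Q : comparisons Sg P).
Hypothesis ups_ten : forall a b, ups Q (ten Sg) a b = idm (teno P a b).
Local Notation R := (realization g_gen box_term Q).
Local Notation "a ⊙ b" := (teno P a b) (at level 35, right associativity).
Local Notation "f ⊗ g" := (tenm P f g) (at level 35, right associativity).
Local Notation leaf i := (Leaf (i : 'I_2) : term Sg 'I_2).

Lemma mu_realization n (f f' : QG box n) phi :
  mu_mor R (f, f') phi = realize g_gen box_term Q f f' phi.
Proof. by []. Qed.

Lemma realization_e x : mu_ob R (Q_e box) x = pe P.
Proof.
have tP : represents (Unt : term Sg _) (sval (Q_e box)).
  by move=> h; rewrite (size0nil (size_word _)).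
apply: (@idm_inj X); rewrite -mu_id mu_realization; apply/esym/(realize_uniq g_gen box_term tP tP).
by split; rewrite /= ?src_idm ?tgt_idm.
Qed.

(** When the words at 1 coincide, the canonical isomorphism in the coherence equation is an
    identity, so only comparisons remain to be checked. *)
Lemma realization_value n (f f' : QG box n) (t t' : term Sg 'I_n) phi k :
  represents t (sval f) -> represents t' (sval f') -> wd t 1%g = wd t' 1%g ->
  let y i := idm (tgt (phi i)) in
  src k = src (cmpr Q phi t) -> tgt k = src (cmpr Q y t') ->
  cmpr Q y t' ∘ k = cmpr Q phi t -> k = mu_mor R (f, f') phi.
Proof.
move=> tf tf' ew y h1 h2 h3; rewrite mu_realization.
apply: (realize_uniq g_gen box_term tf tf'); split=> //.
by rewrite -ew can_id ?(represents_uniq tf) // cmp1l ?tgt_cmpr.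
Qed.

Lemma realization_bin d d' (f f' : QG box 2) (phi : 'I_2 -> Mor X) k :
  represents (Bin d (leaf ord0) (leaf ord_max)) (sval f) ->
  represents (Bin d' (leaf ord0) (leaf ord_max)) (sval f') ->
  src k = src (ups Q d (src (phi ord0)) (src (phi ord_max))) ->
  tgt k = src (ups Q d' (tgt (phi ord0)) (tgt (phi ord_max))) ->
  ups Q d' (tgt (phi ord0)) (tgt (phi ord_max)) ∘ k =
    (phi ord0 ⊗ phi ord_max) ∘ ups Q d (src (phi ord0)) (src (phi ord_max)) ->
  k = mu_mor R (f, f') phi.
Proof.
move=> tf tf' h1 h2 h3; apply: (realization_value tf tf'); first by rewrite /= !bcat1.
- by rewrite h1 /= src_cbin.
- by rewrite h2 /= src_cbin !src_idm.
- by rewrite /= /cbin !src_idm ten_id cmp1l ?tgt_ups.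
Qed.

(** Here the two words at 1 differ, so [realization_value] does not apply; the canonical isomorphism
    is the symmetry itself, by [can_beta] on two letters. *)
Lemma realization_swap x : mu_mor R (Q_otimes box, Q_swap box) (fun i => idm (x i)) =
  beta P (x ord0) (x ord_max).
Proof.
have tf : represents (Bin (ten Sg) (leaf ord0) (leaf ord_max)) (sval (Q_otimes box)).
  by move=> h; rewrite word_otimes /= /bcat swap_ten.
have tf' : represents (Bin (ten Sg) (leaf ord_max) (leaf ord0)) (sval (Q_swap box)).
  by move=> h; rewrite word_swap /= /bcat swap_ten.
have yx : (fun i => idm (tgt (idm (x i)))) = fun i => idm (x i).
  by apply/funext => i; rewrite tgt_idm.
rewrite mu_realization; apply/esym/(realize_uniq g_gen box_term tf tf'); split; rewrite ?yx.
- by rewrite /= src_cbin !src_idm ups_ten src_idm src_beta.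
- by rewrite /= src_cbin !src_idm ups_ten src_idm tgt_beta.
rewrite [cmpr _ _ _]/= /cbin !src_idm !ups_ten !ten_id !cmp1l ?tgt_idm ?tgt_beta //.
rewrite [cmpr _ _ _]/= /cbin !src_idm !ups_ten !ten_id !cmp1l ?tgt_idm //.
have ex : tgt \o (fun i => idm (x i)) = x by apply/funext => i; rewrite /= tgt_idm.
rewrite ex [wd _ _]/= bcat1 [wd _ _]/= bcat1.
rewrite (can_beta P x (w := [:: ord0]) (v := [:: ord_max])) //= !tenoer.
by rewrite cmp1r // src_beta.
Qed.

Lemma realization_perm : evaluates_perm R P.
Proof.
have tf : represents (Bin (ten Sg) (leaf ord0) (leaf ord_max)) (sval (Q_otimes box)).
  by move=> h; rewrite word_otimes /= /bcat swap_ten.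
have H (phi : 'I_2 -> Mor X) :
    fmor (pten P) (phi ord0, phi ord_max) = mu_mor R (Q_otimes box, Q_otimes box) phi.
  apply: (realization_bin tf tf); rewrite !ups_ten ?src_idm ?src_fmor ?tgt_fmor //.
  by rewrite cmp1l ?tgt_fmor // cmp1r ?src_fmor.
split=> [x|x|f|x].
- by rewrite realization_e.
- apply: (@idm_inj X); rewrite -fmor_id -mu_id -H; by [].
- exact: H.
- by rewrite realization_swap.
Qed.

End RealizationValues.

Lemma evaluated_eq (gT : finGroupType) (m : nat) (box : PG gT m) (X : gcategory gT)
    (A : algebra (tQ_operad box) X) (L : eqType) (phi : L -> Mor X) W W' U U' k k' :
  uniq (W 1%g) -> W =1 U -> W' =1 U' ->
  evaluated A phi W W' k -> evaluated A phi U U' k' -> k = k'.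
Proof. by move=> un /funext eW /funext eW'; subst; apply: evaluated_uniq. Qed.

Lemma mu_natural2 (gT : finGroupType) (m : nat) (box : PG gT m) (X : gcategory gT)
    (A : algebra (tQ_operad box) X) (f f' : QG box 2) :
  natural_iso (mu_functor2 A f) (mu_functor2 A f')
    (fun a => mu_mor A (f, f') (fun i => idm (two a.1 a.2 i))).
Proof.
split=> [[a b]|[a b]|[k k']|[a b]].
- by rewrite src_mu; congr mu_ob; apply/funext => i; rewrite /= src_idm.
- by rewrite tgt_mu; congr mu_ob; apply/funext => i; rewrite /= tgt_idm.
- apply/comm_squareE; split=> /=.
  + rewrite src_mu tgt_mu; congr mu_ob; apply/funext => i /=; rewrite tgt_idm.
    by rewrite -(comp_two (fun k => src k)).
  + rewrite src_mu tgt_mu; congr mu_ob; apply/funext => i /=; rewrite src_idm.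
    by rewrite -(comp_two (fun k => tgt k)).
  + have := mu_natural A f f' (two k k').
    have e1 : (fun i => idm (src (two k k' i))) = fun i => idm (two (src k) (src k') i).
      by apply/funext => -[[|[|//]] p].
    have e2 : (fun i => idm (tgt (two k k' i))) = fun i => idm (two (tgt k) (tgt k') i).
      by apply/funext => -[[|[|//]] p].
    by rewrite e1 e2.
- exact: mu_iso.
Qed.

(** * Groups of order two *)

Section C2.
Variables (gT : finGroupType) (g : gT) (g_gen : <[g]>%g = [set: gT]).
Hypothesis card_gT : #|gT| = 2.

Lemma C2_cases (h : gT) : h = 1%g \/ h = g.
Proof.
have : h \in <[g]>%g by rewrite g_gen inE.
case/cyclePmin => -[|[|k]] lt ->; [by left|by right; rewrite expg1|].
by move: lt; rewrite orderE g_gen cardsT card_gT.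
Qed.

Lemma C2_neq : (1%g == g) = false.
Proof.
apply/eqP => e; have := cardsT gT; rewrite -g_gen -e cycle1 cards1 card_gT; lia.
Qed.

Lemma C2_sq : (g * g = 1)%g.
Proof.
case: (C2_cases (g * g)%g) => // e; have /eqP [] := negbT C2_neq.
by apply: (mulgI g); rewrite mulg1 e.
Qed.

Definition swap2 (b : bool) (h : gT) : bool := b && (h == g).

(** The tensor product is [false] and the box is [true]. The translate of the box by g is the box
    with exchanged arguments, so [twist] is the identity and the exchange is left to [swap]. *)
Definition sig2 : signature g.
Proof.
refine (@Signature gT g bool void false swap2 (of_void _) (of_void _) (of_void _)
  (of_void _) id _ _ _ _ _ _ _ _ _ _ _ _ _); try by case.
- by move=> d; rewrite /swap2 C2_neq andbF.
- by [].
- by move=> d d' /(_ g); rewrite /swap2 eqxx !andbT.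
- move=> d h; rewrite /swap2 eqxx andbT; case: d => //=.
  by case: (C2_cases h) => ->; rewrite ?mul1g ?C2_sq ?C2_neq eqxx.
Defined.

Lemma word_box2 h : word (box2 g h) = if h == g then [:: ord_max; ord0] else [:: ord0; ord_max].
Proof. by rewrite ffunE; case: ifP => _; rewrite ?word_tperm2 ?word1 ?enum2. Qed.

Lemma represents_box2 :
  represents (Bin (true : bop sig2) (Leaf ord0) (Leaf ord_max) : term sig2 'I_2) (box2 g).
Proof. by move=> h; rewrite word_box2 /= /bcat /= /swap2 /=; case: ifP. Qed.

Lemma box2_term : exists t : term sig2 'I_2, represents t (box2 g).
Proof. by eexists; apply: represents_box2. Qed.

Variable X : gcategory gT.

Lemma src_b2ups (B : biased_C2 g X) a b : src (b2ups B (a, b)) = b2box B (a, b).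
Proof. exact: (nat_src (b2ups_iso B) (a, b)). Qed.

Lemma tgt_b2ups (B : biased_C2 g X) a b : tgt (b2ups B (a, b)) = teno B a b.
Proof. exact: (nat_tgt (b2ups_iso B) (a, b)). Qed.

Definition ups2 (B : biased_C2 g X) (d : bool) (a b : X) : Mor X :=
  if d then b2ups B (a, b) else idm (teno B a b).

Definition comparisons2 (B : biased_C2 g X) : @comparisons gT g sig2 X B.
Proof.
refine (@Comparisons gT g sig2 X B (ups2 B) (of_void _) _ _ _ _ _ _ _ _ _ _ _ _);
  try by case.
- by move=> [] a b; rewrite /ups2 ?tgt_b2ups ?tgt_idm.
- move=> [] a b; [exact: nat_is_iso (b2ups_iso B) (a, b)|exact: iso_id].
- by move=> [] a; rewrite /ups2 ?b2ups_el // tenoel.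
- by move=> [] a; rewrite /ups2 ?b2ups_er // tenoer.
- move=> [] a b c; rewrite /ups2; last by rewrite !src_idm !ten_id tenoA.
  by rewrite !src_b2ups; case/comm_squareE: (b2ups_assoc B a b c).
- move=> [] a b; rewrite [swap _ _]/= /swap2 /= ?eqxx; last first.
    by rewrite /ups2 fmor_id pten_act_ob.
  by case/is_compE: (b2ups_act B a b).
Defined.

Lemma biased_C2_ext (B B' : biased_C2 g X) : b2perm B = b2perm B' ->
  b2box B = b2box B' -> b2ups B = b2ups B' -> B = B'.
Proof.
case: B => [p t u h1 h2 h3 h4 h5 h6 h7 h8 h9 h10 h11 h12 h13].
case: B' => [p' t' u' k1 k2 k3 k4 k5 k6 k7 k8 k9 k10 k11 k12 k13] /= ee et eb.
by subst; congr BiasedC2; apply: Prop_irrelevance.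
Qed.

Lemma evaluates_C2_uniq (A : algebra (tQ_C2 g) X) (B B' : biased_C2 g X) :
  evaluates_C2 A B -> evaluates_C2 A B' -> B = B'.
Proof.
move=> [e1 e2 e3 e4] [k1 k2 k3 k4]; apply: biased_C2_ext.
- by apply: gpermutative_ext; apply: evaluates_perm_uniq e1 k1.
- by apply: functor_ext => -[f f']; rewrite (e3 (two f f')) (k3 (two f f')).
- by apply/funext => -[a b]; rewrite (e4 (two a b)) (k4 (two a b)).
Qed.

Definition realization2 (B : biased_C2 g X) : algebra (tQ_C2 g) X :=
  realization g_gen box2_term (comparisons2 B).

Lemma evaluates_realization2 (B : biased_C2 g X) : evaluates_C2 (realization2 B) B.
Proof.
have tf : represents _ (sval (Q_box (box2 g))) := represents_box2.
have tf' : represents (Bin (false : bop sig2) (Leaf ord0) (Leaf ord_max) : term sig2 'I_2)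
    (sval (Q_otimes (box2 g))).
  by move=> h; rewrite word_otimes.
have ut a b : ups (comparisons2 B) (ten sig2) a b = idm (teno B a b) by [].
have H (f : 'I_2 -> Mor X) : fmor (b2box B) (f ord0, f ord_max) =
    mu_mor (realization2 B) (Q_box (box2 g), Q_box (box2 g)) f.
  apply: (realization_bin g_gen box2_term (Q := comparisons2 B) (d := true) (d' := true) tf tf);
    rewrite /= /ups2.
  - by rewrite src_b2ups src_fmor.
  - by rewrite src_b2ups tgt_fmor.
  - by case/comm_squareE: (nat_square (b2ups_iso B) (f ord0, f ord_max)).
split; first exact: realization_perm.
- move=> x; apply: (@idm_inj X); rewrite -mu_id -H.
  by rewrite -(fmor_id (b2box B) (x ord0, x ord_max)).
- exact: H.
- move=> x; apply: (realization_bin g_gen box2_term (Q := comparisons2 B)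
    (d := true) (d' := false) tf tf'); rewrite /= /ups2.
  - by rewrite !src_idm.
  - by rewrite !src_idm !tgt_idm tgt_b2ups.
  - by rewrite !src_idm !tgt_idm ten_id cmp1l ?tgt_b2ups // cmp1l ?tgt_b2ups.
Qed.

Section FromAlgebra2.
Variable A : algebra (tQ_C2 g) X.
Local Notation Qb := (Q_box (box2 g)).
Local Notation e := (mu_e A).
Local Notation leaf phi i := (evaluated_leaf A phi i).
Local Notation env s := (fun i => idm (nth e s i)).
Local Notation bw := (@bcat gT g sig2 nat true).
Local Notation beta := (mu_beta A).

Definition mu_box2 := mu_functor2 A Qb.
Definition mu_ups2 (a : X * X) : Mor X :=
  mu_mor A (Qb, Q_otimes (box2 g)) (fun i => idm (two a.1 a.2 i)).

Lemma bcat2E (L : Type) (U V : words gT L) h :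
  @bcat gT g sig2 L true U V h = if h == g then V h ++ U h else U h ++ V h.
Proof. by []. Qed.

Section Rules2.
Variable L : eqType.

Lemma flatten_box2 (U V : words gT L) h : @bcat gT g sig2 L true U V h =
  flatten [seq two U V j h | j <- word (sval Qb h)].
Proof. by rewrite bcat2E word_box2; case: ifP => _ /=; rewrite cats0. Qed.

Lemma evaluated_box2 (phi : L -> Mor X) U U' V V' k k' :
  evaluated A phi U U' k -> evaluated A phi V V' k' ->
  evaluated A phi (@bcat gT g sig2 L true U V) (@bcat gT g sig2 L true U' V')
    (fmor mu_box2 (k, k')).
Proof. by apply: evaluated2 => h; rewrite flatten_box2. Qed.

Lemma evaluated_box2_ten (phi : L -> Mor X) U U' V V' k k' :
  evaluated A phi U U' k -> evaluated A phi V V' k' ->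
  evaluated A phi (@bcat gT g sig2 L true U V) (wcat U' V')
    (mu_mor A (Qb, Q_otimes (box2 g)) (two k k')).
Proof.
by apply: evaluated2 => h; rewrite ?flatten_box2 ?word_otimes //= cats0.
Qed.

Lemma evaluated_ups2 (x : L -> X) U V a b :
  evaluated A (fun i => idm (x i)) U U (idm a) ->
  evaluated A (fun i => idm (x i)) V V (idm b) ->
  evaluated A (fun i => idm (x i)) (@bcat gT g sig2 L true U V) (wcat U V) (mu_ups2 (a, b)).
Proof. by rewrite /mu_ups2 (comp_two (fun a => idm a)); apply: evaluated_box2_ten. Qed.

End Rules2.

Lemma mu_box2_id a b : fmor mu_box2 (idm a, idm b) = idm (mu_box2 (a, b)).
Proof. exact: (fmor_id mu_box2 (a, b)). Qed.

Lemma mu_box2_assoc f f' f'' :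
  fmor mu_box2 (f, fmor mu_box2 (f', f'')) = fmor mu_box2 (fmor mu_box2 (f, f'), f'').
Proof.
pose phi := nth f [:: f; f'; f''].
apply: (evaluated_eq _ _ _ (evaluated_box2 (leaf phi 0) (evaluated_box2 (leaf phi 1) (leaf phi 2)))
  (evaluated_box2 (evaluated_box2 (leaf phi 0) (leaf phi 1)) (leaf phi 2))).
- by rewrite !bcat1.
- by move=> h; rewrite bcatA.
- by move=> h; rewrite bcatA.
Qed.

Lemma mu_box2_el f : fmor mu_box2 (idm e, f) = f.
Proof.
pose phi (i : nat) := f.
apply: (evaluated_eq _ _ _ (evaluated_box2 (evaluated_e A phi) (leaf phi 0)) (leaf phi 0)).
- by rewrite bcat1.
- by move=> h; rewrite bcat_nill.
- by move=> h; rewrite bcat_nill.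
Qed.

Lemma mu_box2_er f : fmor mu_box2 (f, idm e) = f.
Proof.
pose phi (i : nat) := f.
apply: (evaluated_eq _ _ _ (evaluated_box2 (leaf phi 0) (evaluated_e A phi)) (leaf phi 0)).
- by rewrite bcat1.
- by move=> h; rewrite bcat_nilr.
- by move=> h; rewrite bcat_nilr.
Qed.

Lemma mu_ups2_el a : mu_ups2 (e, a) = idm a.
Proof.
apply: (evaluated_eq _ _ _ (evaluated_ups2 (evaluated_e A (env [:: a])) (leaf (env [:: a]) 0))
  (leaf (env [:: a]) 0)); rewrite ?bcat1 //.
by move=> h; rewrite bcat_nill.
Qed.

Lemma mu_ups2_er a : mu_ups2 (a, e) = idm a.
Proof.
apply: (evaluated_eq _ _ _ (evaluated_ups2 (leaf (env [:: a]) 0) (evaluated_e A (env [:: a])))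
  (leaf (env [:: a]) 0)); rewrite ?bcat1 //.
by move=> h; rewrite bcat_nilr.
Qed.

Lemma src_mu_ups2 a b : src (mu_ups2 (a, b)) = mu_box2 (a, b).
Proof. exact: (nat_src (mu_natural2 A _ _) (a, b)). Qed.

Lemma tgt_mu_ups2 a b : tgt (mu_ups2 (a, b)) = mu_ten A (a, b).
Proof. exact: (nat_tgt (mu_natural2 A _ _) (a, b)). Qed.

Lemma mu_ups2_assoc a b c : comm_square
  (fmor (mu_ten A) (idm a, mu_ups2 (b, c))) (mu_ups2 (a, mu_box2 (b, c)))
  (fmor (mu_ten A) (mu_ups2 (a, b), idm c)) (mu_ups2 (mu_box2 (a, b), c)).
Proof.
apply/comm_squareE; split.
- by rewrite src_mu_ten tgt_mu_ups2 src_idm src_mu_ups2.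
- by rewrite src_mu_ten tgt_mu_ups2 src_idm src_mu_ups2.
pose x := env [:: a; b; c].
have H1 := evaluated_box2 (leaf x 1) (leaf x 2); rewrite mu_box2_id in H1.
have H2 := evaluated_box2 (leaf x 0) (leaf x 1); rewrite mu_box2_id in H2.
have E1 := evaluated_ups2 (leaf x 0) H1; have E2 := evaluated_ups2 H2 (leaf x 2).
have E3 := evaluated_ten (leaf x 0) (evaluated_ups2 (leaf x 1) (leaf x 2)).
have E4 := evaluated_ten (evaluated_ups2 (leaf x 0) (leaf x 1)) (leaf x 2).
have F1 := evaluated_cmp_id _ E3 E1; have F2 := evaluated_cmp_id _ E4 E2.
apply: (evaluated_eq _ _ _ (F1 _) (F2 _)); rewrite ?/wcat ?bcat1 //.
by move=> h; rewrite bcatA.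
Qed.

Lemma bcat2_act (L : Type) (U V : seq L) h :
  @bcat gT g sig2 L true (fun=> U) (fun=> V) (h * g)%g =
  @bcat gT g sig2 L true (fun=> V) (fun=> U) h.
Proof.
rewrite !bcat2E; case: (C2_cases h) => ->; rewrite ?mul1g ?C2_sq ?C2_neq ?eqxx //.
Qed.

Lemma mu_box2_act f f' : fmor (gcat_act g) (fmor mu_box2 (f, f')) =
  fmor mu_box2 (fmor (gcat_act g) f', fmor (gcat_act g) f).
Proof.
pose phi := nth f [:: f; f']; pose gphi := fmor (gcat_act g) \o phi.
apply: (evaluated_eq _ _ _ (evaluated_act g (evaluated_box2 (leaf phi 0) (leaf phi 1)))
  (evaluated_box2 (leaf gphi 1) (leaf gphi 0))).
- by rewrite bcat2_act bcat1.
- by move=> h; rewrite bcat2_act.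
- by move=> h; rewrite bcat2_act.
Qed.

Lemma mu_ups2_act a b : is_comp (beta (gcat_act g b, gcat_act g a))
  (mu_ups2 (gcat_act g b, gcat_act g a)) (fmor (gcat_act g) (mu_ups2 (a, b))).
Proof.
apply/is_compE; split; first by rewrite src_mu_beta tgt_mu_ups2.
pose x := nth e [:: a; b]; pose y i := idm (gcat_act g (x i)).
pose z i := idm (x i).
have E1 := evaluated_act_id g (evaluated_ups2 (leaf z 0) (leaf z 1)).
have E2 := evaluated_cmp_id _ (evaluated_beta (leaf y 1) (leaf y 0))
  (evaluated_ups2 (leaf y 1) (leaf y 0)).
apply: (evaluated_eq _ _ _ (E2 _) E1) => //.
- by rewrite bcat1.
- by move=> h; rewrite bcat2_act.
Qed.

Definition biased2 : biased_C2 g X.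
Proof.
refine (@BiasedC2 gT g X (mu_gpermutative A) mu_box2 mu_ups2 (mu_natural2 A _ _)
  _ mu_box2_el _ mu_box2_er mu_ups2_el mu_ups2_er _ mu_box2_assoc mu_ups2_assoc _
  mu_box2_act mu_ups2_act).
- by move=> a; apply: (@idm_inj X); rewrite -mu_box2_id mu_box2_el.
- by move=> a; apply: (@idm_inj X); rewrite -mu_box2_id mu_box2_er.
- by move=> a b c; apply: (@idm_inj X); rewrite -!mu_box2_id mu_box2_assoc.
- move=> a b; apply: (@idm_inj X); rewrite -[LHS]fmor_id -!mu_box2_id mu_box2_act.
  by rewrite !fmor_id.
Defined.

Lemma evaluates_biased2 : evaluates_C2 A biased2.
Proof.
split; first exact: evaluates_mu_permutative.
- by move=> x /=; rewrite two_eta.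
- by move=> f /=; rewrite two_eta.
- by move=> x /=; rewrite /mu_ups2 /= two_eta.
Qed.

(** The comparison is an evaluated morphism by construction; what has to be seen is that [cbin],
    which composes it with a tensor product of morphisms, is one as well. *)
Lemma biased2_generated : generated_by A (comparisons2 biased2).
Proof.
split=> /=.
- by move=> L phi; apply: evaluated_e.
- by move=> L phi U U' V V' k k'; apply: evaluated_ten.
- by move=> L x U V a b; apply: evaluated_beta.
- move=> L phi [] U U' V V' k k' E E'; rewrite /cbin /= /ups2 /=; last first.
    rewrite cmp1r; last by rewrite src_ten.
    by rewrite -[bcat _ _ _]/(fun h => wcat U V h); apply: evaluated_ten.
  have := evaluated_box2_ten E E'; congr evaluated.
  have sk i : src (two k k' i) = tgt (idm (two (src k) (src k') i)).
    by rewrite tgt_idm -(comp_two (fun k => src k)).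
  (* The morphism from box to tensor at k and k' factors as that morphism at the identities of the
     sources, followed by the tensor product of k and k'. *)
  have := mu_cmp A Qb (Q_otimes _) (Q_otimes _) sk.
  have -> : (fun i => two k k' i ∘ idm (two (src k) (src k') i)) = two k k'.
    by apply/funext => -[[|[|//]] p]; rewrite /two /= cmp1r.
  by [].
- by move=> L phi [].
Qed.

Lemma realization2_unique : A = realization2 biased2.
Proof. exact: realization_unique biased2_generated. Qed.

End FromAlgebra2.

(** One round trip is [realization2_unique]. For the other, the given structure and the one read off
    from its realization are both evaluations of the same algebra, hence equal. *)
Lemma biased2_bij : bijective biased2.
Proof.
exists realization2 => [A|B]; first by rewrite -realization2_unique.
exact: evaluates_C2_uniq (evaluates_biased2 _) (evaluates_realization2 B).
Qed.

End C2.

(** * Groups of order three *)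

Section C3.
Variables (gT : finGroupType) (g : gT) (g_gen : <[g]>%g = [set: gT]).
Hypothesis card_gT : #|gT| = 3.

Lemma C3_order : #[g]%g = 3.
Proof. by rewrite orderE g_gen cardsT. Qed.

Lemma C3_cases (h : gT) : [\/ h = 1%g, h = g | h = (g ^+ 2)%g].
Proof.
have : h \in <[g]>%g by rewrite g_gen inE.
case/cyclePmin => k; rewrite C3_order; case: k => [|[|[|//]]] _ ->.
- by constructor 1.
- by constructor 2.
- by constructor 3.
Qed.

Lemma C3_eq (i j : nat) : (g ^+ i == g ^+ j)%g = (i == j %[mod 3]).
Proof. by rewrite eq_expg_mod_order C3_order. Qed.

Lemma C3_cube : (g ^+ 2 * g = 1)%g.
Proof. by rewrite -expgSr -C3_order expg_order. Qed.

(** The value at g is 2 although the box is there the cycle (1 2 3): the word of a permutation lists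
    the values of its inverse, so the inputs are multiplied in the order 3, 1, 2. *)
Definition turn3 (h : gT) : nat :=
  if h == g then 2 else if h == (g ^+ 2)%g then 1 else 0.

Lemma turn3_1 : turn3 1%g = 0.
Proof. by have := C3_eq 0 1; have := C3_eq 0 2; rewrite expg1 expg0 /turn3 => -> ->. Qed.

Lemma turn3_g : turn3 g = 2.
Proof. by rewrite /turn3 eqxx. Qed.

Lemma turn3_gg : turn3 (g ^+ 2)%g = 1.
Proof. by have := C3_eq 2 1; rewrite expg1 /turn3 eqxx => ->. Qed.

Lemma turn3_mul h : turn3 (h * g)%g = (turn3 h + 2) %% 3.
Proof.
by case: (C3_cases h) => ->;
  rewrite ?C3_cube ?mul1g -?expgSr ?turn3_1 ?turn3_g ?turn3_gg.
Qed.

(** The two remaining arguments of the box are compared in its three rotations abc, bca, cab: b and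
    c are reversed in the last only, a and c in the last two, a and b in the second only. *)
Definition swap3 (d : prim_op) (h : gT) : bool :=
  match d with
  | PTen => false
  | PBox1 => turn3 h == 2
  | PBox2 => turn3 h != 0
  | PBox3 => turn3 h == 1
  end.

(** The action of g rotates the arguments of the box, so the unit inserted in one position moves
    cyclically to the next. *)
Definition twist3 (d : prim_op) : prim_op :=
  match d with PTen => PTen | PBox1 => PBox2 | PBox2 => PBox3 | PBox3 => PBox1 end.

Definition sig3 : signature g.
Proof.
refine (@Signature gT g prim_op unit PTen swap3 (fun _ => turn3) (fun _ => PBox1)
  (fun _ => PBox2) (fun _ => PBox3) twist3 _ _ _ _ _ _ _ _ _ _ _ _ _).
- by case; rewrite /swap3 ?turn3_1.
- by [].
- move=> d d' H; have := H g; have := H (g ^+ 2)%g.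
  by case: d {H}; case: d'; rewrite /swap3 ?turn3_g ?turn3_gg.
- by move=> _; rewrite turn3_1.
- by move=> _; exists (g ^+ 2)%g; rewrite turn3_gg.
- by move=> _; exists g; rewrite turn3_g.
- by move=> _ h; rewrite /turn3; case: ifP => // _; case: ifP.
- by [].
- by [].
- by [].
- by case; case.
- move=> d h; case: d; rewrite /= ?turn3_mul ?turn3_g //=;
  by case: (C3_cases h) => ->; rewrite ?turn3_1 ?turn3_g ?turn3_gg.
- by move=> _ h; apply: turn3_mul.
Defined.

Lemma word_box3 h : word (box3 g h) =
  cat3 (turn3 h) [:: ord0] [:: inord 1] [:: ord_max].
Proof.
have i1 : nat_of_ord (inord 1 : 'I_3) = 1 by rewrite inordK.
rewrite ffunE /turn3; case: ifP => _; last case: ifP => _.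
- symmetry; apply: word_unique => [i|]; last by rewrite /= !permE /= i1.
  by rewrite !inE -!val_eqE /= i1; case: i => [[|[|[|]]]].
- rewrite /word invgK enum3 /= !permE; congr [:: _; _; _]; apply: val_inj => //=;
  by rewrite i1.
- by rewrite word1 enum3.
Qed.

Lemma represents_box3 : represents
  (Tern (tt : top sig3) (Leaf ord0) (Leaf (inord 1)) (Leaf ord_max) : term sig3 'I_3)
  (box3 g).
Proof. by move=> h; rewrite word_box3. Qed.

Lemma box3_term : exists t : term sig3 'I_3, represents t (box3 g).
Proof. by eexists; apply: represents_box3. Qed.

Lemma represents_otimes3 : represents
  (Bin (PTen : bop sig3) (Leaf ord0) (Bin (PTen : bop sig3) (Leaf (inord 1)) (Leaf ord_max))
    : term sig3 'I_3)
  (sval (Q_otimes3 (box3 g))).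
Proof. by move=> h; rewrite [sval _]/(P_one gT 3) ffunE word1 enum3. Qed.

Variable X : gcategory gT.

Section OfBiased.
Variable B : biased_C3 g X.

Lemma src_b3ups a b c : src (b3ups B (a, b, c)) = b3box B (a, b, c).
Proof. exact: (nat_src (b3ups_iso B) (a, b, c)). Qed.

Lemma tgt_b3ups a b c : tgt (b3ups B (a, b, c)) = teno B (teno B a b) c.
Proof. exact: (nat_tgt (b3ups_iso B) (a, b, c)). Qed.

Lemma src_prim_ups d a b : src (prim_ups B (b3ups B) d a b) = prim_ob B (b3box B) d a b.
Proof. by case: d; rewrite /= ?src_b3ups ?src_idm. Qed.

Definition ups3 (d : prim_op) (a b : X) : Mor X := prim_ups B (b3ups B) d a b.
Definition upst3 (p : unit) (a b c : X) : Mor X := b3ups B (a, b, c).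

(** The equivariance law of each primitive operation is the ternary law with one argument equal to
    the fixed object [e]. *)
Definition comparisons3 : @comparisons gT g sig3 X B.
Proof.
refine (@Comparisons gT g sig3 X B ups3 upst3 _ _ _ _ _ _ _ _ _ _ _ _).
- by case=> a b; rewrite /ups3 /= ?tgt_b3ups ?tgt_idm ?tenoel ?tenoer.
- by case=> a b; [exact: iso_id| | |]; apply: nat_is_iso (b3ups_iso B) _.
- by case=> a; rewrite /ups3 /= ?b3ups_eea ?b3ups_eae // [pten _ _]tenoel.
- by case=> a; rewrite /ups3 /= ?b3ups_eae ?b3ups_aee // [pten _ _]tenoer.
- move=> d a b c; rewrite /ups3 !src_prim_ups.
  by case/comm_squareE: (b3ups_assoc B d a b c).
- case=> a b; rewrite [swap _ _]/= /ups3 /= ?turn3_g /=.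
  + by rewrite fmor_id pten_act_ob.
  + by case/is_compE: (b3ups_act B (pe B) a b) => _ <-; rewrite pe_act [pten _ _]tenoel.
  + by case/is_compE: (b3ups_act B a (pe B) b) => _ <-; rewrite pe_act [pten _ _]tenoer.
  (* The unit is rotated to the front, so the symmetry in the ternary law is [beta e _], an
     identity; accordingly this insertion keeps the order of its arguments at g. *)
  + case/is_compE: (b3ups_act B a b (pe B)) => _ <-; rewrite pe_act.
    rewrite [pbeta _ _]beta_el cmp1l // tgt_b3ups tenoel; reflexivity.
- by move=> p a b c; rewrite /upst3 tgt_b3ups tenoA.
- by move=> p a b c; apply: nat_is_iso (b3ups_iso B) _.
- by [].
- by [].
- by [].
- by move=> p a b c; case/is_compE: (b3ups_act B a b c).
Defined.

Lemma cbin3_ten k k' : cbin comparisons3 PTen k k' = tenm B k k'.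
Proof. by rewrite /cbin /= /ups3 /= cmp1r // src_ten. Qed.

Definition realization3 : algebra (tQ_C3 g) X :=
  realization g_gen box3_term comparisons3.

Lemma evaluates_realization3 : evaluates_C3 realization3 B.
Proof.
have tf : represents _ (sval (Q_box (box3 g))) := represents_box3.
have tf' := represents_otimes3.
have ut a b : ups comparisons3 (ten sig3) a b = idm (teno B a b) by [].
have H (f : 'I_3 -> Mor X) : fmor (b3box B) (f ord0, f (inord 1), f ord_max) =
    mu_mor realization3 (Q_box (box3 g), Q_box (box3 g)) f.
  have [_ _ sq] := (iffLR (comm_squareE _ _ _ _))
    (nat_square (b3ups_iso B) (f ord0, f (inord 1), f ord_max)).
  apply: (realization_value g_gen box3_term (Q := comparisons3) tf tf) => //.
  - by rewrite [cmpr _ _ _]/= src_ctern /= /upst3 src_b3ups src_fmor.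
  - by rewrite [cmpr _ _ _]/= src_ctern /= /upst3 src_b3ups !src_idm tgt_fmor.
  - rewrite [cmpr _ _ _]/= /ctern /= /upst3 !src_idm !ten_id cmp1l ?tgt_b3ups ?tenoA //.
    by rewrite [X in _ = X ∘ _]tenA; exact: (esym sq).
split; first exact: realization_perm.
- move=> x; apply: (@idm_inj X); rewrite -mu_id -H.
  by rewrite -(fmor_id (b3box B) (x ord0, x (inord 1), x ord_max)).
- exact: H.
- move=> x; apply: (realization_value g_gen box3_term (Q := comparisons3) tf tf').
  + by rewrite /= tcat1 !bcat1.
  + by rewrite [cmpr _ _ _]/= src_ctern /= /upst3 !src_idm.
  + rewrite [cmpr _ _ _]/= !src_cbin /= /ups3 /= !src_idm !tgt_idm.
    by rewrite tgt_b3ups -tenoA.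
  + rewrite [cmpr _ _ _]/= !cbin3_ten [cmpr _ _ _]/= /ctern !tgt_idm !src_idm.
    by rewrite !ten_id !cmp1l //= /upst3 tgt_b3ups tenoA.
Qed.

End OfBiased.

Lemma biased_C3_ext (B B' : biased_C3 g X) : b3perm B = b3perm B' ->
  b3box B = b3box B' -> b3ups B = b3ups B' -> B = B'.
Proof.
case: B => [p t u h1 h2 h3 h4 h5 h6 h7 h8 h9 h10 h11 h12 h13 h14].
case: B' => [p' t' u' k1 k2 k3 k4 k5 k6 k7 k8 k9 k10 k11 k12 k13 k14] /= ee et eb.
by subst; congr BiasedC3; apply: Prop_irrelevance.
Qed.

Lemma evaluates_C3_uniq (A : algebra (tQ_C3 g) X) (B B' : biased_C3 g X) :
  evaluates_C3 A B -> evaluates_C3 A B' -> B = B'.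
Proof.
move=> [e1 e2 e3 e4] [k1 k2 k3 k4]; apply: biased_C3_ext.
- by apply: gpermutative_ext; apply: evaluates_perm_uniq e1 k1.
- apply: functor_ext => -[[f f'] f''].
  have := etrans (e3 (three f f' f'')) (esym (k3 (three f f' f''))).
  by rewrite /three /= inordK.
- apply/funext => -[[a b] c]; have := etrans (e4 (three a b c)) (esym (k4 (three a b c))).
  by rewrite /three /= inordK.
Qed.

(** * The biased structure of an algebra for the group of order three *)

Section FromAlgebra3.
Variable A : algebra (tQ_C3 g) X.
Local Notation Qb := (Q_box (box3 g)).
Local Notation Q3 := (Q_otimes3 (box3 g)).
Local Notation e := (mu_e A).
Local Notation leaf phi i := (evaluated_leaf A phi i).
Local Notation env s := (fun i => idm (nth e s i)).
Local Notation beta := (mu_beta A).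
Local Notation p := (mu_permutative A).
Local Notation tw := (@tcat gT g sig3 _ tt).
Local Notation bw d := (@bcat gT g sig3 _ d).

Definition mu_box3 := mu_functor3 A Qb.
Definition mu_ups3 (a : X * X * X) : Mor X :=
  mu_mor A (Qb, Q3) (fun i => idm (three a.1.1 a.1.2 a.2 i)).

Lemma word_otimes3 h : word (sval Q3 h) = [:: ord0; inord 1; ord_max].
Proof. by rewrite [sval _]/(P_one gT 3) ffunE word1 enum3. Qed.

Section Rules3.
Variable L : eqType.
Implicit Types (phi : L -> Mor X) (U V Z : words gT L) (d : prim_op).

Lemma flatten_box3 U V Z h : tw U V Z h =
  flatten [seq three U V Z j h | j <- word (sval Qb h)].
Proof.
have i1 : nat_of_ord (inord 1 : 'I_3) = 1 by rewrite inordK.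
rewrite word_box3 /tcat /=.
by case: (turn3 h) => [|[|r]] /=; rewrite /three /= i1 /= cats0.
Qed.

Lemma flatten_otimes3 U V Z h : wcat U (wcat V Z) h =
  flatten [seq three U V Z j h | j <- word (sval Q3 h)].
Proof. by rewrite word_otimes3 /three /= inordK //= cats0. Qed.

Lemma evaluated_box3 phi U U' V V' Z Z' k k' k'' :
  evaluated A phi U U' k -> evaluated A phi V V' k' -> evaluated A phi Z Z' k'' ->
  evaluated A phi (tw U V Z) (tw U' V' Z') (fmor mu_box3 (k, k', k'')).
Proof. by apply: evaluated3 => h; rewrite flatten_box3. Qed.

Lemma evaluated_box3_ten phi U U' V V' Z Z' k k' k'' :
  evaluated A phi U U' k -> evaluated A phi V V' k' -> evaluated A phi Z Z' k'' ->
  evaluated A phi (tw U V Z) (wcat U' (wcat V' Z')) (mu_mor A (Qb, Q3) (three k k' k'')).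
Proof. by apply: evaluated3 => h; rewrite ?flatten_box3 ?flatten_otimes3. Qed.

Lemma evaluated_ups3 (x : L -> X) U V Z a b c :
  evaluated A (fun i => idm (x i)) U U (idm a) ->
  evaluated A (fun i => idm (x i)) V V (idm b) ->
  evaluated A (fun i => idm (x i)) Z Z (idm c) ->
  evaluated A (fun i => idm (x i)) (tw U V Z) (wcat U (wcat V Z)) (mu_ups3 (a, b, c)).
Proof. by rewrite /mu_ups3 (comp_three (fun a => idm a)); apply: evaluated_box3_ten. Qed.

Lemma tw_nil1 U V : tw (fun=> [::]) U V = bw PBox1 U V.
Proof. by apply/funext => h; rewrite tcat_nil1. Qed.

Lemma tw_nil2 U V : tw U (fun=> [::]) V = bw PBox2 U V.
Proof. by apply/funext => h; rewrite tcat_nil2. Qed.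

Lemma tw_nil3 U V : tw U V (fun=> [::]) = bw PBox3 U V.
Proof. by apply/funext => h; rewrite tcat_nil3. Qed.

Lemma evaluated_prim phi d U U' V V' k k' :
  evaluated A phi U U' k -> evaluated A phi V V' k' ->
  evaluated A phi (bw d U V) (bw d U' V') (prim_mor p mu_box3 d k k').
Proof.
move=> E E'; have E0 := evaluated_e A phi; case: d.
- exact: evaluated_ten.
- by rewrite -!tw_nil1; apply: evaluated_box3.
- by rewrite -!tw_nil2; apply: evaluated_box3.
- by rewrite -!tw_nil3; apply: evaluated_box3.
Qed.

Lemma evaluated_prim_ups (x : L -> X) d U V a b :
  evaluated A (fun i => idm (x i)) U U (idm a) ->
  evaluated A (fun i => idm (x i)) V V (idm b) ->
  evaluated A (fun i => idm (x i)) (bw d U V) (wcat U V) (prim_ups p mu_ups3 d a b).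
Proof.
move=> E E'; have E0 := evaluated_e A (fun i => idm (x i)); case: d.
- by have := evaluated_ten E E'; rewrite mu_ten_id.
- by rewrite -tw_nil1; apply: (evaluated_ups3 E0 E E').
- by rewrite -tw_nil2; apply: (evaluated_ups3 E E0 E').
- rewrite -tw_nil3; have := evaluated_ups3 E E' E0.
  by have -> : wcat V (fun=> [::]) = V by apply/funext => h; rewrite /wcat cats0.
Qed.

End Rules3.

Lemma mu_box3_id a b c : fmor mu_box3 (idm a, idm b, idm c) = idm (mu_box3 (a, b, c)).
Proof. exact: (fmor_id mu_box3 (a, b, c)). Qed.

Lemma prim_mor_id d a b :
  prim_mor p mu_box3 d (idm a) (idm b) = idm (prim_ob p mu_box3 d a b).
Proof. by case: d; [exact: mu_ten_id|exact: mu_box3_id..]. Qed.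

Lemma mu_prim_el d f : prim_mor p mu_box3 d (idm (pe p)) f = f.
Proof.
pose phi (i : nat) := f.
apply: (evaluated_eq _ _ _ (evaluated_prim d (evaluated_e A phi) (leaf phi 0)) (leaf phi 0)).
- by rewrite bcat1.
- by move=> h; rewrite bcat_nill.
- by move=> h; rewrite bcat_nill.
Qed.

Lemma mu_prim_er d f : prim_mor p mu_box3 d f (idm (pe p)) = f.
Proof.
pose phi (i : nat) := f.
apply: (evaluated_eq _ _ _ (evaluated_prim d (leaf phi 0) (evaluated_e A phi)) (leaf phi 0)).
- by rewrite bcat1.
- by move=> h; rewrite bcat_nilr.
- by move=> h; rewrite bcat_nilr.
Qed.

Lemma mu_prim_assoc d f f' f'' :
  prim_mor p mu_box3 d f (prim_mor p mu_box3 d f' f'') =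
  prim_mor p mu_box3 d (prim_mor p mu_box3 d f f') f''.
Proof.
pose phi := nth f [:: f; f'; f''].
apply: (evaluated_eq _ _ _
  (evaluated_prim d (leaf phi 0) (evaluated_prim d (leaf phi 1) (leaf phi 2)))
  (evaluated_prim d (evaluated_prim d (leaf phi 0) (leaf phi 1)) (leaf phi 2))).
- by rewrite !bcat1.
- by move=> h; rewrite bcatA.
- by move=> h; rewrite bcatA.
Qed.

Lemma mu_ups3_eea a : mu_ups3 (e, e, a) = idm a.
Proof.
pose x := [:: a]; have E := evaluated_e A (env x).
apply: (evaluated_eq _ _ _ (evaluated_ups3 E E (leaf (env x) 0)) (leaf (env x) 0)) => //.
- by rewrite tcat1.
- by move=> h; rewrite tcat_nil1 // bcat_nill.
Qed.

Lemma mu_ups3_eae a : mu_ups3 (e, a, e) = idm a.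
Proof.
pose x := [:: a]; have E := evaluated_e A (env x).
apply: (evaluated_eq _ _ _ (evaluated_ups3 E (leaf (env x) 0) E) (leaf (env x) 0)) => //.
- by rewrite tcat1.
- by move=> h; rewrite tcat_nil1 // bcat_nilr.
Qed.

Lemma mu_ups3_aee a : mu_ups3 (a, e, e) = idm a.
Proof.
pose x := [:: a]; have E := evaluated_e A (env x).
apply: (evaluated_eq _ _ _ (evaluated_ups3 (leaf (env x) 0) E E) (leaf (env x) 0)) => //.
- by rewrite tcat1.
- by move=> h; rewrite tcat_nil2 // bcat_nilr.
Qed.

Lemma mu_otimes3 k k' k'' : mu_mor A (Q3, Q3) (three k k' k'') =
  fmor (mu_ten A) (k, fmor (mu_ten A) (k', k'')).
Proof.
pose phi := nth k [:: k; k'; k''].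
have := evaluated_ten (leaf phi 0) (evaluated_ten (leaf phi 1) (leaf phi 2)).
apply: evaluated_uniq => //.
by apply: evaluated3 (leaf phi 0) (leaf phi 1) (leaf phi 2) => h; rewrite flatten_otimes3.
Qed.

Lemma mu_otimes3_ob a b c :
  mu_ob A Q3 (three a b c) = mu_ten A (mu_ten A (a, b), c).
Proof.
apply: (@idm_inj X); rewrite -!mu_ten_id -mu_ten_assoc -mu_otimes3 -mu_id.
by rewrite (comp_three (fun a => idm a)).
Qed.

Lemma src_mu_ups3 a b c : src (mu_ups3 (a, b, c)) = mu_box3 (a, b, c).
Proof. by rewrite src_mu; congr mu_ob; apply/funext => i; rewrite /= src_idm. Qed.

Lemma tgt_mu_ups3 a b c : tgt (mu_ups3 (a, b, c)) = mu_ten A (mu_ten A (a, b), c).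
Proof.
rewrite tgt_mu -mu_otimes3_ob; congr mu_ob; apply/funext => i.
by rewrite /= tgt_idm.
Qed.

Lemma mu_natural3 : natural_iso mu_box3
  (comp_functor (mu_ten A) (prod_functor (mu_ten A) (id_functor X))) mu_ups3.
Proof.
split=> [[[a b] c]|[[a b] c]|[[k k'] k'']|[[a b] c]].
- exact: src_mu_ups3.
- exact: tgt_mu_ups3.
- have eG : fmor (comp_functor (mu_ten A) (prod_functor (mu_ten A) (id_functor X)))
      (k, k', k'') = mu_mor A (Q3, Q3) (three k k' k'').
    by rewrite mu_otimes3 mu_ten_assoc.
  rewrite eG; apply/comm_squareE; split.
  + by rewrite src_mu tgt_mu_ups3 -mu_otimes3_ob -(comp_three (fun k => src k)).
  + by rewrite src_mu_ups3 [RHS](tgt_fmor mu_box3 (k, k', k'')).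
  + have := mu_natural A Qb Q3 (three k k' k'').
    have e1 : (fun i => idm (src (three k k' k'' i))) =
        fun i => idm (three (src k) (src k') (src k'') i).
      by apply/funext => -[[|[|[|//]]] q].
    have e2 : (fun i => idm (tgt (three k k' k'' i))) =
        fun i => idm (three (tgt k) (tgt k') (tgt k'') i).
      by apply/funext => -[[|[|[|//]]] q].
    by rewrite e1 e2.
- exact: mu_iso.
Qed.

Lemma src_mu_prim_ups d a b : src (prim_ups p mu_ups3 d a b) = prim_ob p mu_box3 d a b.
Proof. by case: d; rewrite /= ?src_mu_ups3 ?src_idm. Qed.

Lemma tgt_mu_prim_ups d a b : tgt (prim_ups p mu_ups3 d a b) = mu_ten A (a, b).
Proof. by case: d; rewrite /= ?tgt_mu_ups3 ?tgt_idm ?mu_ten_el_ob ?mu_ten_er_ob. Qed.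

Lemma mu_prim_ups_assoc d a b c : comm_square
  (fmor (mu_ten A) (idm a, prim_ups p mu_ups3 d b c))
  (prim_ups p mu_ups3 d a (prim_ob p mu_box3 d b c))
  (fmor (mu_ten A) (prim_ups p mu_ups3 d a b, idm c))
  (prim_ups p mu_ups3 d (prim_ob p mu_box3 d a b) c).
Proof.
apply/comm_squareE; split.
- by rewrite src_mu_ten tgt_mu_prim_ups src_idm src_mu_prim_ups.
- by rewrite src_mu_ten tgt_mu_prim_ups src_idm src_mu_prim_ups.
pose x := env [:: a; b; c].
have H1 := evaluated_prim d (leaf x 1) (leaf x 2); rewrite prim_mor_id in H1.
have H2 := evaluated_prim d (leaf x 0) (leaf x 1); rewrite prim_mor_id in H2.
have E1 := evaluated_prim_ups d (leaf x 0) H1; have E2 := evaluated_prim_ups d H2 (leaf x 2).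
have E3 := evaluated_ten (leaf x 0) (evaluated_prim_ups d (leaf x 1) (leaf x 2)).
have E4 := evaluated_ten (evaluated_prim_ups d (leaf x 0) (leaf x 1)) (leaf x 2).
have F1 := evaluated_cmp_id _ E3 E1; have F2 := evaluated_cmp_id _ E4 E2.
apply: (evaluated_eq _ _ _ (F1 _) (F2 _)); rewrite ?/wcat ?bcat1 //.
by move=> h; rewrite bcatA.
Qed.

(** The case of three leaves of [wd_translate]; it supplies the words for both equivariance axioms
    of the box. *)
Lemma tcat3_act (L : Type) (i j k : L) h :
  tw (fun=> [:: i]) (fun=> [:: j]) (fun=> [:: k]) (h * g)%g =
  tw (fun=> [:: k]) (fun=> [:: i]) (fun=> [:: j]) h.
Proof.
exact: (esym (wd_translate (Tern (tt : top sig3) (Leaf i) (Leaf j) (Leaf k)) h)).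
Qed.

Lemma mu_box3_act f f' f'' : fmor (gcat_act g) (fmor mu_box3 (f, f', f'')) =
  fmor mu_box3 (fmor (gcat_act g) f'', fmor (gcat_act g) f, fmor (gcat_act g) f').
Proof.
pose phi := nth f [:: f; f'; f'']; pose gphi := fmor (gcat_act g) \o phi.
apply: (evaluated_eq _ _ _
  (evaluated_act g (evaluated_box3 (leaf phi 0) (leaf phi 1) (leaf phi 2)))
  (evaluated_box3 (leaf gphi 2) (leaf gphi 0) (leaf gphi 1))).
- by rewrite tcat3_act tcat1.
- by move=> h; rewrite tcat3_act.
- by move=> h; rewrite tcat3_act.
Qed.

Lemma mu_ups3_act a b c : is_comp
  (beta (gcat_act g c, mu_ten A (gcat_act g a, gcat_act g b)))
  (mu_ups3 (gcat_act g c, gcat_act g a, gcat_act g b))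
  (fmor (gcat_act g) (mu_ups3 (a, b, c))).
Proof.
apply/is_compE; split.
  by rewrite src_mu_beta tgt_mu_ups3 mu_ten_assoc_ob.
pose x := nth e [:: a; b; c]; pose y i := idm (gcat_act g (x i)).
pose z i := idm (x i).
have E1 := evaluated_act_id g (evaluated_ups3 (leaf z 0) (leaf z 1) (leaf z 2)).
have H := evaluated_ten (leaf y 0) (leaf y 1); rewrite mu_ten_id in H.
have E2 := evaluated_cmp_id _ (evaluated_beta (leaf y 2) H)
  (evaluated_ups3 (leaf y 2) (leaf y 0) (leaf y 1)).
apply: (evaluated_eq _ _ _ (E2 _) E1) => //.
- by rewrite tcat1.
- by move=> h; rewrite tcat3_act.
Qed.

Definition biased3 : biased_C3 g X.
Proof.
refine (@BiasedC3 gT g X (mu_gpermutative A) mu_box3 mu_ups3 mu_natural3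
  _ mu_prim_el _ mu_prim_er mu_ups3_eea mu_ups3_eae mu_ups3_aee _ mu_prim_assoc
  mu_prim_ups_assoc _ mu_box3_act mu_ups3_act).
- by move=> d a; apply: (@idm_inj X); rewrite -prim_mor_id mu_prim_el.
- by move=> d a; apply: (@idm_inj X); rewrite -prim_mor_id mu_prim_er.
- by move=> d a b c; apply: (@idm_inj X); rewrite -!prim_mor_id mu_prim_assoc.
- move=> a b c; apply: (@idm_inj X); rewrite -[LHS]fmor_id -!mu_box3_id mu_box3_act.
  by rewrite !fmor_id.
Defined.

Lemma evaluates_biased3 : evaluates_C3 A biased3.
Proof.
split; first exact: evaluates_mu_permutative.
- by move=> x /=; rewrite three_eta.
- by move=> f /=; rewrite three_eta.
- by move=> x /=; rewrite /mu_ups3 /= three_eta.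
Qed.

(** [mu_cmp] splits the morphism from the box to the threefold tensor product into its value at
    identities of the sources and a tensor product of the three morphisms, which is the form of
    [ctern]. *)
Lemma ctern_biased3 k k' k'' :
  ctern (comparisons3 biased3) tt k k' k'' = mu_mor A (Qb, Q3) (three k k' k'').
Proof.
have sk i : src (three k k' k'' i) = tgt (idm (three (src k) (src k') (src k'') i)).
  by rewrite tgt_idm -(comp_three (fun k => src k)).
have := mu_cmp A Qb Q3 Q3 sk; rewrite mu_otimes3 => H; apply: (etrans (esym H)).
congr mu_mor; apply/funext => -[[|[|[|//]]] q]; by rewrite /three /= cmp1r.
Qed.

Lemma biased3_generated : generated_by A (comparisons3 biased3).
Proof.
have T (L : eqType) (phi : L -> Mor X) U U' V V' Z Z' k k' k'' :
    evaluated A phi U U' k -> evaluated A phi V V' k' -> evaluated A phi Z Z' k'' ->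
    evaluated A phi (tw U V Z) (wcat U' (wcat V' Z')) (ctern (comparisons3 biased3) tt k k' k'').
  by rewrite ctern_biased3; apply: evaluated_box3_ten.
split=> /=.
- by move=> L phi; apply: evaluated_e.
- by move=> L phi U U' V V' k k'; apply: evaluated_ten.
- by move=> L x U V a b; apply: evaluated_beta.
- move=> L phi d U U' V V' k k' E E'; have E0 := evaluated_e A phi; case: d.
  + have := evaluated_ten E E'; congr evaluated.
    exact: (esym (cbin3_ten biased3 k k')).
  + rewrite -tw_nil1 -[cbin _ _ _ _](ctern_e1 (comparisons3 biased3) tt).
    exact: (T _ _ _ _ _ _ _ _ _ _ _ E0 E E').
  + rewrite -tw_nil2 -[cbin _ _ _ _](ctern_e2 (comparisons3 biased3) tt).
    exact: (T _ _ _ _ _ _ _ _ _ _ _ E E0 E').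
  + rewrite -tw_nil3 -[cbin _ _ _ _](ctern_e3 (comparisons3 biased3) tt).
    have := T _ _ _ _ _ _ _ _ _ _ _ E E' E0.
    (* The target word of the third insertion ends in an empty word, which does not disappear by
       computation as in the other two cases. *)
    by have -> : wcat V' (fun=> [::]) = V' by apply/funext => h; rewrite /wcat cats0.
- by move=> L phi [] U U' V V' Z Z' k k' k''; apply: T.
Qed.

Lemma realization3_unique : A = realization3 biased3.
Proof. exact: realization_unique biased3_generated. Qed.

End FromAlgebra3.

Lemma biased3_bij : bijective biased3.
Proof.
exists realization3 => [A|B]; first by rewrite -realization3_unique.
exact: evaluates_C3_uniq (evaluates_biased3 _) (evaluates_realization3 B).
Qed.

End C3.

Theorem theorem4p3 (gT : finGroupType) (g : gT) (g_gen : <[g]>%g = [set: gT]) :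
  (#|gT| = 2 -> forall X : gcategory gT,
     exists Phi : algebra (tQ_C2 g) X -> biased_C2 g X,
       bijective Phi /\ forall A, evaluates_C2 A (Phi A)) /\
  (#|gT| = 3 -> forall X : gcategory gT,
     exists Phi : algebra (tQ_C3 g) X -> biased_C3 g X,
       bijective Phi /\ forall A, evaluates_C3 A (Phi A)).
Proof.
split=> card_gT X.
- exists (biased2 g_gen card_gT (X := X)); split; first exact: biased2_bij.
  exact: evaluates_biased2.
- exists (biased3 g_gen card_gT (X := X)); split; first exact: biased3_bij.
  exact: evaluates_biased3.
Qed.
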